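(* Let $V$ be the rank two fermion vertex operator superalgebra and let $f=e^{2\pi i\alpha a(0)}$, $g=e^{2\pi i\beta a(0)}$ with $\alpha,\beta\in\mathbb R$. The partition function $Z_V\!\left[\begin{array}{c}f\\ g\end{array}\right](\tau)$ transforms under $\gamma\in SL(2,\mathbb Z)$ with a multiplier $\varepsilon_\gamma\!\left[\begin{array}{c}f\\ g\end{array}\right]\in U(1)$: $$Z_V\!\left(\gamma.\!\left[\begin{array}{c}f\\ g\end{array}\right]\right)\!(\gamma.\tau)=\varepsilon_\gamma\!\left[\begin{array}{c}f\\ g\end{array}\right]Z_V\!\left[\begin{array}{c}f\\ g\end{array}\right](\tau),$$ where $\varepsilon_\gamma\!\left[\begin{array}{c}f\\ g\end{array}\right]$ is generated (via $\varepsilon_{\gamma_1\gamma_2}\!\left[\begin{array}{c}f\\ g\end{array}\right]=\varepsilon_{\gamma_1}\!\left(\gamma_2.\!\left[\begin{array}{c}f\\ g\end{array}\right]\right)\varepsilon_{\gamma_2}\!\left[\begin{array}{c}f\\ g\end{array}\right]$) from $$\varepsilon_S\!\left[\begin{array}{c}f\\ g\end{array}\right]=\exp\big(2\pi i(\tfrac12+\beta)(\tfrac12-\alpha)\big),\qquad \varepsilon_T\!\left[\begin{array}{c}f\\ g\end{array}\right]=\exp\big(\pi i(\beta(\beta+1)+\tfrac16)\big),$$ for $S=\left(\begin{array}{cc}0&1\\-1&0\end{array}\right)$ and $T=\left(\begin{array}{cc}1&1\\0&1\end{array}\right)$.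
   Context: The rank two fermion VOSA $V$ is generated by odd vectors $\psi^\pm$ with modes $\psi^\pm(n)$ in $Y(\psi^\pm,z)=\sum_{n\in\mathbb Z}\psi^\pm(n)z^{-n-1}$, (anti)commutators $[\psi^+(m),\psi^-(n)]=\delta_{m,-n-1}$, $[\psi^\pm(m),\psi^\pm(n)]=0$, $\psi^\pm(k)\mathbf1=0$ for $k\ge0$, and Fock basis $\psi^+(-k_1)\cdots\psi^+(-k_s)\psi^-(-l_1)\cdots\psi^-(-l_t)\mathbf 1$ with $1\le k_1<\dots<k_s$, $1\le l_1<\dots<l_t$. Conformal vector $\omega=\frac12[\psi^+(-2)\psi^-(-1)+\psi^-(-2)\psi^+(-1)]\mathbf 1$ (central charge $1$, $L(0)$-weight of $\psi^\pm$ is $\frac12$). Heisenberg vector $a=\psi^+(-1)\psi^-(-1)\mathbf 1$, $a(0)\psi^\pm=\pm\psi^\pm$; parity automorphism $\sigma=e^{\pi ia(0)}$. $\mathrm{STr}_V(X)=\mathrm{Tr}_{V_{\bar 0}}(X)-\mathrm{Tr}_{V_{\bar1}}(X)$. With $\kappa=\beta+\frac12$, $h=\kappa a$, $\sigma g=e^{2\pi ih(0)}$, $\theta=e^{-2\pi i\alpha}$, $q=e^{2\pi i\tau}$, the orbifold $\sigma g$-twisted partition function is $$Z_V\!\left[\begin{array}{c}f\\ g\end{array}\right](\tau)=\mathrm{STr}_V\big(f\,q^{L(0)-\kappa a(0)+\kappa^2/2-1/24}\big)=q^{\kappa^2/2-1/24}\prod_{l\ge1}(1-\theta^{-1}q^{l-\frac12-\kappa})(1-\theta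 q^{l-\frac12+\kappa}).$$ (It depends on the chosen real pair $(\alpha,\beta)$, which the symbol $\left[\begin{array}{c}f\\ g\end{array}\right]$ stands for.) For $\gamma=\left(\begin{array}{cc}a&b\\ c&d\end{array}\right)\in SL(2,\mathbb Z)$: $\gamma.\tau=\frac{a\tau+b}{c\tau+d}$ and $\gamma.\left[\begin{array}{c}f\\ g\end{array}\right]=\left[\begin{array}{c}f^ag^b\\ f^cg^d\end{array}\right]$, i.e. $(\alpha,\beta)\mapsto(a\alpha+b\beta,\,c\alpha+d\beta)$ (here $a,b,c,d$ are the matrix entries). *)

(* Defs.v *)
From HB Require Import structures.
From mathcomp Require Export all_boot all_order all_algebra complex.
From mathcomp Require Export all_classical all_reals all_analysis.
From mathcomp Require Export summability.
Export Order.TTheory GRing.Theory Num.Theory numFieldNormedType.Exports.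

Set Implicit Arguments.
Unset Strict Implicit.
Unset Printing Implicit Defensive.

Local Open Scope classical_set_scope.
Local Open Scope ring_scope.
Local Open Scope complex_scope.

Definition cexp (R : realType) (z : R[i]) : R[i] :=
  (expR (complex.Re z))%:C * (cos (complex.Im z) +i* sin (complex.Im z)).

Definition upper_half_plane (R : realType) : set R[i] :=
  [set tau | 0 < complex.Im tau].

(* The generalized binomial coefficient "m choose j" for m in Z. *)
Definition binz (F : fieldType) (m : int) (j : nat) : F :=
  (\prod_(i < j) (m%:~R - i%:R)) / (j`!)%:R.

Section LinearAlgebra.
Variables (F : fieldType) (V : lmodType F).

Definition subspace (U : set V) : Prop :=
  U 0 /\ forall (x : F) (u v : V), U u -> U v -> U (x *: u + v).

Definition is_basis (I : choiceType) (D : set I) (b : I -> V) : Prop :=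
  forall v : V, exists! c : I -> F,
    [/\ finite_set [set i | c i != 0],
        [set i | c i != 0] `<=` D &
        v = \sum_(i \in D) c i *: b i].

Definition is_finite_basis (U : set V) (n : nat) (e : 'I_n -> V) : Prop :=
  (forall i, U (e i)) /\
  (forall v, U v -> exists! c : 'I_n -> F, v = \sum_(i < n) c i *: e i).

Definition finite_dimensional (U : set V) : Prop :=
  exists (n : nat) (e : 'I_n -> V), is_finite_basis U e.

Definition is_trace_on (U : set V) (X : V -> V) (t : F) : Prop :=
  exists (n : nat) (e : 'I_n -> V) (M : 'M[F]_n),
    [/\ is_finite_basis U e,
        (forall i, X (e i) = \sum_(j < n) M i j *: e j) &
        t = \tr M].

(* Meaningful when U is finite-dimensional and stable under the linear X. *)
Definition trace_on (U : set V) (X : V -> V) : F :=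
  xget 0 [set t | is_trace_on U X t].

End LinearAlgebra.

(* Vertex operator superalgebras over C, with modes Y(u,z) = sum_n u(n) z^(-n-1):
   vparity W false and vparity W true are the even and odd subspaces,
   vmode W u n v is u(n)v. *)
Record vosa (R : realType) (V : lmodType R[i]) := Vosa {
  vparity : bool -> set V;
  vmode : V -> int -> V -> V;
  vvac : V;
  vconf : V;
  vcharge : R[i];

  vparity_subspace : forall p, subspace (vparity p);
  vparity_add : forall v, exists v0 v1,
        [/\ vparity false v0, vparity true v1 & v = v0 + v1];
  vparity_cap : forall v, vparity false v -> vparity true v -> v = 0;

  vmode_linearl : forall n (x : R[i]) u u' v,
        vmode (x *: u + u') n v = x *: vmode u n v + vmode u' n v;
  vmode_linearr : forall n (x : R[i]) u v v',
        vmode u n (x *: v + v') = x *: vmode u n v + vmode u n v';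
  vmode_parity : forall p p' n u v, vparity p u -> vparity p' v ->
        vparity (p (+) p') (vmode u n v);
  vmode_trunc : forall u v, exists N : int, forall n, N <= n -> vmode u n v = 0;

  vvac_even : vparity false vvac;
  vmode_vvac : forall n v, vmode vvac n v = if n == -1 then v else 0;
  vmode_creation : forall u, vmode u (-1) vvac = u;
  vmode_annihilation : forall u n, 0 <= n -> vmode u n vvac = 0;

  (* Jacobi identity, in components (Borcherds identity) *)
  vmode_borcherds : forall p p' u v w (k m n : int), vparity p u -> vparity p' v ->
        \sum_(j \in [set: nat])
           binz R[i] m j *: vmode (vmode u (k + j%:Z) v) (m + n - j%:Z) w
        = \sum_(j \in [set: nat])
           ((-1) ^+ j * binz R[i] k j) *:
             (vmode u (m + k - j%:Z) (vmode v (n + j%:Z) w)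
              - ((-1) ^+ (p && p') * (-1) ^ k) *:
                  vmode v (n + k - j%:Z) (vmode u (m + j%:Z) w));

  (* Virasoro algebra, with L(n) = omega(n+1) *)
  vconf_even : vparity false vconf;
  vconf_virasoro : forall (m n : int) v,
        vmode vconf (m + 1) (vmode vconf (n + 1) v)
        - vmode vconf (n + 1) (vmode vconf (m + 1) v)
        = (m - n)%:~R *: vmode vconf (m + n + 1) v
          + (if m + n == 0 then ((m ^+ 3 - m)%:~R / 12) * vcharge else 0) *: v;
  vconf_derivative : forall u n v, (* L(-1)-derivative property *)
        vmode (vmode vconf 0 u) n v = - n%:~R *: vmode u (n - 1) v;

  (* V is the sum of its L(0)-eigenspaces V_r, r real and bounded below *)
  vconf_graded : exists r0 : R, forall v, exists (d : nat) (r : 'I_d -> R) (w : 'I_d -> V),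
        [/\ forall i, r0 <= r i,
            forall i, vmode vconf 1 (w i) = (r i)%:C *: w i &
            v = \sum_(i < d) w i];
  vconf_findim : forall r : R,
        finite_dimensional [set v | vmode vconf 1 v = r%:C *: v]
}.

Section Fermion.
Variables (R : realType) (V : lmodType R[i]) (W : vosa V).

Definition Lzero (v : V) : V := vmode W (vconf W) 1 v.

Definition weight_space (r : R) : set V := [set v | Lzero v = r%:C *: v].

(* psi^+(-k_1) ... psi^+(-k_s) psi^-(-l_1) ... psi^-(-l_t) 1 *)
Definition fock (psip psim : V) (kl : seq nat * seq nat) : V :=
  foldr (fun k v => vmode W psip (- k%:Z) v)
    (foldr (fun l v => vmode W psim (- l%:Z) v) (vvac W) kl.2) kl.1.

Definition fock_index : set (seq nat * seq nat) :=
  [set kl | path ltn 0%N kl.1 /\ path ltn 0%N kl.2].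

Definition rank_two_fermion (psip psim : V) : Prop :=
  [/\ vparity W true psip /\ vparity W true psim,
      forall (m n : int) v,
        [/\ vmode W psip m (vmode W psim n v) + vmode W psim n (vmode W psip m v)
              = if m == - n - 1 then v else 0,
            vmode W psip m (vmode W psip n v)
              + vmode W psip n (vmode W psip m v) = 0 &
            vmode W psim m (vmode W psim n v)
              + vmode W psim n (vmode W psim m v) = 0],
      is_basis fock_index (fock psip psim),
      vconf W = 2^-1 *: (vmode W psip (- 2%:Z) (vmode W psim (-1) (vvac W))
                         + vmode W psim (- 2%:Z) (vmode W psip (-1) (vvac W))) &
      vcharge W = 1].

Definition heisenberg (psip psim : V) : V :=
  vmode W psip (-1) (vmode W psim (-1) (vvac W)).

(* The exponential of a diagonalizable operator A: the linear map acting as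
   e^x on the x-eigenspace of A. *)
Definition is_opexp (A E : V -> V) : Prop :=
  linear E /\ forall (x : R[i]) v, A v = x *: v -> E v = cexp x *: v.

Definition opexp (A : V -> V) : V -> V := xget (id : V -> V) [set E | is_opexp A E].

Definition supertrace_weight (X : V -> V) (r : R) : R[i] :=
  trace_on (weight_space r `&` vparity W false) X
  - trace_on (weight_space r `&` vparity W true) X.

(* STr_V(X), for X stable on the finite-dimensional weight spaces: the
   unconditional sum over all weights r of the supertrace of X on V_r. *)
Definition supertrace (X : V -> V) : R[i] :=
  sum (supertrace_weight X : R -> R[i]^o).

(* f = e^(2 pi i alpha a(0)) *)
Definition fermion_aut (psip psim : V) (alpha : R) : V -> V :=
  opexp (fun v => (2 * pi * alpha)%:C * 'i%C *:
                    vmode W (heisenberg psip psim) 0 v).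

(* q^(L(0) - kappa a(0) + kappa^2/2 - 1/24), with q = e^(2 pi i tau) and
   kappa = beta + 1/2 *)
Definition twisted_qL0 (psip psim : V) (beta : R) (tau : R[i]) : V -> V :=
  let kappa := beta + 2^-1 in
  opexp (fun v => (2 * pi)%:C * 'i%C * tau *:
    (Lzero v - kappa%:C *: vmode W (heisenberg psip psim) 0 v
     + (kappa ^+ 2 / 2 - 24^-1)%:C *: v)).

(* The pair (alpha, beta) stands for (f, g). *)
Definition partition_function (psip psim : V) (fg : R * R) (tau : R[i]) : R[i] :=
  supertrace (fermion_aut psip psim fg.1 \o twisted_qL0 psip psim fg.2 tau).

End Fermion.

Section Modular.
Variable R : realType.

Definition moebius (g : 'M[int]_2) (tau : R[i]) : R[i] :=
  ((g 0 0)%:~R * tau + (g 0 1)%:~R) / ((g 1 0)%:~R * tau + (g 1 1)%:~R).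

Definition twist_act (g : 'M[int]_2) (fg : R * R) : R * R :=
  ((g 0 0)%:~R * fg.1 + (g 0 1)%:~R * fg.2,
   (g 1 0)%:~R * fg.1 + (g 1 1)%:~R * fg.2).

Definition matS : 'M[int]_2 :=
  \matrix_(i < 2, j < 2)
    if (i == 0) && (j == 1) then 1 else if (i == 1) && (j == 0) then -1 else 0.

Definition matT : 'M[int]_2 :=
  \matrix_(i < 2, j < 2) if (i == 1) && (j == 0) then 0 else 1.

(* eps is only considered on SL(2,Z) = {g : 'M[int]_2 | \det g = 1}. *)
Definition multiplier_system (eps : 'M[int]_2 -> R * R -> R[i]) : Prop :=
  [/\ forall g1 g2 fg, \det g1 = 1 -> \det g2 = 1 ->
        eps (g1 *m g2) fg = eps g1 (twist_act g2 fg) * eps g2 fg,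
      forall alpha beta, eps matS (alpha, beta)
        = cexp ((2 * pi * (2^-1 + beta) * (2^-1 - alpha))%:C * 'i%C) &
      forall alpha beta, eps matT (alpha, beta)
        = cexp ((pi * (beta * (beta + 1) + 6^-1))%:C * 'i%C)].

End Modular.

(* Main.v *)
(** On the Fock basis [L(0)] and [a(0)] are diagonal, so the supertrace is
    [q^(kappa^2/2-1/24) prod_l (1 - w q^l)(1 - q^(l+1)/w)] with [w = e^(2 pi i z)],
    [z = alpha - beta tau]; the rule for [T] can be read off from this product.

    For [S], let [phi tau z] be the odd theta product. If [z1^2+z2^2 = z3^2+z4^2], then
    the product of [(w^2-z1^2)(w^2-z2^2)/((w^2-z3^2)(w^2-z4^2))] over the lattice points
    [w] converges absolutely, the factors being [1 + O(|w|^-4)]. Multiplied by rows and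
    by columns, with the sine product, it gives the same quotient of values of [phi] for
    [tau] and for [-1/tau]. Hence [k(z) = e^(-pi i z^2/tau) phi(-1/tau, z/tau)/phi(tau, z)]
    satisfies [k(z1) k(z2) = k(z3) k(z4)]. As [k] is even and 1-periodic, choosing
    [z4 = z2 + n] shows that [k] is constant. The products of the partition function over
    the three 2-torsion points and over four 3-torsion points are the constants [2] and
    [1 - e^(2 pi i/3)], and [S] permutes these points up to sign and translation; so the
    cube and the fourth power of the remaining constant are 1.

    The multiplier is a coboundary times a character of SL(2,Z). *)
Require Import Defs.
From mathcomp Require Import ring lra zify finmap.

Set Implicit Arguments.
Unset Strict Implicit.
Unset Printing Implicit Defensive.

Local Open Scope classical_set_scope.
Local Open Scope ring_scope.
Local Open Scope complex_scope.

(** * Modulus, exponential and limits of complex numbers *)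

Section ComplexAnalysis.
Variable R : realType.
Implicit Types (x y z : R[i]) (u v : nat -> R[i]).

(** The treatment of S uses limits of sequences only, neither holomorphy nor Poisson summation. The
    lattice product for a single theta value converges only conditionally, and passing from rows to
    columns is what creates the Gaussian e^(pi i z^2/tau). The relation z1^2+z2^2 = z3^2+z4^2
    removes the 1/w^2 term from the quotient of four factors, so that the exchange becomes harmless;
    the same relation makes the four Gaussians cancel.

    The multiplier cannot be read off from the partition function at each pair: for integral (alpha,
    beta) that function vanishes for every tau. Therefore the dependence on (alpha, beta) is put
    into an explicit phase, and each matrix keeps one unknown constant valid for all pairs, which a
    single nonzero value determines. Uniqueness of this constant yields the cocycle rule, so no
    relations of SL(2,Z) have to be checked on the values of the multiplier; only generation by S
    and T enters. *)

Definition cmod z : R := ComplexField.Normc.normc z.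

Lemma cmodE z : cmod z = Num.sqrt (complex.Re z ^+ 2 + complex.Im z ^+ 2).
Proof. by case: z. Qed.

Lemma cmod_ge0 z : 0 <= cmod z.
Proof. by rewrite cmodE sqrtr_ge0. Qed.

Lemma cmodM x y : cmod (x * y) = cmod x * cmod y.
Proof. exact: ComplexField.Normc.normcM. Qed.

Lemma cmod0 : cmod 0 = 0. Proof. exact: ComplexField.Normc.normc0. Qed.

Lemma cmod1 : cmod 1 = 1. Proof. exact: ComplexField.Normc.normc1. Qed.

Lemma cmodN z : cmod (- z) = cmod z. Proof. exact: normcN. Qed.

Lemma cmodV z : cmod z^-1 = (cmod z)^-1. Proof. exact: ComplexField.Normc.normcV. Qed.

Lemma cmod_eq0 z : (cmod z == 0) = (z == 0).
Proof.
apply/eqP/eqP => [|->]; last exact: cmod0.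
exact: ComplexField.Normc.eq0_normc.
Qed.

Lemma cmod_gt0 z : (0 < cmod z) = (z != 0).
Proof. by rewrite lt_def cmod_ge0 andbT cmod_eq0. Qed.

Lemma cmodD x y : cmod (x + y) <= cmod x + cmod y. Proof. exact: le_normcD. Qed.

Lemma cmodBC x y : cmod (x - y) = cmod (y - x).
Proof. by rewrite -cmodN opprB. Qed.

Lemma cmodB_ge x y : cmod x - cmod y <= cmod (x - y).
Proof. by rewrite lerBlDr; apply: le_trans (cmodD _ _); rewrite subrK. Qed.

Lemma cmodX z n : cmod (z ^+ n) = cmod z ^+ n.
Proof. by elim: n => [|n IH]; rewrite ?expr0 ?cmod1 // !exprS cmodM IH. Qed.

Lemma cmod_prod (I : Type) (r : seq I) (P : pred I) (F : I -> R[i]) :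
  cmod (\prod_(i <- r | P i) F i) = \prod_(i <- r | P i) cmod (F i).
Proof. exact: (big_morph cmod cmodM cmod1). Qed.

Lemma cmod_sum (I : Type) (r : seq I) (P : pred I) (F : I -> R[i]) :
  cmod (\sum_(i <- r | P i) F i) <= \sum_(i <- r | P i) cmod (F i).
Proof.
elim/big_rec2: _ => [|i y x _ h]; first by rewrite cmod0.
by apply: le_trans (cmodD _ _) _; rewrite lerD2l.
Qed.

Lemma cmod_real (t : R) : cmod t%:C = `|t|.
Proof. by rewrite cmodE /= expr0n addr0 sqrtr_sqr. Qed.

Lemma cmod_nat n : cmod n%:R = n%:R.
Proof. by rewrite -(rmorph_nat (real_complex R)) cmod_real ger0_norm. Qed.

Lemma normc_cmod z : `|z| = (cmod z)%:C.
Proof. by rewrite normc_def cmodE. Qed.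

Lemma Re_le_cmod z : `|complex.Re z| <= cmod z.
Proof. by rewrite cmodE -sqrtr_sqr ler_wsqrtr // lerDl sqr_ge0. Qed.

Lemma Im_le_cmod z : `|complex.Im z| <= cmod z.
Proof. by rewrite cmodE -sqrtr_sqr ler_wsqrtr // lerDr sqr_ge0. Qed.

Lemma cmod_le_ReIm z : cmod z <= `|complex.Re z| + `|complex.Im z|.
Proof.
case: z => a b.
have -> : (a +i* b) = a%:C + 'i%C * b%:C :> R[i] by simpc.
apply: le_trans (cmodD _ _) _; rewrite cmodM !cmod_real.
suff -> : cmod 'i%C = 1 by rewrite mul1r; simpc.
by rewrite cmodE /= expr0n add0r expr1n sqrtr1.
Qed.

Lemma cmod_sqr z : cmod z ^+ 2 = complex.Re z ^+ 2 + complex.Im z ^+ 2.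
Proof. by rewrite cmodE sqr_sqrtr // addr_ge0 ?sqr_ge0. Qed.

Lemma ReD x y : complex.Re (x + y) = complex.Re x + complex.Re y.
Proof. by case: x; case: y. Qed.
Lemma ImD x y : complex.Im (x + y) = complex.Im x + complex.Im y.
Proof. by case: x; case: y. Qed.
Lemma ReN x : complex.Re (- x) = - complex.Re x. Proof. by case: x. Qed.
Lemma ImN x : complex.Im (- x) = - complex.Im x. Proof. by case: x. Qed.
Lemma ReM x y : complex.Re (x * y) =
  complex.Re x * complex.Re y - complex.Im x * complex.Im y.
Proof. by case: x; case: y. Qed.
Lemma ImM x y : complex.Im (x * y) =
  complex.Re x * complex.Im y + complex.Im x * complex.Re y.
Proof. by case: x; case: y. Qed.

Lemma complex_eq x y : complex.Re x = complex.Re y ->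
  complex.Im x = complex.Im y -> x = y.
Proof. by case: x => a b; case: y => c d /= -> ->. Qed.

Lemma cexpD x y : cexp (x + y) = cexp x * cexp y.
Proof.
by rewrite /cexp ReD ImD expRD cosD sinD; apply: complex_eq; simpc => /=; ring.
Qed.

Lemma cexp0 : cexp (0 : R[i]) = 1.
Proof. by rewrite /cexp /= expR0 cos0 sin0; simpc. Qed.

Lemma cmod_cexp z : cmod (cexp z) = expR (complex.Re z).
Proof.
rewrite /cexp cmodM cmod_real ger0_norm ?expR_ge0 // cmodE /= cos2Dsin2.
by rewrite sqrtr1 mulr1.
Qed.

Lemma cexp_neq0 z : cexp z != 0.
Proof. by rewrite -cmod_gt0 cmod_cexp expR_gt0. Qed.

Lemma cexpN z : cexp (- z) = (cexp z)^-1.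
Proof.
by apply: (mulIf (cexp_neq0 z)); rewrite -cexpD addNr cexp0 mulVf ?cexp_neq0.
Qed.

Lemma cexpMn z n : cexp (z *+ n) = cexp z ^+ n.
Proof. by elim: n => [|n IH]; rewrite ?cexp0 // mulrS cexpD IH exprS. Qed.

Lemma cexp_sum (I : Type) (r : seq I) (P : pred I) (F : I -> R[i]) :
  cexp (\sum_(i <- r | P i) F i) = \prod_(i <- r | P i) cexp (F i).
Proof. exact: (big_morph _ cexpD cexp0). Qed.

Lemma cexp_real_i (t : R) : cexp (t%:C * 'i%C) = cos t +i* sin t.
Proof. by rewrite /cexp; simpc; rewrite /= expR0; simpc. Qed.

Lemma cmod_cexp_real_i (t : R) : cmod (cexp (t%:C * 'i%C)) = 1.
Proof. by rewrite cmod_cexp; simpc; rewrite expR0. Qed.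

Lemma cexp_pi_i : cexp (pi%:C * 'i%C) = -1 :> R[i].
Proof. by rewrite cexp_real_i cospi sinpi; apply: complex_eq; rewrite /= ?oppr0. Qed.

Lemma cexp_2pi_i : cexp ((2 * pi)%:C * 'i%C) = 1 :> R[i].
Proof.
have -> : (2 * pi)%:C * 'i%C = pi%:C * 'i%C + pi%:C * 'i%C :> R[i].
  by rewrite rmorphM /=; ring.
by rewrite cexpD cexp_pi_i mulrNN mulr1.
Qed.

Lemma cexp_2pi_i_int (k : int) : cexp ((2 * pi * k%:~R)%:C * 'i%C) = 1 :> R[i].
Proof.
case: k => n.
  have -> : (2 * pi * n%:~R)%:C * 'i%C = ((2 * pi)%:C * 'i%C) *+ n :> R[i].
    by rewrite -mulr_natr !rmorphM /= -pmulrn rmorph_nat; ring.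
  by rewrite cexpMn cexp_2pi_i expr1n.
have -> : (2 * pi * (Negz n)%:~R)%:C * 'i%C = - (((2 * pi)%:C * 'i%C) *+ n.+1) :> R[i].
  by rewrite -mulr_natr NegzE rmorphN /= mulrN rmorphN /= -pmulrn !rmorphM /= rmorph_nat; ring.
by rewrite cexpN cexpMn cexp_2pi_i expr1n invr1.
Qed.


(** Modulo [2 * pi] the imaginary part lies in [0, 2 pi), where the cosine is 1 only at 0. The half
    beyond [pi] is reflected by y -> 2 pi - y into the interval on which [cos] is injective. *)
Lemma cexp_eq1 z : cexp z = 1 -> exists k : int, z = (2 * pi * k%:~R)%:C * 'i%C.
Proof.
move=> h.
have hR : complex.Re z = 0.
  have := cmod_cexp z; rewrite h cmod1 -(expR0 R) => /expR_inj <- //.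
set k := Num.floor (complex.Im z / (2 * pi)).
have pi0 : 0 < (2 * pi : R) by rewrite mulr_gt0 ?pi_gt0.
have hkz : complex.Im z = (complex.Im z - 2 * pi * k%:~R) + 2 * pi * k%:~R by ring.
set y := complex.Im z - 2 * pi * k%:~R in hkz.
have /andP[y0 y2] : 0 <= y < 2 * pi.
  have /andP[h1 h2] := @mem_rg1_floor R (complex.Im z / (2 * pi)).
  rewrite /y subr_ge0 ltrBlDr mulrC -ler_pdivlMr // h1 /=.
  by move: h2; rewrite ltr_pdivrMr // mulrDl mul1r addrC.
have hc : cos y = 1.
  have : cexp (y%:C * 'i%C) = 1.
    rewrite -[RHS]h; have -> : z = y%:C * 'i%C + (2 * pi * k%:~R)%:C * 'i%C.
      rewrite -mulrDl -rmorphD /= -hkz; case: (z) hR => a b /= ->.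
      by apply: complex_eq; simpc.
    by rewrite cexpD cexp_2pi_i_int mulr1.
  by rewrite cexp_real_i => -[].
suff y_0 : y = 0.
  exists k; have -> : 2 * pi * k%:~R = complex.Im z by rewrite [RHS]hkz y_0 add0r.
  by apply: complex_eq; rewrite ?ReM ?ImM /= ?hR; ring.
have [ypi|ypi] := leP y pi.
  apply: (@cos_inj R); rewrite ?in_itv /= ?y0 ?ypi ?lexx ?pi_ge0 //.
  by rewrite hc cos0.
have : 2 * pi - y = 0 :> R.
  apply: (@cos_inj R); rewrite ?in_itv /= ?lexx ?pi_ge0 //; first by apply/andP; split; lra.
  have -> : 2 * pi - y = - y + pi *+ 2 by rewrite mulr2n; ring.
  by rewrite cosD2pi cosN hc cos0.
lra.
Qed.

(** Convergence is expressed by the real sequence of distances, so that squeezing and monotone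
    convergence take place in [R]. *)
Definition climit u (l : R[i]) := (fun n => cmod (u n - l)) @ \oo --> (0 : R).

Lemma climitP u l : climit u l <->
  forall e : R, 0 < e -> exists N, forall n, (N <= n)%N -> cmod (u n - l) < e.
Proof.
split.
  move=> /cvgr0Pnorm_lt h e e0; have [N _ hN] := h e e0.
  by exists N => n Nn; have := hN n Nn; rewrite ger0_norm ?cmod_ge0.
move=> h; apply/cvgr0Pnorm_lt => e e0; have [N hN] := h e e0.
by exists N => // n /= Nn; rewrite ger0_norm ?cmod_ge0 //; apply: hN.
Qed.

Lemma climit_squeeze u l (b : nat -> R) :
  (forall n, cmod (u n - l) <= b n) -> b @ \oo --> (0 : R) -> climit u l.
Proof.
move=> h hb; apply: (squeeze_cvgr _ (cvg_cst 0) hb).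
by apply: nearW => n; rewrite cmod_ge0 h.
Qed.

Lemma climit_unique u l m : climit u l -> climit u m -> l = m.
Proof.
move=> /climitP hl /climitP hm; apply/eqP; rewrite -subr_eq0 -cmod_eq0.
rewrite eq_le cmod_ge0 andbT; apply/ler_addgt0Pr => e e0.
have e2 : 0 < e / 2 by rewrite divr_gt0.
have [N hN] := hl _ e2; have [M hM] := hm _ e2.
have := hN _ (leq_maxl N M); have := hM _ (leq_maxr N M).
set n := maxn N M => h1 h2; rewrite add0r.
have -> : l - m = (u n - m) - (u n - l) by ring.
by apply: le_trans (cmodD _ _) _; rewrite cmodN; lra.
Qed.

Lemma climit_eventually_eq u v l :
  (exists N, forall n, (N <= n)%N -> u n = v n) -> climit u l -> climit v l.
Proof.
move=> [N h] /climitP hu; apply/climitP => e /hu[M hM]; exists (maxn N M) => n.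
by rewrite geq_max => /andP[h1 h2]; rewrite -h //; apply: hM.
Qed.

Lemma climit_cst l : climit (fun=> l) l.
Proof. by apply/climitP => e e0; exists 0%N => n _; rewrite subrr cmod0. Qed.

Lemma climitD u v l m : climit u l -> climit v m -> climit (fun n => u n + v n) (l + m).
Proof.
move=> hu hv; apply: (@climit_squeeze _ _ (fun n => cmod (u n - l) + cmod (v n - m))).
  by move=> n; rewrite opprD addrACA; exact: cmodD.
by rewrite -[X in _ --> X]addr0; apply: cvgD.
Qed.

Lemma climitM u v l m : climit u l -> climit v m -> climit (fun n => u n * v n) (l * m).
Proof.
move=> hu hv; apply: (@climit_squeeze _ _ (fun n =>
  cmod (u n - l) * cmod (v n - m) + cmod l * cmod (v n - m) + cmod m * cmod (u n - l))).
  move=> n.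
  have -> : u n * v n - l * m = (u n - l) * (v n - m) + l * (v n - m) + m * (u n - l) by ring.
  by rewrite -!cmodM; apply: le_trans (cmodD _ _) _; rewrite lerD2r; exact: cmodD.
have -> : 0 = 0 * 0 + cmod l * 0 + cmod m * 0 :> R by rewrite !mulr0 !addr0.
by apply: cvgD; first apply: cvgD; apply: cvgM => //; apply: cvg_cst.
Qed.

Lemma climitZ c u l : climit u l -> climit (fun n => c * u n) (c * l).
Proof. exact/climitM/climit_cst. Qed.

Lemma climitN u l : climit u l -> climit (fun n => - u n) (- l).
Proof.
by move=> h; apply: (climit_squeeze _ h) => n; rewrite -opprD cmodN.
Qed.

Lemma climitB u v l m : climit u l -> climit v m -> climit (fun n => u n - v n) (l - m).
Proof. by move=> hu hv; apply: climitD => //; apply: climitN. Qed.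

Lemma climitV u l : l != 0 -> climit u l -> climit (fun n => (u n)^-1) l^-1.
Proof.
rewrite -cmod_gt0 => l0 /climitP hu; apply/climitP => e e0.
have d0 : 0 < Num.min (cmod l / 2) (e * (cmod l) ^+ 2 / 2).
  by rewrite lt_min !divr_gt0 // mulr_gt0 // exprn_gt0.
have [N hN] := hu _ d0; exists N => n /hN; rewrite lt_min => /andP[h1 h2].
have un0 : cmod l / 2 < cmod (u n).
  by have := cmodB_ge l (u n); rewrite cmodBC; lra.
have un_gt0 : 0 < cmod (u n) by lra.
have -> : (u n)^-1 - l^-1 = - (u n - l) / (u n * l).
  by field; rewrite -!cmod_gt0 l0 un_gt0.
rewrite cmodM cmodN cmodV cmodM ltr_pdivrMr ?mulr_gt0 //.
apply: lt_trans h2 _; rewrite mulrA -mulrA (mulrC _ (cmod l)).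
by have := un0; rewrite -(ltr_pM2l (mulr_gt0 e0 l0)); lra.
Qed.

Lemma climit_prod (I : Type) (r : seq I) (u : I -> nat -> R[i]) (l : I -> R[i]) :
  (forall i, climit (u i) (l i)) ->
  climit (fun n => \prod_(i <- r) u i n) (\prod_(i <- r) l i).
Proof.
move=> h; elim: r => [|i r IH].
  by rewrite big_nil; under eq_fun do rewrite big_nil; exact: climit_cst.
by rewrite big_cons; under eq_fun do rewrite big_cons; exact: climitM.
Qed.

Lemma climit_comp u l (f : nat -> nat) : climit u l -> (forall n, (n <= f n)%N) ->
  climit (u \o f) l.
Proof.
move=> /climitP h hf; apply/climitP => e /h[N hN]; exists N => n Nn.
exact/hN/(leq_trans Nn).
Qed.

Lemma climit_dist_le u l x (e : R) (N : nat) : climit u l ->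
  (forall n, (N <= n)%N -> cmod (u n - x) <= e) -> cmod (l - x) <= e.
Proof.
move=> /climitP h hx; apply/ler_addgt0Pr => d /h[M hM].
have := hx _ (leq_maxl N M); have := hM _ (leq_maxr N M).
set n := maxn N M => h1 h2.
have -> : l - x = (u n - x) - (u n - l) by ring.
by apply: le_trans (cmodD _ _) _; rewrite cmodN lerD // ltW.
Qed.

(** For f = Re or Im, the domination makes f(u) + q nondecreasing and bounded, so f(u) is a
    difference of two convergent real sequences. Every existence statement for infinite products
    below rests on this. *)
Lemma climit_nondecreasing_dominated u (q : nat -> R) (B : R) :
  (forall n, q n <= B) -> (forall m n, (m <= n)%N -> cmod (u n - u m) <= q n - q m) ->
  exists l, climit u l.
Proof.
move=> qB h.
have hq : {homo q : m n / (m <= n)%N >-> m <= n}.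
  by move=> m n mn; rewrite -subr_ge0; apply: le_trans (h _ _ mn); exact: cmod_ge0.
have cq : cvgn q.
  by apply: nondecreasing_is_cvgn => //; exists B => _ [n _ <-].
have aux (f : R[i] -> R) : (forall z, `|f z| <= cmod z) ->
    (forall x y, f (x - y) = f x - f y) -> cvgn (f \o u).
  move=> hf hfB.
  have -> : f \o u = (fun n => (f (u n) + q n) - q n) by apply/funext => n /=; ring.
  apply: is_cvgB => //; apply: nondecreasing_is_cvgn.
    move=> m n mn; have := le_trans (hf _) (h _ _ mn).
    by rewrite hfB ler_norml => /andP[]; lra.
  exists (f (u 0%N) - q 0%N + B + B) => _ [n _ <-].
  have := le_trans (hf _) (h _ _ (leq0n n)); rewrite hfB ler_norml => /andP[].
  by have := qB n; lra.
have /cvg_ex[a ha] := aux _ Re_le_cmod (fun x y => etrans (ReD _ _) (congr1 _ (ReN y))).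
have /cvg_ex[b hb] := aux _ Im_le_cmod (fun x y => etrans (ImD _ _) (congr1 _ (ImN y))).
exists (a +i* b).
apply: (@climit_squeeze _ _ (fun n => `|complex.Re (u n) - a| + `|complex.Im (u n) - b|)).
  by move=> n; apply: le_trans (cmod_le_ReIm _) _; rewrite ReD ImD ReN ImN.
rewrite -[X in _ --> X]addr0; apply: cvgD; apply/norm_cvg0P; exact/subr_cvg0.
Qed.

End ComplexAnalysis.

(** * Infinite products *)

Section InfiniteProducts.
Variable R : realType.
Implicit Types (u v : nat -> R[i]).

(** Induction on the list through xX - yY = (x-y)(X-Y) + (x-y)Y + y(X-Y), which holds with equality
    for the majorants as well. It transfers Cauchy estimates from the real products of the 1 + |u|
    to the complex products of the 1 + u. *)
Lemma prod_majorant (I : Type) (r : seq I) (P : pred I) (x y : I -> R[i]) (a b : I -> R) :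
  (forall i, P i -> cmod (y i) <= b i) -> (forall i, P i -> cmod (x i - y i) <= a i - b i) ->
  cmod (\prod_(i <- r | P i) x i - \prod_(i <- r | P i) y i)
    <= \prod_(i <- r | P i) a i - \prod_(i <- r | P i) b i.
Proof.
move=> hy hx.
suff [] : cmod (\prod_(i <- r | P i) y i) <= \prod_(i <- r | P i) b i /\
  cmod (\prod_(i <- r | P i) x i - \prod_(i <- r | P i) y i)
    <= \prod_(i <- r | P i) a i - \prod_(i <- r | P i) b i by [].
elim: r => [|i r [IHy IHx]]; first by rewrite !big_nil cmod1 !subrr cmod0.
rewrite !big_cons; case: ifP => // Pi.
set X := \prod_(i <- r | _) x i in IHx *; set Y := \prod_(i <- r | _) y i in IHx IHy *.
set A := \prod_(i <- r | _) a i in IHx *; set B := \prod_(i <- r | _) b i in IHx IHy *.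
have [h1 h2] := (hy i Pi, hx i Pi).
have h3 := cmod_ge0 (y i); have h4 := cmod_ge0 (x i - y i).
have h5 := cmod_ge0 Y; have h6 := cmod_ge0 (X - Y).
split; first by rewrite cmodM ler_pM.
have -> : x i * X - y i * Y = (x i - y i) * (X - Y) + (x i - y i) * Y + y i * (X - Y) by ring.
have -> : a i * A - b i * B = (a i - b i) * (A - B) + (a i - b i) * B + b i * (A - B) by ring.
apply: le_trans (cmodD _ _) _; rewrite cmodM lerD ?ler_pM //.
by apply: le_trans (cmodD _ _) _; rewrite !cmodM lerD ?ler_pM.
Qed.

Lemma cmod_1D (z : R[i]) : cmod (1 + z) <= 1 + cmod z.
Proof. by apply: le_trans (cmodD _ _) _; rewrite cmod1. Qed.

Lemma prod1D_majorant (I : Type) (r : seq I) (P : pred I) (u : I -> R[i]) :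
  cmod (\prod_(i <- r) (1 + u i) - \prod_(i <- r | P i) (1 + u i))
    <= \prod_(i <- r) (1 + cmod (u i)) - \prod_(i <- r | P i) (1 + cmod (u i)).
Proof.
rewrite [X in cmod (_ - X)]big_mkcond [X in _ <= _ - X]big_mkcond /=.
apply: prod_majorant => i _; first by case: ifP; rewrite ?cmod1 ?cmod_1D.
by case: ifP => _; rewrite ?subrr ?cmod0 // addrAC subrr add0r [leRHS]addrAC subrr add0r.
Qed.

Lemma prod1D_le_expR (I : Type) (r : seq I) (P : pred I) (a : I -> R) :
  (forall i, 0 <= a i) ->
  \prod_(i <- r | P i) (1 + a i) <= expR (\sum_(i <- r | P i) a i).
Proof.
move=> a0.
rewrite (big_morph _ (@expRD R) (@expR0 R)); apply: ler_prod => i _.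
by rewrite addr_ge0 //= expR_ge1Dx.
Qed.

Lemma prod1D_ge1 (I : Type) (r : seq I) (P : pred I) (a : I -> R) :
  (forall i, 0 <= a i) -> 1 <= \prod_(i <- r | P i) (1 + a i).
Proof.
move=> a0; elim/big_rec: _ => // i x _ x1.
by apply: (le_trans x1); rewrite ler_peMl ?lerDl //; exact: le_trans ler01 x1.
Qed.

Lemma prod_ord_filter (T : Type) (idx : T) (op : Monoid.law idx) (m n : nat) (F : nat -> T) :
  (m <= n)%N -> \big[op/idx]_(i < m) F i = \big[op/idx]_(0 <= i < n | (i < m)%N) F i.
Proof.
move=> mn; rewrite -(big_mkord xpredT) (big_nat_widen _ _ _ _ _ mn) /=.
by apply: eq_bigl => i.
Qed.

Lemma prod1D_ord_majorant u (m n : nat) : (m <= n)%N ->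
  cmod (\prod_(i < n) (1 + u i) - \prod_(i < m) (1 + u i))
    <= \prod_(i < n) (1 + cmod (u i)) - \prod_(i < m) (1 + cmod (u i)).
Proof.
move=> mn; rewrite (prod_ord_filter _ (fun i => 1 + u i) mn).
rewrite (prod_ord_filter _ (fun i => 1 + cmod (u i)) mn).
by rewrite -(big_mkord xpredT (fun i => 1 + u i)) -(big_mkord xpredT (fun i => 1 + cmod (u i))); exact: prod1D_majorant.
Qed.

Lemma iprod_cvg u (B : R) : (forall n, \sum_(i < n) cmod (u i) <= B) ->
  exists l, climit (fun n => \prod_(i < n) (1 + u i)) l.
Proof.
move=> hB.
apply: (@climit_nondecreasing_dominated _ _ (fun n => \prod_(i < n) (1 + cmod (u i))) (expR B)).
  move=> n; apply: le_trans (prod1D_le_expR _ _ _) _; first by move=> i; exact: cmod_ge0.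
  by rewrite ler_expR.
by move=> m n mn; exact: prod1D_ord_majorant.
Qed.

Lemma nondecreasing_tail_small (q : nat -> R) (B e : R) :
  {homo q : m n / (m <= n)%N >-> m <= n} -> (forall n, q n <= B) -> 0 < e ->
  exists K, forall n, q n - q K < e.
Proof.
move=> nd qB e0.
have hub : has_ubound (range q) by exists B => _ [n _ <-].
have hs : has_sup (range q) by split => //; exists (q 0%N), 0%N.
have [_ [K _ <-] hK] := sup_adherent e0 hs.
exists K => n; have : q n <= sup (range q) by apply: ub_le_sup => //; exists n.
by lra.
Qed.

Lemma sum_tail_small (a : nat -> R) (B e : R) : (forall i, 0 <= a i) ->
  (forall n, \sum_(i < n) a i <= B) -> 0 < e ->
  exists K, forall n, \sum_(i < n) a i - \sum_(i < K) a i < e.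
Proof.
move=> a0 aB e0; apply: (nondecreasing_tail_small (q := fun n => \sum_(i < n) a i) _ aB e0).
by apply/nondecreasing_seqP => n; rewrite big_ord_recr /= lerDl.
Qed.

Lemma iprod_neq0 u (B : R) (l : R[i]) : (forall n, \sum_(i < n) cmod (u i) <= B) ->
  (forall i, 1 + u i != 0) -> climit (fun n => \prod_(i < n) (1 + u i)) l -> l != 0.
Proof.
move=> hB u0 hl.
(* A tail of the sum below ln(3/2) keeps the tail of the product within 1/2 of 1; the limit then
   stays within |p|/2 of the nonzero partial product p. *)
have h32 : 1 < 3 / 2 :> R by lra.
have e0 := ln_gt0 h32.
have [K hK] := sum_tail_small (fun i => cmod_ge0 (u i)) hB e0.
set p := \prod_(i < K) (1 + u i).
have p0 : p != 0 by apply/prodf_neq0 => i _.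
suff : cmod (l - p) <= cmod p / 2.
  move=> h; rewrite -cmod_gt0; rewrite -cmod_gt0 in p0.
  by have := cmodB_ge p l; rewrite cmodBC; lra.
apply: (climit_dist_le hl (N := K)) => n Kn.
have -> : \prod_(i < n) (1 + u i) = p * \prod_(K <= i < n) (1 + u i).
  by rewrite /p -!(big_mkord xpredT (fun i => 1 + u i)) -big_cat_nat.
rewrite -[X in _ - X]mulr1 -mulrBr cmodM ler_wpM2l ?cmod_ge0 //.
have := prod1D_majorant (index_iota K n) pred0 u.
rewrite [X in cmod (_ - X)]big_pred0 // [X in _ <= _ - X]big_pred0 // => /le_trans; apply.
have := prod1D_le_expR (index_iota K n) xpredT (fun i => cmod_ge0 (u i)).
have : expR (\sum_(K <= i < n) cmod (u i)) <= 3 / 2.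
  rewrite -[leRHS]lnK; last by rewrite posrE; lra.
  rewrite ler_expR; apply: le_trans _ (ltW (hK n)).
  by rewrite -!(big_mkord xpredT (fun i => cmod (u i))) (big_cat_nat (leq0n K) Kn) /= addrAC subrr add0r.
by lra.
Qed.

(** Tannery's theorem for products whose length grows with p. The product is cut at K: beyond K the
    summable bound [b] controls the error uniformly in p, and the first K factors converge one by
    one. *)
Lemma tannery_iprod (w : nat -> nat -> R[i]) u (b : nat -> R) (B : R) (l : R[i]) :
  (forall p k, (k < p)%N -> cmod (w p k) <= b k) -> (forall k, 0 <= b k) ->
  (forall n, \sum_(i < n) b i <= B) ->
  (forall k, climit (fun p => w p k) (u k)) ->
  climit (fun n => \prod_(i < n) (1 + u i)) l ->
  climit (fun p => \prod_(i < p) (1 + w p i)) l.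
Proof.
move=> wb b0 hB hw hl; apply/climitP => e e0.
pose q n := \prod_(i < n) (1 + b i).
have qB n : q n <= expR B by rewrite /q; apply: le_trans (prod1D_le_expR _ _ _) _; rewrite ?ler_expR.
have q1 n : 1 <= q n by exact: prod1D_ge1.
have nd : {homo q : m n / (m <= n)%N >-> m <= n}.
  by apply/nondecreasing_seqP => n; rewrite /q big_ord_recr /= ler_peMr ?(le_trans ler01 (q1 n)) // lerDl.
have e3 : 0 < e / 3 by rewrite divr_gt0.
have [K0 hK0] := nondecreasing_tail_small nd qB e3.
have [K1 hK1] := (climitP _ _).1 hl _ e3.
set K := maxn K0 K1.
have hKlim : climit (fun p => \prod_(i < K) (1 + w p i)) (\prod_(i < K) (1 + u i)).
  apply: (@climit_prod _ _ _ (fun (i : 'I_K) p => 1 + w p i) (fun i => 1 + u i)) => i; apply: climitD; [exact: climit_cst|exact: hw].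
have [N hN] := (climitP _ _).1 hKlim _ e3.
exists (maxn N K) => p; rewrite geq_max => /andP[Np Kp].
have h1 := hN _ Np; have h2 := hK1 K (leq_maxr _ _).
have h3 : cmod (\prod_(i < p) (1 + w p i) - \prod_(i < K) (1 + w p i)) <= q p - q K.
  rewrite (prod_ord_filter _ (fun i => 1 + w p i) Kp) /q (prod_ord_filter _ (fun i => 1 + b i) Kp).
  rewrite -(big_mkord xpredT (fun i => 1 + w p i)) -(big_mkord xpredT (fun i => 1 + b i)).
  rewrite [X in cmod (_ - X)]big_mkcond [X in _ <= _ - X]big_mkcond /=.
  rewrite [X in cmod (X - _)]big_seq_cond [X in cmod (_ - X)]big_seq_cond.
  rewrite [X in _ <= X - _]big_seq_cond [X in _ <= _ - X]big_seq_cond.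
  apply: prod_majorant => i; rewrite mem_index_iota /= => /andP[ip _].
    by case: ifP => _; rewrite ?cmod1 // (le_trans (cmod_1D _)) // lerD2l wb.
  case: ifP => _; first by rewrite !subrr cmod0.
  by rewrite addrAC subrr add0r [leRHS]addrAC subrr add0r wb.
have h4 := hK0 p.
have h5 : q K0 <= q K by apply: nd; exact: leq_maxl.
have -> : \prod_(i < p) (1 + w p i) - l =
  (\prod_(i < p) (1 + w p i) - \prod_(i < K) (1 + w p i)) +
  (\prod_(i < K) (1 + w p i) - \prod_(i < K) (1 + u i)) +
  (\prod_(i < K) (1 + u i) - l) by ring.
apply: le_lt_trans (cmodD _ _) _; apply: le_lt_trans (lerD (cmodD _ _) (lexx _)) _.
by move: h1 h2 h3 h4 h5; lra.
Qed.

(** The majorant products are bounded and monotone in both indices, so the finite rectangles are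
    uniformly close to [E] as soon as both sides exceed some K. Either iterated limit can then be
    taken inside this estimate. Applied to the period lattice, this is where rows are exchanged with
    columns. *)
Lemma double_iprod (u : nat -> nat -> R[i]) (B : R) :
  (forall M N, \sum_(m < M) \sum_(n < N) cmod (u m n) <= B) ->
  exists E,
    (forall r : nat -> R[i], (forall n, climit (fun M => \prod_(m < M) (1 + u m n)) (r n)) ->
       climit (fun N => \prod_(n < N) r n) E) /\
    (forall c : nat -> R[i], (forall m, climit (fun N => \prod_(n < N) (1 + u m n)) (c m)) ->
       climit (fun M => \prod_(m < M) c m) E).
Proof.
move=> hB.
pose p M N := \prod_(m < M) \prod_(n < N) (1 + u m n).
pose q M N := \prod_(m < M) \prod_(n < N) (1 + cmod (u m n)).
have qB M N : q M N <= expR B.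
  apply: le_trans (_ : expR (\sum_(m < M) \sum_(n < N) cmod (u m n)) <= _); last by rewrite ler_expR.
  rewrite (big_morph _ (@expRD R) (@expR0 R)); apply: ler_prod => m _.
  rewrite (le_trans ler01 (prod1D_ge1 _ _ _)) => [|i]; last exact: cmod_ge0.
  by apply: prod1D_le_expR => n; exact: cmod_ge0.
have hp M N M' N' : (M <= M')%N -> (N <= N')%N ->
    cmod (p M' N' - p M N) <= q M' N' - q M N.
  move=> MM NN; rewrite /p /q.
  rewrite (prod_ord_filter _ (fun m => \prod_(n < N) (1 + u m n)) MM).
  rewrite (prod_ord_filter _ (fun m => \prod_(n < N) (1 + cmod (u m n))) MM).
  rewrite -(big_mkord xpredT (fun m => \prod_(n < N') (1 + u m n))).
  rewrite -(big_mkord xpredT (fun m => \prod_(n < N') (1 + cmod (u m n)))).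
  rewrite [X in cmod (_ - X)]big_mkcond [X in _ <= _ - X]big_mkcond /=.
  apply: prod_majorant => m _.
    case: ifP => _; last by rewrite cmod1.
    rewrite cmod_prod; apply: ler_prod => n _; rewrite cmod_ge0 /=; exact: cmod_1D.
  case: ifP => _; first exact: prod1D_ord_majorant.
  have := prod1D_ord_majorant (u m) (leq0n N'); by rewrite !big_ord0.
have [E hE] : exists E, climit (fun K => p K K) E.
  by apply: (@climit_nondecreasing_dominated _ _ (fun K => q K K) (expR B)) => // m n mn; exact: hp.
have nd : {homo (fun K => q K K) : m n / (m <= n)%N >-> m <= n}.
  by move=> m n mn; rewrite -subr_ge0; apply: le_trans (hp _ _ _ _ mn mn); exact: cmod_ge0.
have key e : 0 < e -> exists K, forall M N, (K <= M)%N -> (K <= N)%N -> cmod (p M N - E) <= e.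
  move=> e0; have e2 : 0 < e / 2 by rewrite divr_gt0.
  have [K hK] := nondecreasing_tail_small nd (fun K => qB K K) e2.
  have qsup M N : (K <= M)%N -> (K <= N)%N -> q M N - q K K <= e / 2.
    move=> KM KN.
    have h1 : q M N <= q (maxn M N) (maxn M N).
      rewrite -subr_ge0; apply: le_trans (hp _ _ _ _ (leq_maxl _ _) (leq_maxr _ _)); exact: cmod_ge0.
    by have := hK (maxn M N); lra.
  have hEK : cmod (E - p K K) <= e / 2.
    by apply: (climit_dist_le hE (N := K)) => n Kn; apply: le_trans (hp _ _ _ _ _ _) (qsup _ _ _ _).
  exists K => M N KM KN.
  have -> : p M N - E = (p M N - p K K) - (E - p K K) by ring.
  apply: le_trans (cmodD _ _) _; rewrite cmodN.
  by have := hp _ _ _ _ KM KN; have := qsup _ _ KM KN; lra.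
exists E; split => [r hr|c hc]; apply/climitP => e e0.
  have e2 : 0 < e / 2 by rewrite divr_gt0.
  have [K hK] := key _ e2; exists K => N KN.
  have hl : climit (fun M => p M N) (\prod_(n < N) r n).
    rewrite /p; under eq_fun do rewrite exchange_big.
    by apply: (@climit_prod _ _ _ (fun (n : 'I_N) M => \prod_(m < M) (1 + u m n)) r) => n; exact: hr.
  apply: le_lt_trans (climit_dist_le hl (N := K) (e := e / 2) _) _; last by lra.
  by move=> M KM; exact: hK.
have e2 : 0 < e / 2 by rewrite divr_gt0.
have [K hK] := key _ e2; exists K => M KM.
have hl : climit (fun N => p M N) (\prod_(m < M) c m).
  by apply: (@climit_prod _ _ _ (fun (m : 'I_M) N => \prod_(n < N) (1 + u m n)) c) => m; exact: hc.
apply: le_lt_trans (climit_dist_le hl (N := K) (e := e / 2) _) _; last by lra.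
by move=> N KN; exact: hK.
Qed.

Lemma sum_inv_sqr_le2 n : \sum_(i < n) ((i.+1%:R : R) ^+ 2)^-1 <= 2.
Proof.
(* The additional term makes the induction go through, by 1/(x+1)^2 + 1/(x+1) <= 1/x. *)
have : \sum_(i < n.+1) ((i.+1%:R : R) ^+ 2)^-1 + n.+1%:R^-1 <= 2.
  elim: n => [|n IH]; first by rewrite big_ord1 expr1n invr1; lra.
  rewrite big_ord_recr /=; apply: le_trans _ IH; rewrite -addrA lerD2l.
  have n0 : 0 < (n.+1%:R : R) by rewrite ltr0n.
  rewrite -[n.+2%:R]natr1; set x : R := n.+1%:R in n0 *.
  have -> : ((x + 1) ^+ 2)^-1 + (x + 1)^-1 = (x + 2) / (x + 1) ^+ 2 by field; lra.
  rewrite ler_pdivrMr ?exprn_gt0 //; last lra.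
  rewrite mulrC ler_pdivlMr //; nra.
rewrite big_ord_recr /= => h.
have h1 : 0 <= ((n.+1%:R : R) ^+ 2)^-1 by rewrite invr_ge0 exprn_ge0.
have h2 : 0 <= (n.+1%:R : R)^-1 by rewrite invr_ge0.
by apply: le_trans h; rewrite -addrA lerDl addr_ge0.
Qed.

End InfiniteProducts.

(** * The sine product *)

Section SineProduct.
Variable R : realType.
Implicit Types (z : R[i]).

Definition piI : R[i] := pi%:C * 'i%C.

Lemma cexpMr z n : cexp (z * n%:R) = cexp z ^+ n.
Proof. by rewrite mulr_natr cexpMn. Qed.

(* 2 i sin (pi z) *)
Definition esin z : R[i] := cexp (piI * z) - cexp (- (piI * z)).

Lemma piI_neq0 : piI != 0.
Proof.
rewrite /piI mulf_neq0 //; last by rewrite -cmod_gt0 cmodE /= expr0n add0r expr1n sqrtr1.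
by rewrite -cmod_gt0 cmod_real normr_gt0 gt_eqF // pi_gt0.
Qed.

Lemma esinN z : esin (- z) = - esin z.
Proof. by rewrite /esin mulrN opprK opprB. Qed.

Lemma cexp_2piI_int (k : int) : cexp (2 * piI * k%:~R) = 1.
Proof.
apply: etrans (cexp_2pi_i_int R k); congr cexp.
by rewrite /piI !rmorphM /= rmorph_nat rmorph_int; ring.
Qed.

Lemma cexp_2piI_eq1 z : cexp (2 * piI * z) = 1 -> exists k : int, z = k%:~R.
Proof.
move=> /cexp_eq1[k hk]; exists k; apply: (mulfI (_ : 2 * piI != 0)).
  by rewrite mulf_neq0 ?piI_neq0 ?pnatr_eq0.
by rewrite hk /piI !rmorphM /= rmorph_nat rmorph_int; ring.
Qed.

Lemma esin_eq0 z : esin z = 0 -> exists k : int, z = k%:~R.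
Proof.
move=> /eqP; rewrite subr_eq0 => /eqP h; apply: cexp_2piI_eq1.
have -> : 2 * piI * z = piI * z + piI * z by ring.
by rewrite cexpD {1}h -cexpD addNr cexp0.
Qed.

Lemma prim_root_cexp n : n.+1.-primitive_root (cexp (2 * piI / n.+1%:R)).
Proof.
have n0 : (n.+1%:R : R[i]) != 0 by rewrite pnatr_eq0.
apply/andP; split => //; apply/forallP => i; apply/eqP.
rewrite unity_rootE -cexpMr.
apply/eqP/eqP => [h|->]; last first.
  by apply: etrans (cexp_2piI_int 1); congr cexp; rewrite mulfVK // mulr1.
have : cexp (2 * piI * (i.+1%:R / n.+1%:R)) = 1.
  by rewrite -[RHS]h; congr cexp; rewrite mulrA mulrAC.
move=> /cexp_2piI_eq1[k]; move/(congr1 ( *%R^~ n.+1%:R)); rewrite mulfVK // => hk.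
have {}hk : (i.+1%:Z%:~R : R[i]) = (k * n.+1%:Z)%:~R by rewrite rmorphM /= -!pmulrn.
move/intr_inj in hk; case: i h hk => i /= hi _ hk.
have k0 : (0 < k)%R by nia.
have : (n.+1%:Z <= k * n.+1%:Z)%R by rewrite ler_peMl.
by rewrite -hk; lia.
Qed.

Lemma prod_sub_cyclotomic (p : nat) (zeta w : R[i]) : p.+1.-primitive_root zeta ->
  \prod_(i < p) (w - zeta ^+ i.+1) = \sum_(i < p.+1) w ^+ i.
Proof.
move=> hz.
have : ('X - 1) * \prod_(i < p) ('X - (zeta ^+ i.+1)%:P) = ('X - 1) * \sum_(i < p.+1) 'X^i.
  by rewrite -subrX1 -(factor_Xn_sub_1 hz) big_mkord big_ord_recl expr0.
have X1 : 'X - 1 != 0 :> {poly R[i]} by rewrite -polyC1 polyXsubC_eq0.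
move/(mulfI X1)/(congr1 (horner^~ w)).
rewrite horner_prod horner_sum.
under eq_bigr do rewrite hornerXsubC.
by under [RHS]eq_bigr do rewrite hornerXn.
Qed.

Lemma big_ord_double (n : nat) (F : nat -> R[i]) :
  \prod_(i < n + n) F i = \prod_(i < n) (F i * F (n + n - i.+1)%N).
Proof.
rewrite big_split_ord big_split /=; congr (_ * _).
rewrite (reindex_inj rev_ord_inj); apply: eq_bigr => i _ /=; congr F.
by have := ltn_ord i; lia.
Qed.

(** * The sine of an odd multiple of an angle as a polynomial in the sine *)

Section FiniteProduct.
Variable n : nat.
Let p := (n + n).+1.

Let S z := esin (z / p%:R).

Let p0 : (p%:R : R[i]) != 0. Proof. by rewrite pnatr_eq0. Qed.

(** As p = 2n+1 is odd, the nontrivial p-th roots of unity split into pairs of inverses, and (X^2 -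
    zeta^k)(X^2 - zeta^-k) = X^2 ((X - 1/X)^2 - S(k)^2). *)
Lemma prod_esin_aux (X : R[i]) : X != 0 ->
  \sum_(i < p) (X ^+ 2) ^+ i
    = X ^+ (n + n) * \prod_(k < n) ((X - X^-1) ^+ 2 - S k.+1%:R ^+ 2).
Proof.
move=> X0; rewrite -(prod_sub_cyclotomic _ (prim_root_cexp (n + n))).
rewrite (big_ord_double n (fun i => X ^+ 2 - cexp (2 * piI / (n + n).+1%:R) ^+ i.+1)).
have -> : X ^+ (n + n) = \prod_(k < n) X ^+ 2.
  by rewrite prodr_const card_ord -exprM mulnC muln2 addnn.
rewrite -big_split /=; apply: eq_bigr => k _.
have h1 : cexp (2 * piI / p%:R) ^+ k.+1 = cexp (piI * (k.+1%:R / p%:R)) ^+ 2.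
  rewrite -!cexpMr; congr cexp; move: p0 (k.+1%:R); set P := p%:R.
  by move: P => P P0 K; field.
have h2 : cexp (2 * piI / p%:R) ^+ (n + n - k.+1).+1 = cexp (- (piI * (k.+1%:R / p%:R))) ^+ 2.
  have e1 := cexp_2piI_int 1; rewrite -[RHS]mul1r -[X in _ = X * _]e1 -!cexpMr -cexpD; congr cexp.
  have -> : (n + n - k.+1).+1 = (p - k.+1)%N by have := ltn_ord k; rewrite /p; lia.
  rewrite natrB; last by have := ltn_ord k; rewrite /p; lia.
  by move: p0 (k.+1%:R); set P := p%:R; move: P => P P0 K; field.
rewrite -/p h1 h2 /S /esin !cexpN; move: (cexp_neq0 (piI * (k.+1%:R / p%:R))).
set e := cexp _; move: e => e e0.
by field; rewrite X0 e0.
Qed.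

(** The case X = 1 of the preceding identity. It normalises the sine product and also shows that no
    factor vanishes. *)
Lemma prod_esin_const : (p%:R : R[i]) = \prod_(k < n) - S k.+1%:R ^+ 2.
Proof.
have := prod_esin_aux (oner_neq0 (R[i])); rewrite invr1 subrr [X in X * _]expr1n mul1r.
under eq_bigr do rewrite !expr1n; rewrite sumr_const card_ord => ->.
by apply: eq_bigr => k _; ring.
Qed.

Lemma S_neq0 (k : 'I_n) : S k.+1%:R != 0.
Proof.
have : \prod_(k < n) - S k.+1%:R ^+ 2 != 0 by rewrite -prod_esin_const.
by move=> /prodf_neq0 /(_ k isT); rewrite oppr_eq0 sqrf_eq0.
Qed.

(** With X = e^(pi i z/p) the left side is X^-p ((X^2)^p - 1). The factor X^2 - 1 accounts for
    [S z]; the remaining ones come from [prod_esin_aux] and are divided by their values at X = 1. *)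
Lemma esin_finite_product z :
  esin z = p%:R * S z * \prod_(k < n) (1 - S z ^+ 2 / S k.+1%:R ^+ 2).
Proof.
set X := cexp (piI * (z / p%:R)).
have X0 : X != 0 by exact: cexp_neq0.
have SX : S z = X - X^-1 by rewrite /S /esin cexpN.
have -> : esin z = X ^+ p - (X ^+ p)^-1.
  by rewrite /esin cexpN /X -cexpMr -mulrA mulfVK.
have -> : X ^+ p - (X ^+ p)^-1 = (X ^+ p)^-1 * ((X ^+ 2) ^+ p - 1).
  by rewrite -exprM mulnC exprM; field; rewrite expf_neq0.
rewrite subrX1 (prod_esin_aux X0) -SX.
rewrite mulrAC prod_esin_const -big_split /=.
have -> : \prod_(k < n) (- S k.+1%:R ^+ 2 * (1 - S z ^+ 2 / S k.+1%:R ^+ 2)) =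
  \prod_(k < n) (S z ^+ 2 - S k.+1%:R ^+ 2).
  by apply: eq_bigr => k _; field; exact: S_neq0.
rewrite SX /p exprS; set Y := \prod_(k < n) _.
by field; rewrite X0 expf_neq0.
Qed.

End FiniteProduct.

Lemma is_derive_cvg_seq (f : R -> R) (df : R) : is_derive (0 : R) (1 : R) f df ->
  (fun n => (n.+1%:R : R) * (f (n.+1%:R^-1) - f 0)) @ \oo --> df.
Proof.
move=> [hd <-]; rewrite /derive.
have hc : h^-1 *: ((f \o shift 0) (h *: 1) - f 0) @[h --> 0^'] --> 'D_1 f 0 by exact: hd.
have := (cvgr_dnbhsP _ _ _).1 hc (fun n => n.+1%:R^-1) => /=.
have -> : (fun n => n.+1%:R * (f n.+1%:R^-1 - f 0)) =
    (fun n => (n.+1%:R^-1)^-1 *: (f (n.+1%:R^-1 *: (1 : R) + 0) - f 0)).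
  by apply/funext => n; rewrite invrK addr0 /GRing.scale /= mulr1.
apply; split; last exact: cvg_harmonic.
by move=> n; rewrite invr_eq0 pnatr_eq0.
Qed.

Lemma climit_ReIm (u : nat -> R[i]) a b :
  (fun n => complex.Re (u n)) @ \oo --> a -> (fun n => complex.Im (u n)) @ \oo --> b ->
  climit u (a +i* b).
Proof.
move=> ha hb.
apply: (@climit_squeeze _ _ _ (fun n => `|complex.Re (u n) - a| + `|complex.Im (u n) - b|)).
  by move=> n; apply: le_trans (cmod_le_ReIm _) _; rewrite ReD ImD ReN ImN.
rewrite -[X in _ --> X]addr0; apply: cvgD; apply/norm_cvg0P; exact/subr_cvg0.
Qed.

(** Along the real increments 1/(n+1), the real and imaginary parts of the quotient are difference
    quotients at 0 of the real functions e^(tx) cos(ty) and e^(tx) sin(ty). *)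
Lemma climit_cexp_deriv (c : R[i]) :
  climit (fun n => n.+1%:R * (cexp (c / n.+1%:R) - 1)) c.
Proof.
case: c => x y.
have hN n : (n.+1%:R : R[i]) = (n.+1%:R : R)%:C by rewrite rmorph_nat.
have hV n : (x +i* y) / n.+1%:R = (n.+1%:R^-1 * x) +i* (n.+1%:R^-1 * y).
  by rewrite hN -fmorphV /=; simpc; rewrite ![_ * n.+1%:R^-1]mulrC.
have hRe n : complex.Re (n.+1%:R * (cexp ((x +i* y) / n.+1%:R) - 1)) =
   n.+1%:R * (expR (n.+1%:R^-1 * x) * cos (n.+1%:R^-1 * y) - expR (0 * x) * cos (0 * y)).
  by rewrite hV hN ReM ReD ReN /cexp ReM /= !mul0r !subr0 expR0 cos0 mulr1.
have hIm n : complex.Im (n.+1%:R * (cexp ((x +i* y) / n.+1%:R) - 1)) =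
   n.+1%:R * (expR (n.+1%:R^-1 * x) * sin (n.+1%:R^-1 * y) - expR (0 * x) * sin (0 * y)).
  by rewrite hV hN ImM ImD ImN /cexp ImM /= !mul0r sin0 !mulr0 ?oppr0 ?addr0 ?subr0.
apply: climit_ReIm.
  under eq_fun do rewrite hRe.
  apply: (@is_derive_cvg_seq (fun t => expR (t * x) * cos (t * y))).
  apply: is_derive_eq.
  by rewrite /GRing.scale /= !mul0r expR0 cos0 sin0; ring.
under eq_fun do rewrite hIm.
apply: (@is_derive_cvg_seq (fun t => expR (t * x) * sin (t * y))).
apply: is_derive_eq.
by rewrite /GRing.scale /= !mul0r expR0 cos0 sin0; ring.
Qed.

Lemma climit_esin_deriv z :
  climit (fun n => (n + n).+1%:R * esin (z / (n + n).+1%:R)) (2 * piI * z).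
Proof.
have -> : 2 * piI * z = piI * z - (- (piI * z)) by ring.
have h := climitB (climit_cexp_deriv (piI * z)) (climit_cexp_deriv (- (piI * z))).
have := climit_comp h (fun n => leq_addr n n).
apply: climit_eventually_eq; exists 0%N => n _ /=.
by rewrite /esin mulrA mulNr; ring.
Qed.

Lemma climit_bounded (u : nat -> R[i]) l : climit u l -> exists B, forall n, cmod (u n) <= B.
Proof.
move=> /climitP /(_ 1 ltr01)[N hN].
exists (\sum_(i < N) cmod (u i) + (1 + cmod l)) => n.
have s0 (P : pred 'I_N) : 0 <= \sum_(i < N | P i) cmod (u i) by apply: sumr_ge0 => i _; exact: cmod_ge0.
have l0 := cmod_ge0 l.
have [nN|Nn] := ltnP n N.
  rewrite (bigD1 (Ordinal nN)) //= -addrA lerDl addr_ge0 ?s0 //; lra.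
have := hN n Nn; have := cmodB_ge (u n) l; have := s0 xpredT; lra.
Qed.

(** sin x = 2 sin(x/2) cos(x/2), and sin(x/2) = (x/2) cos c by the mean value theorem. Both cosines
    are at least cos(pi/4), whose square is 1/2. *)
Lemma sin_ge_half (x : R) : 0 <= x <= pi / 2 -> x / 2 <= sin x.
Proof.
move=> /andP[x0 xpi].
have pi0 := pi_gt0 R.
have c4 : cos (pi / 4) ^+ 2 = 2^-1 :> R.
  have := cos_mulr2n (pi / 4 : R).
  have -> : (pi / 4) *+ 2 = pi / 2 :> R by rewrite mulr2n; field.
  by rewrite cos_pihalf mulr2n; lra.
have c40 : 0 < cos (pi / 4 : R) by apply: cos_gt0_pihalf; apply/andP; split; lra.
have cle (y : R) : 0 <= y <= pi / 4 -> cos (pi / 4) <= cos y.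
  move=> /andP[y0 y4]; rewrite leNgt ltr_cos ?in_itv /=; first by rewrite -leNgt.
    by apply/andP; split; lra.
  by apply/andP; split; lra.
have [c hc hs] : exists2 c, c \in `[0, x / 2] & sin (x / 2) - sin 0 = cos c * (x / 2 - 0).
  apply: MVT_segment; first by lra.
  by apply: continuous_subspaceT => y; exact: continuous_sin.
move: hc; rewrite in_itv /= => /andP[c0 cx].
have h1 := cle c; have h2 := cle (x / 2).
have {}h1 : cos (pi / 4) <= cos c by apply: h1; apply/andP; split; lra.
have {}h2 : cos (pi / 4) <= cos (x / 2) by apply: h2; apply/andP; split; lra.
have -> : sin x = sin (x / 2) * cos (x / 2) * 2.
  have {1}-> : x = (x / 2) *+ 2 by rewrite mulr2n; field.
  by rewrite sin_mulr2n mulr2n; ring.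
move: hs; rewrite sin0 !subr0 => ->.
have : cos (pi / 4) * cos (pi / 4) <= cos c * cos (x / 2) by apply: ler_pM => //; exact: ltW.
rewrite -expr2 c4 => h3.
have : x * 2^-1 <= x * (cos c * cos (x / 2)) by rewrite ler_wpM2l.
lra.
Qed.

Lemma cmod_esin_real (t : R) : cmod (esin t%:C) = 2 * `|sin (pi * t)|.
Proof.
rewrite /esin /piI.
have -> : pi%:C * 'i%C * t%:C = (pi * t)%:C * 'i%C :> R[i] by rewrite rmorphM /=; ring.
have -> : - ((pi * t)%:C * 'i%C) = (- (pi * t))%:C * 'i%C :> R[i] by rewrite rmorphN mulNr.
rewrite !cexp_real_i cosN sinN cmodE.
have -> : cos (pi * t) +i* sin (pi * t) - (cos (pi * t) +i* - sin (pi * t))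
  = 0 +i* (2 * sin (pi * t)) by apply: complex_eq; rewrite /= ?subrr //; ring.
by rewrite /= expr0n add0r sqrtr_sqr normrM ger0_norm.
Qed.

(** The angle pi (k+1)/p is at most pi/2, where the sine is at least half its argument. As a bound
    on denominators that does not depend on n, it provides the summable majorant for Tannery's
    theorem. *)
Lemma esin_dominated (n k : nat) : (k < n)%N ->
  (k.+1%:R : R) <= cmod ((n + n).+1%:R * esin (k.+1%:R / (n + n).+1%:R)).
Proof.
move=> kn; set p : nat := (n + n).+1.
have p0 : 0 < (p%:R : R) by rewrite ltr0n.
have -> : (k.+1%:R / p%:R : R[i]) = (k.+1%:R / p%:R : R)%:C.
  by rewrite fmorph_div /= !rmorph_nat.
rewrite cmodM cmod_nat cmod_esin_real.
have h : 0 <= (pi : R) * (k.+1%:R / p%:R) <= pi / 2.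
  have pi0 := pi_gt0 R.
  rewrite mulr_ge0 ?divr_ge0 ?(ltW pi0) //= ler_pM2l // ler_pdivrMr //.
  have : (k.+1 * 2)%:R <= p%:R :> R by rewrite ler_nat /p; lia.
  by rewrite natrM; lra.
have := sin_ge_half h; have /andP[h0 _] := h.
set s := sin _ => hs; rewrite ger0_norm; last by lra.
have : p%:R * (pi * (k.+1%:R / p%:R)) <= p%:R * (2 * s) by rewrite ler_pM2l //; lra.
apply: le_trans; have -> : p%:R * (pi * (k.+1%:R / p%:R)) = pi * k.+1%:R :> R.
  by field; rewrite gt_eqF.
by rewrite ler_peMl //; have := pi_ge2 R; lra.
Qed.

Lemma sum_inv_sqr_scaled_le (C : R) n : 0 <= C ->
  \sum_(i < n) C / (i.+1%:R : R) ^+ 2 <= C * 2.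
Proof. by move=> C0; rewrite -mulr_sumr ler_wpM2l // sum_inv_sqr_le2. Qed.

(** The limit of [esin_finite_product] as n grows: p S(z) stays below some C and p S(k) is at least
    k, so the k-th term is dominated by C^2/k^2. *)
Lemma sine_product z :
  climit (fun n => 2 * piI * z * \prod_(k < n) (1 - z ^+ 2 / k.+1%:R ^+ 2)) (esin z).
Proof.
have hz := climit_esin_deriv z.
have [C hC] := climit_bounded hz.
have C0 : 0 <= C by apply: le_trans (hC 0%N); exact: cmod_ge0.
have [L hL] : exists L, climit (fun n => \prod_(k < n) (1 + - (z ^+ 2 / k.+1%:R ^+ 2))) L.
  apply: (@iprod_cvg _ (fun k => - (z ^+ 2 / k.+1%:R ^+ 2)) (cmod z ^+ 2 * 2)) => n.
  rewrite (le_trans _ (sum_inv_sqr_scaled_le n (sqr_ge0 (cmod z)))) //.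
  by apply: ler_sum => k _; rewrite cmodN cmodM cmodV !cmodX cmod_nat.
suff : climit (fun n => esin z) (2 * piI * z * L).
  move=> /climit_unique /(_ (climit_cst _)) => <-.
  by apply: climitM => //; exact: climit_cst.
pose S n x := esin (x / (n + n).+1%:R).
have : climit (fun n => \prod_(k < n) (1 + - (S n z ^+ 2 / S n k.+1%:R ^+ 2))) L.
  apply: (@tannery_iprod _ (fun n k => - (S n z ^+ 2 / S n k.+1%:R ^+ 2))
    (fun k => - (z ^+ 2 / k.+1%:R ^+ 2)) (fun k => C ^+ 2 / k.+1%:R ^+ 2) (C ^+ 2 * 2)) => //.
  - move=> n k kn; rewrite cmodN.
    have := esin_dominated kn; have := hC n; rewrite -/(S n z) -/(S n k.+1%:R) => h1 h2.
    have k0 : 0 < k.+1%:R :> R by rewrite ltr0n.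
    have p0 : (n + n).+1%:R != 0 :> R[i] by rewrite pnatr_eq0.
    have S0 : S n k.+1%:R != 0.
      by move: (lt_le_trans k0 h2); rewrite cmod_gt0 mulf_eq0 negb_or => /andP[].
    have -> : S n z ^+ 2 / S n k.+1%:R ^+ 2 =
      ((n + n).+1%:R * S n z) ^+ 2 / ((n + n).+1%:R * S n k.+1%:R) ^+ 2.
      by move: p0; set P := (n + n).+1%:R; move: P => P P0; field; rewrite P0 S0.
    rewrite cmodM cmodV !cmodX ler_pM ?invr_ge0 ?exprn_ge0 ?cmod_ge0 //.
      by rewrite lerXn2r // ?nnegrE ?cmod_ge0.
    rewrite lef_pV2 ?posrE ?exprn_gt0 //; last exact: lt_le_trans h2.
    by rewrite lerXn2r // ?nnegrE ?cmod_ge0 // ltW.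
  - by move=> k; rewrite divr_ge0 ?sqr_ge0.
  - by move=> n; exact: sum_inv_sqr_scaled_le (sqr_ge0 C).
  - move=> k; apply: climitN.
    have k0 : (k.+1%:R : R[i]) != 0 by rewrite pnatr_eq0.
    have l0 : (2 * piI * k.+1%:R) * (2 * piI * k.+1%:R) != 0.
      have i2 : 2 * piI != 0 by rewrite mulf_neq0 ?piI_neq0 ?pnatr_eq0.
      by rewrite mulf_neq0 ?(mulf_neq0 i2 k0).
    have hk := climit_esin_deriv k.+1%:R.
    have := climitM (climitM hz hz) (climitV l0 (climitM hk hk)).
    have -> : 2 * piI * z * (2 * piI * z) / (2 * piI * k.+1%:R * (2 * piI * k.+1%:R))
      = z ^+ 2 / k.+1%:R ^+ 2.
      by move: k0; set K := k.+1%:R; move: K => K K0; field; rewrite K0 piI_neq0.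
    apply: climit_eventually_eq; exists k.+1 => n kn.
    have p0 : (n + n).+1%:R != 0 :> R[i] by rewrite pnatr_eq0.
    have S0 := S_neq0 (Ordinal kn); rewrite /= in S0.
    rewrite /S; move: p0 S0; set P := (n + n).+1%:R; set s := esin (z / P).
    set s' := esin _; move: P s s' => P s s' P0 s0; field; by rewrite P0 s0.
move=> /(climitM hz); apply: climit_eventually_eq; exists 0%N => n _.
by rewrite [RHS](esin_finite_product n).
Qed.

End SineProduct.

(** * Theta products *)

Section Theta.
Variable R : realType.
Implicit Types (w q z tau : R[i]).

(** Partial products of the Jacobi triple product without its factor prod (1 - q^l). The index shift
    between the two families places zeros at w = q^n for all n in Z, each once. *)
Definition thetaN w q (N : nat) : R[i] := \prod_(l < N) ((1 - w * q ^+ l) * (1 - w^-1 * q ^+ l.+1)).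

Lemma geometric_sum_le (r : R) n : 0 <= r < 1 -> \sum_(i < n) r ^+ i <= (1 - r)^-1.
Proof.
move=> /andP[r0 r1]; have h : 0 < 1 - r by lra.
rewrite -[leRHS]mul1r ler_pdivlMr //.
have -> : (\sum_(i < n) r ^+ i) * (1 - r) = 1 - r ^+ n.
  by rewrite mulrC -opprB mulNr -subrX1 opprB.
by have := exprn_ge0 n r0; lra.
Qed.

Let theta_term w q (l : nat) : R[i] := (1 - w * q ^+ l) * (1 - w^-1 * q ^+ l.+1) - 1.

Lemma thetaN_1D w q N : thetaN w q N = \prod_(l < N) (1 + theta_term w q l).
Proof. by apply: eq_bigr => l _; rewrite /theta_term [RHS]addrC subrK. Qed.

Lemma theta_term_sum w q : cmod q < 1 -> exists B, forall N, \sum_(l < N) cmod (theta_term w q l) <= B.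
Proof.
move=> q1; have q0 := cmod_ge0 q.
exists ((cmod w + cmod w^-1 + 1) * (1 - cmod q)^-1) => N.
apply: le_trans (_ : \sum_(l < N) (cmod w + cmod w^-1 + 1) * cmod q ^+ l <= _).
  apply: ler_sum => l _.
  have w0 := cmod_ge0 w; have v0 := cmod_ge0 w^-1.
  have ql0 := exprn_ge0 l q0.
  have ql1 : cmod q ^+ l <= 1 by rewrite exprn_ile1 // ltW.
  have h : cmod q * cmod q ^+ l <= cmod q ^+ l by rewrite ler_piMl // ltW.
  have -> : theta_term w q l = - (w * q ^+ l) + (- (w^-1 * (q * q ^+ l)) + (w * w^-1) * (q * q ^+ l * q ^+ l)).
    by rewrite /theta_term exprS; ring.
  have h2 : cmod (w * w^-1) <= 1.
    by have [->|w_neq0] := eqVneq w 0; rewrite ?mul0r ?cmod0 // mulfV // cmod1.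
  rewrite !mulrDl mul1r -addrA; apply: le_trans (cmodD _ _) _; rewrite cmodN cmodM cmodX lerD2l.
  apply: le_trans (cmodD _ _) _; rewrite cmodN !cmodM !cmodX -cmodM.
  apply: lerD; first by rewrite ler_wpM2l.
  apply: le_trans (_ : 1 * (cmod q ^+ l * 1) <= _); last by rewrite mul1r mulr1.
  rewrite ler_pM ?cmod_ge0 ?mulr_ge0 ?cmod_ge0 //.
  by rewrite ler_pM ?mulr_ge0 ?cmod_ge0.
rewrite -mulr_sumr ler_wpM2l ?geometric_sum_le ?q0 ?q1 //.
by rewrite !addr_ge0 ?cmod_ge0.
Qed.

Definition theta w q : R[i] := xget 0 [set l | climit (thetaN w q) l].

Lemma thetaP w q : cmod q < 1 -> climit (thetaN w q) (theta w q).
Proof.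
move=> q1; rewrite /theta; case: xgetP => [l -> //|h].
have [B hB] := theta_term_sum w q1; have [l hl] := iprod_cvg hB.
by exfalso; apply: (h l); rewrite /= (_ : thetaN w q = fun N => \prod_(l < N) (1 + theta_term w q l)) //; apply/funext => N; rewrite thetaN_1D.
Qed.

Lemma theta_limit w q t : cmod q < 1 -> climit (thetaN w q) t -> theta w q = t.
Proof. by move=> q1; apply: climit_unique; exact: thetaP. Qed.

Lemma theta_neq0 w q : cmod q < 1 ->
  (forall l, 1 - w * q ^+ l != 0) -> (forall l, 1 - w^-1 * q ^+ l.+1 != 0) -> theta w q != 0.
Proof.
move=> q1 h1 h2; have [B hB] := theta_term_sum w q1.
apply: (@iprod_neq0 _ _ B _ hB).
  by move=> l; rewrite /theta_term addrC subrK mulf_neq0.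
rewrite (_ : (fun N => _) = thetaN w q); first exact: thetaP.
by apply/funext => N; rewrite thetaN_1D.
Qed.

Lemma theta_eq0 w q (l : nat) : cmod q < 1 ->
  (1 - w * q ^+ l == 0) || (1 - w^-1 * q ^+ l.+1 == 0) -> theta w q = 0.
Proof.
move=> q1 h; apply: theta_limit => //; apply: climit_eventually_eq (climit_cst 0).
exists l.+1 => n ln; apply/esym/eqP/prodf_eq0; exists (Ordinal ln) => //=.
by rewrite mulf_eq0.
Qed.

Lemma climit_expr q : cmod q < 1 -> climit (fun n => q ^+ n) 0.
Proof.
move=> q1; apply: (@climit_squeeze _ _ _ (fun n => cmod q ^+ n)).
  by move=> n; rewrite subr0 cmodX.
by apply: cvg_expr; rewrite ger0_norm ?cmod_ge0.
Qed.

(** Replacing w by 1/w exchanges the two families of factors up to one factor at each end. The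
    boundary factors at index N are kept, which makes the identity exact; they tend to 1. *)
Lemma thetaN_inv w q N : w != 0 ->
  thetaN w^-1 q N * (1 - w^-1 * q ^+ N) = - w^-1 * (thetaN w q N * (1 - w * q ^+ N)).
Proof.
move=> w0; rewrite /thetaN invrK; elim: N => [|N IH].
  by rewrite !big_ord0 !expr0; field.
rewrite !big_ord_recr /=.
set A := \prod_(l < N) _ in IH *; set B := \prod_(l < N) _ in IH *.
have -> : A * ((1 - w^-1 * q ^+ N) * (1 - w * q ^+ N.+1)) * (1 - w^-1 * q ^+ N.+1)
  = (A * (1 - w^-1 * q ^+ N)) * ((1 - w * q ^+ N.+1) * (1 - w^-1 * q ^+ N.+1)) by ring.
by rewrite IH; ring.
Qed.

Lemma climit_1BM w q : cmod q < 1 -> climit (fun n => 1 - w * q ^+ n) 1.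
Proof.
by move=> q1; have := climitB (climit_cst 1) (climitZ w (climit_expr q1)); rewrite mulr0 subr0.
Qed.

Lemma theta_inv w q : w != 0 -> cmod q < 1 -> theta w^-1 q = - w^-1 * theta w q.
Proof.
move=> w0 q1.
have h1 := climitM (thetaP w^-1 q1) (climit_1BM w^-1 q1).
have h2 := climitZ (- w^-1) (climitM (thetaP w q1) (climit_1BM w q1)).
rewrite !mulr1 in h1 h2; apply: climit_unique h1 _.
apply: climit_eventually_eq h2; exists 0%N => n _.
by rewrite thetaN_inv.
Qed.

(** The factors for w q are those for 1/w, with the two members of each pair exchanged; so this is
    the inversion formula again. *)
Lemma theta_mulq w q : w != 0 -> q != 0 -> cmod q < 1 -> theta (w * q) q = - w^-1 * theta w q.
Proof.
move=> w0 q0 q1; rewrite -theta_inv //; congr xget; apply/funext => l /=.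
congr (climit _ l); apply/funext => N; apply: eq_bigr => i _.
by rewrite invfM invrK !exprS; field; rewrite w0 q0.
Qed.

Definition nome tau : R[i] := cexp (2 * piI R * tau).

Lemma nome_neq0 tau : nome tau != 0. Proof. exact: cexp_neq0. Qed.

Lemma nomeD x y : nome (x + y) = nome x * nome y.
Proof. by rewrite /nome mulrDr cexpD. Qed.

Lemma nomeN x : nome (- x) = (nome x)^-1.
Proof. by rewrite /nome mulrN cexpN. Qed.

Lemma nomeMn x n : nome (x * n%:R) = nome x ^+ n.
Proof. by rewrite /nome mulrA cexpMr. Qed.

Lemma nome_int (k : int) : nome k%:~R = 1. Proof. exact: cexp_2piI_int. Qed.

Lemma nome1 : nome 1 = 1. Proof. exact: (nome_int 1). Qed.

Lemma Im_2piI tau : complex.Re (2 * piI R * tau) = - (2 * pi * complex.Im tau).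
Proof.
have -> : 2 * piI R = 0 +i* (2 * pi).
  by rewrite /piI -(rmorph_nat (real_complex R)); simpc.
by rewrite ReM /= mul0r sub0r.
Qed.

Lemma cmod_nome_lt1 tau : 0 < complex.Im tau -> cmod (nome tau) < 1.
Proof.
move=> h; rewrite /nome cmod_cexp Im_2piI -expR0 ltr_expR oppr_lt0.
by rewrite !mulr_gt0 // pi_gt0.
Qed.

Definition in_lattice tau z := exists a b : int, z = a%:~R + b%:~R * tau.

Lemma in_latticeN tau z : in_lattice tau z -> in_lattice tau (- z).
Proof. by move=> [a [b ->]]; exists (- a), (- b); rewrite !rmorphN /=; ring. Qed.

Lemma in_latticeD tau z z' : in_lattice tau z -> in_lattice tau z' -> in_lattice tau (z + z').
Proof.
by move=> [a [b ->]] [a' [b' ->]]; exists (a + a'), (b + b'); rewrite !rmorphD /=; ring.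
Qed.

Lemma in_lattice_mul tau (n : nat) : in_lattice tau (n%:R * tau).
Proof. by exists 0, n%:Z; rewrite add0r -pmulrn. Qed.

Lemma in_lattice_int tau (k : int) : in_lattice tau k%:~R.
Proof. by exists k, 0; rewrite mul0r addr0. Qed.

Lemma in_lattice_nat tau (n : nat) : in_lattice tau n%:R.
Proof. exact: (in_lattice_int tau n). Qed.

Lemma in_lattice0 tau : in_lattice tau 0. Proof. exact: (in_lattice_int tau 0). Qed.

Lemma nome_eq1 x : nome x = 1 -> exists k : int, x = k%:~R.
Proof. exact: cexp_2piI_eq1. Qed.

Lemma theta_nome_neq0 tau z : 0 < complex.Im tau -> ~ in_lattice tau z ->
  theta (nome z) (nome tau) != 0.
Proof.
move=> t0 zL; apply: theta_neq0 => [|l|l]; first exact: cmod_nome_lt1.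
  apply/eqP => /eqP; rewrite subr_eq0 -nomeMn -nomeD => /eqP/esym/nome_eq1[k hk].
  apply: zL; have -> : z = k%:~R + - (l%:R * tau) by rewrite -hk; ring.
  by apply: in_latticeD; [exact: in_lattice_int|apply: in_latticeN; exact: in_lattice_mul].
apply/eqP => /eqP; rewrite subr_eq0 -nomeMn -nomeN -nomeD => /eqP/esym/nome_eq1[k hk].
apply: zL; have -> : z = (- k)%:~R + l.+1%:R * tau by rewrite rmorphN /= -hk; ring.
by apply: in_latticeD; [exact: in_lattice_int|exact: in_lattice_mul].
Qed.

Lemma theta_nome_eq0 tau z : 0 < complex.Im tau -> in_lattice tau z ->
  theta (nome z) (nome tau) = 0.
Proof.
move=> t0 [a [[] l ->]].
  have [->|l0] := posnP l.
    apply: (@theta_eq0 _ _ 0); first exact: cmod_nome_lt1.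
    by rewrite mul0r addr0 nome_int expr0 mulr1 subrr eqxx.
  apply: (@theta_eq0 _ _ l.-1); first exact: cmod_nome_lt1.
  apply/orP; right; rewrite prednK // -nomeMn -nomeN -nomeD.
  rewrite -pmulrn; have -> : - (a%:~R + l%:R * tau) + tau * l%:R = (- a)%:~R.
    by rewrite rmorphN /=; ring.
  by rewrite nome_int subrr.
apply: (@theta_eq0 _ _ l.+1); first exact: cmod_nome_lt1.
apply/orP; left; rewrite -nomeMn -nomeD.
rewrite NegzE rmorphN /= -pmulrn.
have -> : a%:~R + - l.+1%:R * tau + tau * l.+1%:R = a%:~R by ring.
by rewrite nome_int subrr.
Qed.

End Theta.

(** * The product over the period lattice *)

Section Quadruple.
Variable R : realType.
Implicit Types (w q z x : R[i]).
Local Notation piI := (piI R).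

(** Multiplicative in f and insensitive to a nonzero constant factor of f, so the normalising
    constants of the various products disappear. *)
Definition quo4 (z1 z2 z3 z4 : R[i]) (f : R[i] -> R[i]) : R[i] := f z1 * f z2 / (f z3 * f z4).

Section Fixed.
Variables (z1 z2 z3 z4 : R[i]).
Local Notation Q := (quo4 z1 z2 z3 z4).

Lemma quo4M f g : Q (fun z => f z * g z) = Q f * Q g.
Proof. by rewrite /quo4 !invfM; ring. Qed.

Lemma quo4_prod (I : Type) (r : seq I) (F : I -> R[i] -> R[i]) :
  Q (fun z => \prod_(i <- r) F i z) = \prod_(i <- r) Q (F i).
Proof. by rewrite /quo4 big_split /= prodfV !big_split. Qed.

Lemma quo4_cst c : c != 0 -> Q (fun=> c) = 1.
Proof. by move=> c0; rewrite /quo4 mulfV ?mulf_neq0. Qed.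

Lemma quo4Z c f : c != 0 -> Q (fun z => c * f z) = Q f.
Proof. by move=> c0; rewrite (quo4M (fun=> c)) quo4_cst ?mul1r. Qed.

Lemma quo4N f : Q (fun z => - f z) = Q f.
Proof.
rewrite -[RHS](quo4Z f (_ : -1 != 0)) ?oppr_eq0 ?oner_eq0 //.
by rewrite /quo4 !mulN1r.
Qed.

Lemma climit_quo4 (f : nat -> R[i] -> R[i]) (l : R[i] -> R[i]) :
  (forall z, climit (fun n => f n z) (l z)) -> l z3 != 0 -> l z4 != 0 ->
  climit (fun n => Q (f n)) (Q l).
Proof.
move=> h h3 h4; apply: climitM; first exact: climitM.
by apply: climitV; [rewrite mulf_neq0|exact: climitM].
Qed.

Lemma quo4_neq0 f : f z1 != 0 -> f z2 != 0 -> f z3 != 0 -> f z4 != 0 -> Q f != 0.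
Proof. by move=> *; rewrite /quo4 !mulf_neq0 ?invr_neq0 // mulf_neq0. Qed.

(** The joint contribution of the lattice points w and -w, since w^2 - z^2 = (w - z)(w + z). *)
Definition rho w : R[i] := Q (fun z => w ^+ 2 - z ^+ 2).

Lemma rhoN w : rho (- w) = rho w. Proof. by rewrite /rho sqrrN. Qed.

Definition sineN x (M : nat) : R[i] := 2 * piI * x * \prod_(m < M) (1 - x ^+ 2 / m.+1%:R ^+ 2).

(** The four linear factors are regrouped as ((m+x)-z)((m-x)+z) = m^2 - (x-z)^2, and likewise for
    x+z, which are the shapes occurring in the sine product. *)
Lemma rho_pair (m : nat) x :
  rho (m.+1%:R + x) * rho (m.+1%:R - x) =
  Q (fun z => (1 - (x - z) ^+ 2 / m.+1%:R ^+ 2) * (1 - (x + z) ^+ 2 / m.+1%:R ^+ 2)).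
Proof.
have k0 : (m.+1%:R : R[i]) != 0 by rewrite pnatr_eq0.
rewrite /rho -quo4M -[RHS](@quo4Z (m.+1%:R ^+ 4)) ?expf_neq0 //.
by congr quo4; apply/funext => z; move: k0; set K := m.+1%:R; move: K => K K0; field.
Qed.

Lemma row_identity x M :
  Q (fun z => sineN (x - z) M * sineN (x + z) M) =
  rho x * \prod_(m < M) (rho (m.+1%:R + x) * rho (m.+1%:R - x)).
Proof.
under eq_bigr do rewrite rho_pair.
rewrite -quo4_prod /rho -quo4M -[RHS](@quo4Z ((2 * piI) ^+ 2)); last first.
  by rewrite expf_neq0 // mulf_neq0 ?piI_neq0 ?pnatr_eq0.
congr quo4; apply/funext => z; rewrite /sineN big_split /=; ring.
Qed.

Lemma row_identity0 M :
  Q (fun z => sineN z M) = Q id * \prod_(m < M) rho m.+1%:R.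
Proof.
rewrite /sineN (quo4M (fun z => 2 * piI * z)) quo4Z; last by rewrite mulf_neq0 ?piI_neq0 ?pnatr_eq0.
rewrite quo4_prod; congr (_ * _); apply: eq_bigr => m _.
have k0 : (m.+1%:R : R[i]) != 0 by rewrite pnatr_eq0.
rewrite /rho -[LHS](@quo4Z (m.+1%:R ^+ 2)) ?expf_neq0 //; congr quo4; apply/funext => z.
by move: k0; set K := m.+1%:R; move: K => K K0; field.
Qed.

Lemma row_limit x : esin (x - z3) != 0 -> esin (x + z3) != 0 ->
  esin (x - z4) != 0 -> esin (x + z4) != 0 ->
  climit (fun M => rho x * \prod_(m < M) (rho (m.+1%:R + x) * rho (m.+1%:R - x)))
    (Q (fun z => esin (x - z) * esin (x + z))).
Proof.
move=> h1 h2 h3 h4; under eq_fun do rewrite -row_identity.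
apply: (@climit_quo4 (fun M z => sineN (x - z) M * sineN (x + z) M)
  (fun z => esin (x - z) * esin (x + z))); rewrite ?mulf_neq0 //.
by move=> z; apply: climitM; exact: sine_product.
Qed.

Lemma row_limit0 : esin z3 != 0 -> esin z4 != 0 ->
  climit (fun M => Q id * \prod_(m < M) rho m.+1%:R) (Q (@esin R)).
Proof.
move=> h1 h2; under eq_fun do rewrite -row_identity0.
by apply: (@climit_quo4 (fun M z => sineN z M)) => // z; exact: sine_product.
Qed.

End Fixed.

Section Lattice.
Variable tau : R[i].
Hypothesis tau_gt0 : 0 < complex.Im tau.
Local Notation q := (nome tau).

Lemma esin_neq0 z : ~ in_lattice tau z -> esin z != 0.
Proof.
by move=> zL; apply/eqP => /esin_eq0[k hk]; apply: zL; rewrite hk; exact: in_lattice_int.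
Qed.

(** Apart from q^-n, which [quo4] ignores, a row of the lattice and its negative contribute the n-th
    pair of factors of the theta product. *)
Lemma esin_pair (n : nat) z :
  esin (n%:R * tau - z) * esin (n%:R * tau + z) =
  (q ^+ n)^-1 * ((1 - nome z * q ^+ n) * (1 - (nome z)^-1 * q ^+ n)).
Proof.
have e1 (x : R[i]) : esin x = - (cexp (piI * x))^-1 * (1 - nome x).
  rewrite /esin cexpN /nome; have -> : 2 * piI * x = piI * x + piI * x by ring.
  by rewrite cexpD; move: (cexp_neq0 (piI * x)); set e := cexp _; move: e => e e0; field.
rewrite !e1; have -> : nome (n%:R * tau - z) = (nome z)^-1 * q ^+ n.
  by rewrite nomeD nomeN mulrC [n%:R * _]mulrC nomeMn.
have -> : nome (n%:R * tau + z) = nome z * q ^+ n.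
  by rewrite nomeD mulrC [n%:R * _]mulrC nomeMn.
have -> : q ^+ n = cexp (piI * (n%:R * tau - z)) * cexp (piI * (n%:R * tau + z)).
  by rewrite -nomeMn -cexpD; congr cexp; ring.
move: (cexp_neq0 (piI * (n%:R * tau - z))) (cexp_neq0 (piI * (n%:R * tau + z))).
set e := cexp _; set f := cexp _; move: e f => e f e0 f0.
by move: (nome z) (nome z)^-1 => a b; field; rewrite e0 f0.
Qed.

(* 2i sin(pi z) prod_(n >= 1) (1 - w q^n)(1 - q^n / w), with w = e^(2 pi i z) *)
Definition phi z : R[i] := - cexp (- (piI * z)) * theta (nome z) q.

Lemma phi_limit z :
  climit (fun N => esin z * \prod_(n < N) ((1 - nome z * q ^+ n.+1) * (1 - (nome z)^-1 * q ^+ n.+1)))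
    (phi z).
Proof.
have q1 := cmod_nome_lt1 tau_gt0.
have := climitZ (- cexp (- (piI * z))) (climitM (thetaP (nome z) q1) (climit_1BM (nome z) q1)).
rewrite mulr1; apply: climit_eventually_eq; exists 0%N => N _.
have -> : esin z = - cexp (- (piI * z)) * (1 - nome z).
  rewrite /esin /nome; have -> : 2 * piI * z = piI * z + piI * z by ring.
  by rewrite cexpD cexpN; move: (cexp_neq0 (piI * z)); set e := cexp _; move: e => e e0; field.
rewrite -[RHS]mulrA; congr (_ * _); rewrite /thetaN; elim: N => [|N IH].
  by rewrite !big_ord0 expr0; ring.
rewrite !big_ord_recr /= [RHS]mulrA -IH.
by move: (\prod_(l < N) _) => A; ring.
Qed.

End Lattice.
End Quadruple.

(** * Absolute convergence over the lattice, and the exchange of rows and columns *)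

Section QuadrupleTransformation.
Variable R : realType.
Implicit Types (w q z x tau : R[i]).

(** The constant is det/trace of the Gram matrix G of the form |M + N tau|^2, a lower bound for its
    least eigenvalue. By Cayley-Hamilton, trace * v^T G v - det * |v|^2 = |G v|^2, which is the sum
    of two squares in the proof. *)
Lemma lattice_norm_ge tau : complex.Im tau != 0 ->
  exists2 c : R, 0 < c & forall m n : nat,
    c * (m.+1%:R ^+ 2 + n.+1%:R ^+ 2) <= cmod (m.+1%:R + n.+1%:R * tau) ^+ 2.
Proof.
case: tau => A B /= B0.
have B2 : 0 < B ^+ 2 by rewrite exprn_even_gt0.
have A2 := sqr_ge0 A.
have D0 : 0 < 1 + A ^+ 2 + B ^+ 2 by lra.
exists (B ^+ 2 / (1 + A ^+ 2 + B ^+ 2)) => [|m n]; first exact: divr_gt0.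
have hN (k : nat) : (k.+1%:R : R[i]) = (k.+1%:R : R)%:C by rewrite rmorph_nat.
rewrite cmod_sqr !hN; simpc; rewrite /=.
move: (m.+1%:R) (n.+1%:R) => M N.
rewrite mulrAC ler_pdivrMr // -subr_ge0.
have -> : ((M + N * A) ^+ 2 + (N * B) ^+ 2) * (1 + A ^+ 2 + B ^+ 2) - B ^+ 2 * (M ^+ 2 + N ^+ 2)
  = (M + N * A) ^+ 2 + (M * A + N * (A ^+ 2 + B ^+ 2)) ^+ 2 by ring.
by rewrite addr_ge0 ?sqr_ge0.
Qed.

Section Bound.
Variables (z1 z2 z3 z4 : R[i]).
Hypothesis sqr_sum : z1 ^+ 2 + z2 ^+ 2 = z3 ^+ 2 + z4 ^+ 2.
Local Notation rho := (rho z1 z2 z3 z4).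

(** The hypothesis on the squares cancels the w^2 term of the numerator. What remains is constant,
    so the quotient decays like |w|^-4. *)
Lemma rhoB1 w : w ^+ 2 - z3 ^+ 2 != 0 -> w ^+ 2 - z4 ^+ 2 != 0 ->
  rho w - 1 = (z1 ^+ 2 * z2 ^+ 2 - z3 ^+ 2 * z4 ^+ 2) / ((w ^+ 2 - z3 ^+ 2) * (w ^+ 2 - z4 ^+ 2)).
Proof.
move=> h3 h4; rewrite /rho /quo4.
have -> : (w ^+ 2 - z1 ^+ 2) * (w ^+ 2 - z2 ^+ 2) =
  (w ^+ 2 - z3 ^+ 2) * (w ^+ 2 - z4 ^+ 2) + (z1 ^+ 2 * z2 ^+ 2 - z3 ^+ 2 * z4 ^+ 2).
  have -> : z1 ^+ 2 = z3 ^+ 2 + z4 ^+ 2 - z2 ^+ 2 by rewrite -sqr_sum; ring.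
  by ring.
rewrite mulrDl mulfV ?mulf_neq0 //; ring.
Qed.

Lemma rho_bound tau : complex.Im tau != 0 -> exists2 C : R, 0 <= C &
  forall m n : nat,
    cmod (rho (m.+1%:R + n.+1%:R * tau) - 1) <= C / (m.+1%:R ^+ 2 * n.+1%:R ^+ 2).
Proof.
move=> /lattice_norm_ge[c c0 hc].
pose K := cmod (z1 ^+ 2 * z2 ^+ 2 - z3 ^+ 2 * z4 ^+ 2).
pose D := cmod z3 ^+ 2 + cmod z4 ^+ 2.
(* Once c (m^2 + n^2) >= 2D, the z^2 cost at most half of |w|^2, and |w^2 - z^2| >= c m n. All other
   indices lie in the box of side T, where the finitely many values [F], whatever they are, are
   simply added to the constant. *)
pose T := (Num.truncn (2 * D / c)).+1.
pose F (m n : nat) := cmod (rho (m.+1%:R + n.+1%:R * tau) - 1) * (m.+1%:R ^+ 2 * n.+1%:R ^+ 2).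
have F0 m n : 0 <= F m n by rewrite mulr_ge0 ?cmod_ge0 // mulr_ge0 ?sqr_ge0.
have K0 : 0 <= K by exact: cmod_ge0.
have D3 := sqr_ge0 (cmod z3); have D4 := sqr_ge0 (cmod z4).
have S0 : 0 <= \sum_(m < T) \sum_(n < T) F m n.
  by apply: sumr_ge0 => m _; apply: sumr_ge0 => n _.
have Kc0 : 0 <= K / c ^+ 2 by rewrite divr_ge0 // sqr_ge0.
exists (K / c ^+ 2 + \sum_(m < T) \sum_(n < T) F m n) => [|m n]; first by rewrite addr_ge0.
have m0 : 0 < m.+1%:R :> R by rewrite ltr0n.
have n0 : 0 < n.+1%:R :> R by rewrite ltr0n.
rewrite ler_pdivlMr ?mulr_gt0 ?exprn_gt0 // -/(F m n).
have [h|h] := leP (2 * D) (c * (m.+1%:R ^+ 2 + n.+1%:R ^+ 2)); last first.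
  have small (k l : nat) : c * (k.+1%:R ^+ 2 + l.+1%:R ^+ 2) < 2 * D -> (k < T)%N.
    move=> hk; have D0 : 0 <= 2 * D / c by rewrite divr_ge0 ?(ltW c0) // /D; lra.
    rewrite /T ltnS truncn_ge_nat // ler_pdivlMr // mulrC; apply: le_trans (ltW hk).
    rewrite ler_pM2l // -natr1; have := ler0n R k; have := sqr_ge0 (l.+1%:R : R).
    by move: (k%:R) => x; nra.
  have mT := small _ _ h; rewrite addrC in h; have nT := small _ _ h.
  apply: le_trans (_ : \sum_(i < T) \sum_(j < T) F i j <= _); last by rewrite lerDr.
  rewrite (bigD1 (Ordinal mT)) //= (bigD1 (Ordinal nT)) //= -addrA lerDl addr_ge0 //.
    by apply: sumr_ge0 => j _.
  by apply: sumr_ge0 => i _; apply: sumr_ge0 => j _.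
apply: le_trans (_ : K / c ^+ 2 <= _); last by rewrite lerDl.
rewrite /F; set w := m.+1%:R + _.
have hcw := hc m n; rewrite -/w in hcw.
have hw : c * (m.+1%:R * n.+1%:R) <= cmod w ^+ 2 / 2.
  have : c * (m.+1%:R * n.+1%:R) <= c * ((m.+1%:R ^+ 2 + n.+1%:R ^+ 2) / 2).
    rewrite ler_pM2l //; have := sqr_ge0 (m.+1%:R - n.+1%:R : R).
    by move: (m.+1%:R : R) (n.+1%:R : R) => x y; nra.
  by lra.
have MN0 : 0 < c * (m.+1%:R * n.+1%:R) :> R by rewrite !mulr_gt0.
have hz (z : R[i]) : cmod z ^+ 2 <= D -> c * (m.+1%:R * n.+1%:R) <= cmod (w ^+ 2 - z ^+ 2).
  by move=> hD; have := cmodB_ge (w ^+ 2) (z ^+ 2); rewrite !cmodX; lra.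
have {}h3 := hz z3 (_ : cmod z3 ^+ 2 <= D); have {}h3 := h3 (ler_wpDr D4 (lexx _)).
have {}h4 := hz z4 (_ : cmod z4 ^+ 2 <= D); have {}h4 := h4 (ler_wpDl D3 (lexx _)).
have d3 := lt_le_trans MN0 h3; have d4 := lt_le_trans MN0 h4.
rewrite rhoB1 -?cmod_gt0 // cmodM cmodV cmodM -/K.
have -> : K / c ^+ 2 = K / ((c * (m.+1%:R * n.+1%:R)) * (c * (m.+1%:R * n.+1%:R)))
   * (m.+1%:R ^+ 2 * n.+1%:R ^+ 2).
  move: m0 n0; move: (m.+1%:R : R) (n.+1%:R : R) => x y x0 y0.
  by field; rewrite !gt_eqF.
rewrite ler_wpM2r ?mulr_ge0 ?sqr_ge0 // ler_wpM2l // lef_pV2 ?posrE ?(mulr_gt0 d3) // ?(mulr_gt0 MN0) //.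
by apply: ler_pM => //; exact: ltW.
Qed.

End Bound.

Section Transformation.
Variables (z1 z2 z3 z4 : R[i]).
Hypothesis sqr_sum : z1 ^+ 2 + z2 ^+ 2 = z3 ^+ 2 + z4 ^+ 2.
Local Notation rho := (rho z1 z2 z3 z4).
Local Notation Q := (quo4 z1 z2 z3 z4).

(** The four lattice points with coordinates m+1 and n+1 up to signs. The points on the two axes are
    left out and enter through sine products. *)
Definition rho2 tau (m n : nat) : R[i] :=
  rho (m.+1%:R + n.+1%:R * tau) * rho (m.+1%:R - n.+1%:R * tau).

Lemma rho2_summable tau : complex.Im tau != 0 -> exists B : R,
  forall M N, \sum_(m < M) \sum_(n < N) cmod (rho2 tau m n - 1) <= B.
Proof.
move=> t0; have [C C0 hC] := rho_bound sqr_sum t0.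
have [|C' C'0 hC'] := rho_bound sqr_sum (_ : complex.Im (- tau) != 0).
  by rewrite ImN oppr_eq0.
exists ((C + C' + C * C') * (2 * 2)) => M N.
apply: le_trans (_ : \sum_(m < M) \sum_(n < N)
    (C + C' + C * C') * ((m.+1%:R ^+ 2)^-1 * (n.+1%:R ^+ 2)^-1) <= _).
  apply: ler_sum => m _; apply: ler_sum => n _.
  have h := hC m n; have h' := hC' m n; rewrite mulrN in h'; rewrite -invfM.
  rewrite /rho2; set a := rho _ in h *; set b := rho _ in h' *.
  set t : R := m.+1%:R ^+ 2 * n.+1%:R ^+ 2 in h h' *.
  have t1 : 1 <= t.
    by rewrite /t -exprMn -natrM exprn_ege1 // ler1n.
  have t_gt0 : 0 < t by exact: lt_le_trans t1.
  have -> : a * b - 1 = (a - 1) + ((b - 1) + (a - 1) * (b - 1)) by ring.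
  have -> : (C + C' + C * C') / t = C / t + (C' / t + C * C' / t) by rewrite !mulrDl addrA.
  apply: le_trans (cmodD _ _) _; apply: lerD => //.
  apply: le_trans (cmodD _ _) _; apply: lerD => //; rewrite cmodM.
  apply: le_trans (ler_pM _ _ h h') _; rewrite ?cmod_ge0 //.
  rewrite mulrACA ler_wpM2l ?mulr_ge0 // ler_piMr ?invr_ge0 ?(ltW t_gt0) //.
  by rewrite invf_le1.
under eq_bigr do rewrite -mulr_sumr -mulr_sumr.
rewrite -mulr_sumr ler_wpM2l ?addr_ge0 ?mulr_ge0 // -mulr_suml.
by rewrite ler_pM ?sum_inv_sqr_le2 // sumr_ge0 // => i _; rewrite invr_ge0 sqr_ge0.
Qed.

Lemma rho_neq0 tau w : in_lattice tau w -> ~ in_lattice tau z1 -> ~ in_lattice tau z2 ->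
  ~ in_lattice tau z3 -> ~ in_lattice tau z4 -> rho w != 0.
Proof.
move=> wL h1 h2 h3 h4.
suff h z : ~ in_lattice tau z -> w ^+ 2 - z ^+ 2 != 0 by rewrite quo4_neq0 ?h.
move=> zL; rewrite subr_eq0 eqf_sqr; apply/negP => /orP[/eqP e|/eqP e]; apply: zL.
  by rewrite -e.
by rewrite -[z]opprK -e; exact: in_latticeN.
Qed.

End Transformation.

Lemma in_lattice_inv tau z : tau != 0 -> in_lattice (- tau^-1) (z / tau) -> in_lattice tau z.
Proof.
move=> t0 [a [b h]]; exists (- b), a; apply: (mulIf (invr_neq0 t0)).
by rewrite h rmorphN /=; field.
Qed.

Lemma in_lattice_inv' tau z : tau != 0 -> in_lattice tau z -> in_lattice (- tau^-1) (z / tau).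
Proof.
move=> t0 [a [b ->]]; exists b, (- a).
by rewrite rmorphN /=; field.
Qed.

Lemma Im_invN tau : complex.Im (- tau^-1) = complex.Im tau / cmod tau ^+ 2.
Proof. by rewrite cmod_sqr; case: tau => a b /=; rewrite opprK. Qed.

(** The quotient for [phi] is the sine quotient of row 0 times the rows of height n tau. Each such
    row is its point on the axis R tau times the product of [rho2] over m, and these axis points
    together with [id] form the sine quotient in z/tau. Apart from the quotient for [phi], every
    term of the resulting identity is compatible with tau -> -1/tau. *)
Lemma rows_limit tau z1 z2 z3 z4 (E : R[i]) : 0 < complex.Im tau ->
  ~ in_lattice tau z1 -> ~ in_lattice tau z2 -> ~ in_lattice tau z3 -> ~ in_lattice tau z4 ->
  (forall r : nat -> R[i],
    (forall n, climit (fun M => \prod_(m < M) rho2 z1 z2 z3 z4 tau m n) (r n)) ->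
    climit (fun N => \prod_(n < N) r n) E) ->
  E * quo4 z1 z2 z3 z4 (@esin R) * quo4 z1 z2 z3 z4 (fun z => esin (z / tau)) =
  quo4 z1 z2 z3 z4 id * quo4 z1 z2 z3 z4 (phi tau).
Proof.
move=> t_gt0 L1 L2 L3 L4 hE.
have t0 : tau != 0 by apply: contraTneq t_gt0 => ->; rewrite ltxx.
set Q := quo4 z1 z2 z3 z4; set ro := rho z1 z2 z3 z4.
have nL n z : ~ in_lattice tau z -> ~ in_lattice tau (n%:R * tau - z).
  move=> h /(in_latticeD (in_latticeN (in_lattice_mul tau n))) k; apply: h.
  have -> : z = - (- (n%:R * tau) + (n%:R * tau - z)) by ring.
  exact: in_latticeN k.
have nL' n z : ~ in_lattice tau z -> ~ in_lattice tau (n%:R * tau + z).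
  by move=> h; rewrite -[z]opprK; apply: nL => /in_latticeN; rewrite opprK.
have ro0 n : ro (n.+1%:R * tau) != 0.
  by apply: (@rho_neq0 z1 z2 z3 z4 tau) => //; exact: in_lattice_mul.
pose row n := Q (fun z => esin (n.+1%:R * tau - z) * esin (n.+1%:R * tau + z)).
have hrow n : climit (fun M => \prod_(m < M) rho2 z1 z2 z3 z4 tau m n)
    ((ro (n.+1%:R * tau))^-1 * row n).
  have := @row_limit _ z1 z2 z3 z4 (n.+1%:R * tau).
  move=> /(_ (esin_neq0 (nL _ _ L3)) (esin_neq0 (nL' _ _ L3))
             (esin_neq0 (nL _ _ L4)) (esin_neq0 (nL' _ _ L4))).
  move=> /(climitZ (ro (n.+1%:R * tau))^-1); apply: climit_eventually_eq.
  by exists 0%N => M _; rewrite mulrA mulVf ?ro0 // mul1r.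
have {}hE := hE _ hrow.
have hphi : climit (fun N => Q (@esin R) * \prod_(n < N) row n) (Q (phi tau)).
  have := @climit_quo4 _ z1 z2 z3 z4 _ _ (phi_limit t_gt0).
  have phi0 z : ~ in_lattice tau z -> phi tau z != 0.
    by move=> zL; rewrite mulf_neq0 ?oppr_eq0 ?cexp_neq0 //; exact: theta_nome_neq0.
  move=> /(_ (phi0 _ L3) (phi0 _ L4)); apply: climit_eventually_eq; exists 0%N => N _.
  rewrite quo4M quo4_prod; congr (_ * _); apply: eq_bigr => n _; rewrite /row /Q.
  rewrite -[LHS](@quo4Z _ _ _ _ _ (nome tau ^+ n.+1)^-1); last first.
    by rewrite invr_neq0 // expf_neq0 // nome_neq0.
  by congr quo4; apply/funext => z; rewrite esin_pair.
have hro : climit (fun N => Q (fun z => z / tau) * \prod_(n < N) ro (n.+1%:R * tau))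
    (Q (fun z => esin (z / tau))).
  have nLt z : ~ in_lattice tau z -> esin (z / tau) != 0.
    by move=> zL; apply: (@esin_neq0 _ (- tau^-1)) => /(in_lattice_inv t0).
  have := @row_limit0 _ (z1 / tau) (z2 / tau) (z3 / tau) (z4 / tau) (nLt _ L3) (nLt _ L4).
  apply: climit_eventually_eq; exists 0%N => N _; congr (_ * _).
  apply: eq_bigr => n _; rewrite /ro /rho -[RHS](@quo4Z _ _ _ _ _ (tau ^+ 2)^-1); last first.
    by rewrite invr_neq0 // expf_neq0.
  rewrite /quo4; congr (_ * _ / (_ * _)); by field.
have hid : Q (fun z => z / tau) = Q id.
  rewrite -[RHS](@quo4Z _ _ _ _ _ tau^-1) ?invr_neq0 //; congr quo4; apply/funext => z.
  by rewrite mulrC.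
have h1 := climitM (climitM hE (climit_cst (Q (@esin R)))) hro.
have h2 := climitZ (Q id) hphi.
apply: climit_unique h1 _; apply: climit_eventually_eq h2; exists 0%N => N _.
rewrite hid [in RHS]big_split /= prodfV.
have : \prod_(n < N) ro (n.+1%:R * tau) != 0 by apply/prodf_neq0.
by move: (\prod_(n < N) ro _) (\prod_(n < N) row _) => A B A0; field.
Qed.

(** [rows_limit] is used for tau and for -1/tau with the same [E]: once as a product by rows, once
    by columns. The two sine quotients trade places and the quotient of [id] is unchanged, so the
    quotients for [phi] must agree. *)
Lemma phi_quadruple tau z1 z2 z3 z4 : 0 < complex.Im tau ->
  z1 ^+ 2 + z2 ^+ 2 = z3 ^+ 2 + z4 ^+ 2 ->
  ~ in_lattice tau z1 -> ~ in_lattice tau z2 -> ~ in_lattice tau z3 -> ~ in_lattice tau z4 ->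
  quo4 z1 z2 z3 z4 (fun z => phi (- tau^-1) (z / tau)) = quo4 z1 z2 z3 z4 (phi tau).
Proof.
move=> t_gt0 hz L1 L2 L3 L4.
have t0 : tau != 0 by apply: contraTneq t_gt0 => ->; rewrite ltxx.
have t'_gt0 : 0 < complex.Im (- tau^-1) by rewrite Im_invN divr_gt0 // exprn_gt0 // cmod_gt0.
have [B hB] := rho2_summable hz (lt0r_neq0 t_gt0).
have [E [hr hc]] := @double_iprod _ (fun m n => rho2 z1 z2 z3 z4 tau m n - 1) _ hB.
have e1 (x : R[i]) : 1 + (x - 1) = x by rewrite addrC subrK.
have nL z : ~ in_lattice tau z -> ~ in_lattice (- tau^-1) (z / tau).
  by move=> h /(in_lattice_inv t0).
have h1 := @rows_limit tau z1 z2 z3 z4 E t_gt0 L1 L2 L3 L4.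
have h2 := @rows_limit (- tau^-1) (z1 / tau) (z2 / tau) (z3 / tau) (z4 / tau) E t'_gt0
  (nL _ L1) (nL _ L2) (nL _ L3) (nL _ L4).
have {}h1 : E * quo4 z1 z2 z3 z4 (@esin R) * quo4 z1 z2 z3 z4 (fun z => esin (z / tau)) =
    quo4 z1 z2 z3 z4 id * quo4 z1 z2 z3 z4 (phi tau).
  apply: h1 => r hyp; apply: hr => n; under eq_fun do under eq_bigr do rewrite e1.
  exact: hyp.
have hrho w : rho (z1 / tau) (z2 / tau) (z3 / tau) (z4 / tau) w = rho z1 z2 z3 z4 (w * tau).
  rewrite /rho -[LHS](@quo4Z _ _ _ _ _ (tau ^+ 2)) ?expf_neq0 //.
  rewrite /quo4; congr (_ * _ / (_ * _)); by field.
(* Multiplication by tau sends m - n/tau to m tau - n, so the rows for -1/tau are the columns for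
   tau. *)
have hrho2 m n : rho2 (z1 / tau) (z2 / tau) (z3 / tau) (z4 / tau) (- tau^-1) m n
    = rho2 z1 z2 z3 z4 tau n m.
  rewrite /rho2 !hrho [RHS]mulrC -[X in X * _ = _]rhoN; congr (_ * _); congr rho.
    by move: (m.+1%:R) (n.+1%:R) => x y; field.
  by move: (m.+1%:R) (n.+1%:R) => x y; field.
have {}h2 : E * quo4 z1 z2 z3 z4 (fun z => esin (z / tau)) * quo4 z1 z2 z3 z4 (@esin R) =
    quo4 z1 z2 z3 z4 id * quo4 z1 z2 z3 z4 (fun z => phi (- tau^-1) (z / tau)).
  have -> : quo4 z1 z2 z3 z4 (@esin R) =
      quo4 z1 z2 z3 z4 (fun z => esin (z / tau / - tau^-1)).
    rewrite -quo4N; congr quo4; apply/funext => z; rewrite -esinN; congr esin; by field.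
  have -> : quo4 z1 z2 z3 z4 id = quo4 z1 z2 z3 z4 (fun z => z / tau).
    by rewrite -(@quo4Z _ _ _ _ _ tau^-1) ?invr_neq0 //; congr quo4; apply/funext => z; rewrite mulrC.
  apply: h2 => r hyp; apply: hc => n; under eq_fun do under eq_bigr do rewrite e1 -hrho2.
  exact: hyp.
have nz z : ~ in_lattice tau z -> z != 0.
  by move=> zL; apply/eqP => z0; apply: zL; rewrite z0; exact: in_lattice0.
have Q0 : quo4 z1 z2 z3 z4 id != 0 by rewrite quo4_neq0 //=; apply: nz.
exact: (mulfI Q0 (etrans (esym h2) (etrans (mulrAC _ _ _) h1))).
Qed.
End QuadrupleTransformation.

(** * The inversion of the theta product *)

Section InversionConstant.
Variable R : realType.
Implicit Types (z tau : R[i]).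
Local Notation piI := (piI R).

Lemma upper_half_neq0 tau : 0 < complex.Im tau -> tau != 0.
Proof. by move=> h; apply: contraTneq h => ->; rewrite ltxx. Qed.

Lemma upper_half_inv tau : 0 < complex.Im tau -> 0 < complex.Im (- tau^-1).
Proof.
by move=> h; rewrite Im_invN divr_gt0 // exprn_gt0 // cmod_gt0 upper_half_neq0.
Qed.

Lemma nome_cexp z : nome z = cexp (piI * z) ^+ 2.
Proof. by rewrite -cexpMr /nome; congr cexp; ring. Qed.

Lemma cexp_piI : cexp piI = -1.
Proof. exact: cexp_pi_i. Qed.

Lemma phi_neq0 tau z : 0 < complex.Im tau -> ~ in_lattice tau z -> phi tau z != 0.
Proof.
by move=> t0 zL; rewrite mulf_neq0 ?oppr_eq0 ?cexp_neq0 //; exact: theta_nome_neq0.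
Qed.

Lemma phi_eq0 tau z : 0 < complex.Im tau -> in_lattice tau z -> phi tau z = 0.
Proof. by move=> t0 zL; rewrite /phi theta_nome_eq0 ?mulr0. Qed.

Lemma phi_add1 tau z : phi tau (z + 1) = - phi tau z.
Proof.
rewrite /phi nomeD nome1 mulr1 mulrDr mulr1 opprD cexpD [cexp (- piI)]cexpN cexp_piI invrN1.
by ring.
Qed.

Lemma phiN tau z : 0 < complex.Im tau -> phi tau (- z) = - phi tau z.
Proof.
move=> t0; rewrite /phi nomeN theta_inv ?nome_neq0 ?cmod_nome_lt1 // nome_cexp mulrN opprK cexpN.
by move: (cexp_neq0 (piI * z)); move: (cexp _) => e e0; field.
Qed.

Lemma phi_subtau tau z : 0 < complex.Im tau ->
  phi tau (z - tau) = - (nome z * cexp (- (piI * tau))) * phi tau z.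
Proof.
move=> t0; have zt : z = (z - tau) + tau by rewrite subrK.
rewrite [in RHS]zt; move: (z - tau) => u.
rewrite /phi nomeD theta_mulq ?nome_neq0 ?cmod_nome_lt1 // !nome_cexp.
rewrite mulrDr opprD cexpD !cexpN.
move: (cexp_neq0 (piI * u)) (cexp_neq0 (piI * tau)).
by move: (cexp (piI * u)) (cexp (piI * tau)) => e f e0 f0; field; rewrite e0 f0.
Qed.

Section Fixed.
Variable tau : R[i].
Hypothesis t_gt0 : 0 < complex.Im tau.
Let t0 : tau != 0 := upper_half_neq0 t_gt0.
Let t'_gt0 := upper_half_inv t_gt0.

Let gauss z : R[i] := cexp (- (piI * z ^+ 2 / tau)).

(* Elliptic and zero-free, hence constant; [inversion_ratio_const] proves
   constancy from the quadruple relation alone. *)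
Definition inversion_ratio z : R[i] := phi (- tau^-1) (z / tau) / phi tau z * gauss z.
Local Notation k := inversion_ratio.

Lemma inversion_ratioN z : k (- z) = k z.
Proof.
rewrite /inversion_ratio mulNr !phiN // invrN mulrNN; congr (_ * cexp _).
by rewrite sqrrN.
Qed.

(** A shift of z by 1 moves z/tau by the quasi-period 1/tau of the numerator; the exponential factor
    which this produces is the one by which the Gaussian changes. *)
Lemma inversion_ratio_add1 z : k (z + 1) = k z.
Proof.
rewrite /inversion_ratio phi_add1.
have -> : (z + 1) / tau = z / tau - (- tau^-1) by rewrite opprK mulrDl mul1r.
rewrite phi_subtau //.
have -> : gauss (z + 1) = gauss z * (nome (z / tau) * cexp (piI / tau))^-1.
  rewrite /nome -cexpD -cexpN -cexpD; congr cexp; by field.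
have -> : - (piI * - tau^-1) = piI / tau by ring.
move: (nome_neq0 (z / tau)) (cexp_neq0 (piI / tau)).
move: (nome (z / tau)) (cexp (piI / tau)) => n e n0 e0.
move: (phi (- tau^-1) (z / tau)) (phi tau z) (gauss z) => a b c.
by rewrite invrN; move: b^-1 => d; field; rewrite n0 e0.
Qed.

Lemma inversion_ratio_nat z n : k (z + n%:R) = k z.
Proof.
elim: n => [|n IH]; first by rewrite addr0.
by rewrite -natr1 addrA inversion_ratio_add1.
Qed.

Lemma inversion_ratio_neq0 z : ~ in_lattice tau z -> k z != 0.
Proof.
move=> zL; apply: mulf_neq0; last exact: cexp_neq0.
apply: mulf_neq0; last exact: invr_neq0 (phi_neq0 t_gt0 zL).
by apply: (phi_neq0 t'_gt0) => h; exact: zL (in_lattice_inv t0 h).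
Qed.

Lemma inversion_ratio_quadruple z1 z2 z3 z4 : z1 ^+ 2 + z2 ^+ 2 = z3 ^+ 2 + z4 ^+ 2 ->
  ~ in_lattice tau z1 -> ~ in_lattice tau z2 -> ~ in_lattice tau z3 -> ~ in_lattice tau z4 ->
  k z1 * k z2 = k z3 * k z4.
Proof.
move=> hz L1 L2 L3 L4.
have h := phi_quadruple t_gt0 hz L1 L2 L3 L4.
have L' z : ~ in_lattice tau z -> phi (- tau^-1) (z / tau) != 0.
  by move=> zL; apply: (phi_neq0 t'_gt0) => h'; exact: zL (in_lattice_inv t0 h').
have hg : gauss z1 * gauss z2 = gauss z3 * gauss z4.
  rewrite /gauss -!cexpD; congr cexp.
  have -> : z1 ^+ 2 = z3 ^+ 2 + z4 ^+ 2 - z2 ^+ 2 by rewrite -hz; ring.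
  by field.
rewrite /inversion_ratio mulrACA hg [RHS]mulrACA; congr (_ * _).
move: h; rewrite /quo4.
move: (L' _ L1) (L' _ L2) (L' _ L3) (L' _ L4).
move: (phi_neq0 t_gt0 L1) (phi_neq0 t_gt0 L2) (phi_neq0 t_gt0 L3) (phi_neq0 t_gt0 L4).
set a1 := phi tau z1; set a2 := phi tau z2; set a3 := phi tau z3; set a4 := phi tau z4.
set b1 := phi _ (z1 / tau); set b2 := phi _ (z2 / tau); set b3 := phi _ (z3 / tau).
set b4 := phi _ (z4 / tau); move: a1 a2 a3 a4 b1 b2 b3 b4 => a1 a2 a3 a4 b1 b2 b3 b4.
move=> A1 A2 A3 A4 B1 B2 B3 B4 h.
have -> : b1 / a1 * (b2 / a2) = (b1 * b2 / (b3 * b4)) * (b3 * b4) / (a1 * a2).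
  by field; rewrite A1 A2 B3 B4.
by rewrite h; field; rewrite A1 A2 A3 A4.
Qed.

Lemma int_lattice_inj (a b a' b' : int) :
  a%:~R + b%:~R * tau = a'%:~R + b'%:~R * tau -> a = a' /\ b = b'.
Proof.
have hI (c : int) : (c%:~R : R[i]) = (c%:~R : R)%:C by rewrite rmorph_int.
rewrite !hI; case: tau t_gt0 => x y /= y0; simpc => -[h1 /(mulIf (lt0r_neq0 y0))].
by move=> /intr_inj e; move: h1; rewrite e => /addIr /intr_inj.
Qed.

(** The quotient is the solution s of (s+n)^2 - s^2 = d. If it were a lattice point for every n,
    both lattice coordinates of d would be divisible by every n, hence 0. One n exceeding the sum of
    their absolute values is enough. *)
Lemma generic_shift (d : R[i]) : d != 0 ->
  exists2 n : nat, (0 < n)%N & ~ in_lattice tau ((d - n%:R ^+ 2) / (2 * n%:R)).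
Proof.
move=> d0; apply: contrapT => hn.
have hL (n : nat) : (0 < n)%N -> exists a b : int,
    d = (n%:Z ^+ 2 + 2 * n%:Z * a)%:~R + (2 * n%:Z * b)%:~R * tau.
  move=> n0; have n0' : (n%:R : R[i]) != 0 by rewrite pnatr_eq0 -lt0n.
  have [a [b h]] : in_lattice tau ((d - n%:R ^+ 2) / (2 * n%:R)).
    by apply: contrapT => h; apply: hn; exists n.
  exists a, b; have -> : d = n%:R ^+ 2 + (2 * n%:R) * ((d - n%:R ^+ 2) / (2 * n%:R)).
    by move: n0'; move: (n%:R) => N N0; field.
  by rewrite h !rmorphD !rmorphM /= -!pmulrn; ring.
have [a1 [b1 h1]] := hL 1%N isT.
set x := (_ + _)%:~R in h1; set d1 := (_ + _) in x h1; set d2 := 2 * _ * b1 in h1.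
have [a [b]] := hL (`|d1| + `|d2|).+1%N isT.
rewrite {1}h1 /x => /int_lattice_inj[e1 e2].
have small (N : nat) (x0 y : int) : x0 = N%:Z * y -> (`|x0| < N)%N -> x0 = 0.
  move=> ->; rewrite abszM /=; have [->|y0] := eqVneq y 0; first by rewrite mulr0.
  by rewrite -absz_gt0 in y0; nia.
case/negP: d0; apply/eqP; rewrite h1 /x.
rewrite (small (`|d1| + `|d2|).+1 d1 ((`|d1| + `|d2|).+1%:Z + 2 * a)); [|by rewrite {1}e1; ring|by lia].
rewrite (small (`|d1| + `|d2|).+1 d2 (2 * b)); [|by rewrite {1}e2; ring|by lia].
by rewrite !mulr0z mul0r addr0.
Qed.

Lemma inversion_ratio_const z z' : ~ in_lattice tau z -> ~ in_lattice tau z' -> k z = k z'.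
Proof.
move=> L L'; have [d0|d0] := eqVneq (z ^+ 2 - z' ^+ 2) 0.
  move/eqP: d0; rewrite subr_eq0 eqf_sqr => /orP[/eqP -> //|/eqP ->].
  exact: inversion_ratioN.
have [n n0 Ls] := generic_shift d0; set s := _ / _ in Ls.
have n0' : (n%:R : R[i]) != 0 by rewrite pnatr_eq0 -lt0n.
have Lsn : ~ in_lattice tau (s + n%:R).
  move=> h; apply: Ls; have -> : s = s + n%:R + - n%:R by ring.
  by apply: in_latticeD => //; apply: in_latticeN; exact: in_lattice_nat.
have e : z ^+ 2 + s ^+ 2 = z' ^+ 2 + (s + n%:R) ^+ 2.
  by rewrite /s; move: n0'; move: (n%:R) => N N0; field.
have := inversion_ratio_quadruple e L Ls L' Lsn.
by rewrite inversion_ratio_nat => /mulIf; apply; exact: inversion_ratio_neq0.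
Qed.

Lemma half_nin_lattice : ~ in_lattice tau 2^-1.
Proof.
move=> [a [b h]].
have /int_lattice_inj[h1 _] : (1 : int)%:~R + (0 : int)%:~R * tau = (2 * a)%:~R + (2 * b)%:~R * tau.
  have -> : (1 : int)%:~R + (0 : int)%:~R * tau = 2 * 2^-1 :> R[i] by rewrite mulr1z mulr0z; field.
  by rewrite h !rmorphM /=; ring.
by lia.
Qed.

Lemma phi_inversion : exists c : R[i],
  forall z, phi (- tau^-1) (z / tau) = c * cexp (piI * z ^+ 2 / tau) * phi tau z.
Proof.
exists (k 2^-1) => z; have [zL|zL] := pselect (in_lattice tau z).
  by rewrite !phi_eq0 ?mulr0 //; exact: in_lattice_inv'.
rewrite -(inversion_ratio_const zL half_nin_lattice) /inversion_ratio /gauss cexpN.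
move: (phi_neq0 t_gt0 zL) (cexp_neq0 (piI * z ^+ 2 / tau)).
by move: (phi _ _) (phi _ _) (cexp _) => a b e b0 e0; field; rewrite b0 e0.
Qed.

End Fixed.
End InversionConstant.

(** * Torsion points *)

Section TwistedTheta.
Variable R : realType.
Implicit Types (z q w tau : R[i]) (a b : R).
Local Notation piI := (piI R).

(* The product formula for the partition function at (alpha, beta) = x. *)
Definition ztheta (x : R * R) tau : R[i] :=
  nome (((x.2 + 2^-1) ^+ 2 / 2 - 24^-1)%:C * tau) *
  theta (nome (x.1%:C - x.2%:C * tau)) (nome tau).

Lemma theta_phi tau z : theta (nome z) (nome tau) = - cexp (piI * z) * phi tau z.
Proof.
rewrite /phi mulrA mulrNN -cexpD subrr cexp0 mul1r //.
Qed.

(** At this stage c may depend on tau; that it does not depend on (a, b) is what allows the torsion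
    points to determine it. *)
Lemma ztheta_inversion tau : 0 < complex.Im tau -> exists c : R[i], forall a b,
  ztheta (b, - a) (- tau^-1) = c * nome ((2^-1 + b) * (2^-1 - a))%:C * ztheta (a, b) tau.
Proof.
move=> t_gt0; have t0 := upper_half_neq0 t_gt0.
have [c hc] := phi_inversion t_gt0.
(* The half period for which z = -k' - k tau + p, with k = b + 1/2 and k' = 1/2 - a. Expanding
   z^2/(2 tau) then yields both quadratic prefactors, the phase k k', the linear terms in z, and a
   remainder free of a and b that goes into the constant. *)
pose p : R[i] := (1 + tau) / 2.
exists (- c * nome (- (p ^+ 2 / (2 * tau)) + (24 * tau)^-1 + tau / 24)) => a b.
rewrite /ztheta /= !theta_phi.
set z := a%:C - b%:C * tau.
have -> : b%:C - (- a)%:C * - tau^-1 = (- z) / tau by rewrite rmorphN /= /z; field.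
rewrite hc phiN // sqrrN.
move: (phi tau z) => f.
set k := (b + 2^-1)%:C; set k' := (- a + 2^-1)%:C.
have hk : z = - k' - k * tau + p.
  by rewrite /z /k /k' /p !rmorphD rmorphN /= fmorphV rmorph_nat; field.
have r24 : (24^-1)%:C = 24^-1 :> R[i] by rewrite fmorphV rmorph_nat.
have rk (x : R) : (x ^+ 2 / 2 - 24^-1)%:C = x%:C ^+ 2 / 2 - 24^-1 :> R[i].
  by rewrite rmorphB /= r24 rmorphM /= rmorphXn fmorphV /= rmorph_nat.
have -> : ((2^-1 + b) * (2^-1 - a))%:C = k * k' :> R[i].
  by rewrite -rmorphM /=; congr (_%:C); ring.
rewrite !rk -/k -/k'; clearbody z k k'.
have hcn (x : R[i]) : cexp (piI * x) = nome (x / 2) by rewrite /nome; congr cexp; field.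
have -> : piI * z ^+ 2 / tau = piI * (z ^+ 2 / tau) by ring.
rewrite !hcn.
set L1 := nome ((k' ^+ 2 / 2 - 24^-1) * - tau^-1); set L2 := nome (- z / tau / 2).
set L3 := nome (z ^+ 2 / tau / 2); set L4 := nome (_ + tau / 24); set L5 := nome (k * k').
set L6 := nome (_ * tau); set L7 := nome (z / 2).
have : L1 * L2 * L3 = L4 * L5 * L6 * L7.
  rewrite /L1 /L2 /L3 /L4 /L5 /L6 /L7 -!nomeD; congr nome.
  by rewrite hk /p; field.
clearbody L1 L2 L3 L4 L5 L6 L7 => hL.
have -> : L1 * (- L2 * (c * L3 * - f)) = c * f * (L1 * L2 * L3) by ring.
by rewrite hL; ring.
Qed.

Lemma ztheta_add1 a b tau : ztheta (a + 1, b) tau = ztheta (a, b) tau.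
Proof.
rewrite /ztheta /=.
have -> : (a + 1)%:C - b%:C * tau = (a%:C - b%:C * tau) + 1 by rewrite rmorphD /=; ring.
by rewrite nomeD nome1 mulr1.
Qed.

(** Needed because S permutes the 3-torsion pairs used below only up to sign. *)
Lemma ztheta_opp a b tau : 0 < complex.Im tau ->
  ztheta (- a, - b) tau = - nome (- a)%:C * ztheta (a, b) tau.
Proof.
move=> t0; rewrite /ztheta /=.
have -> : (- a)%:C - (- b)%:C * tau = - (a%:C - b%:C * tau) by rewrite !rmorphN /=; ring.
rewrite nomeN theta_inv ?nome_neq0 ?cmod_nome_lt1 // -nomeN.
have -> : nome (((- b + 2^-1) ^+ 2 / 2 - 24^-1)%:C * tau) =
    nome (- (b%:C * tau)) * nome (((b + 2^-1) ^+ 2 / 2 - 24^-1)%:C * tau).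
  rewrite -nomeD; congr nome; rewrite -mulNr -mulrDl -rmorphN -rmorphD /=.
  by congr (_%:C * _); field.
have -> : nome (- a)%:C = nome (- (b%:C * tau)) * nome (- (a%:C - b%:C * tau)).
  by rewrite -nomeD; congr nome; rewrite rmorphN /=; ring.
ring.
Qed.

Lemma ztheta_translation a b tau :
  ztheta (a + b, b) (tau + 1) = nome ((b + 2^-1) ^+ 2 / 2 - 24^-1)%:C * ztheta (a, b) tau.
Proof.
rewrite /ztheta /= mulrDr mulr1 !nomeD nome1 mulr1 -!nomeD.
have -> : (a + b)%:C - b%:C * (tau + 1) = a%:C - b%:C * tau by rewrite rmorphD /=; ring.
by rewrite nomeD; ring.
Qed.

(** * Theta products over 2- and 3-torsion points *)

Section Torsion.
Variable q : R[i].
Hypothesis q1 : cmod q < 1.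

Let euler n : R[i] := \prod_(l < n) (1 - q ^+ l.+1).

Lemma euler_cvg : exists2 P, P != 0 & climit euler P.
Proof.
have hB n : \sum_(i < n) cmod (- q ^+ i.+1) <= (1 - cmod q)^-1.
  apply: le_trans (geometric_sum_le n (_ : 0 <= cmod q < 1)); last by rewrite cmod_ge0.
  apply: ler_sum => i _; rewrite cmodN cmodX exprS ler_piMl ?exprn_ge0 ?cmod_ge0 //.
  exact: ltW.
have [P hP] := @iprod_cvg _ (fun i => - q ^+ i.+1) _ hB; exists P => //.
apply: (@iprod_neq0 _ (fun i => - q ^+ i.+1) _ _ hB _ hP) => i; rewrite subr_eq0; apply/eqP => h.
have : cmod (q ^+ i.+1) < 1 by rewrite cmodX exprn_ilt1 // cmod_ge0.
by rewrite -h cmod1 ltxx.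
Qed.

(** This is the square of Euler's identity prod (1+q^l)(1-q^(2l-1)) = 1; the 2 is the leftover
    factor 1 + q^0. Multiplying by the square of prod (1-q^l) turns it into an exact identity of
    finite products: 1-q^(2l) and 1-q^(2l-1) together exhaust the exponents up to 2N. *)
Lemma theta_2torsion (p : R[i]) : p ^+ 2 = q -> p != 0 ->
  theta (-1) q * theta p q * theta (- p) q = 2.
Proof.
move=> pq p0; have [P P0 hP] := euler_cvg.
have h1 : climit (fun N => thetaN (-1) q N * thetaN p q N * thetaN (- p) q N * (1 - (-1) * q ^+ N)
    * (euler N) ^+ 2) (theta (-1) q * theta p q * theta (- p) q * 1 * P ^+ 2).
  apply: climitM; last exact: climitM.
  apply: climitM; last exact: climit_1BM.
  by do 2?apply: climitM; exact: thetaP.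
have h2 : climit (fun N => 2 * euler (N + N)%N ^+ 2) (2 * P ^+ 2).
  apply: climitZ; have := climit_comp hP (fun n => leq_addr n n).
  by move=> h; exact: (climitM h h).
have key N : thetaN (-1) q N * thetaN p q N * thetaN (- p) q N * (1 - (-1) * q ^+ N)
    * (euler N) ^+ 2 = 2 * euler (N + N)%N ^+ 2.
  rewrite /thetaN /euler; elim: N => [|N IH]; first by rewrite !big_ord0 expr0; ring.
  rewrite addSn addnS !big_ord_recr /=.
  move: IH; set A := \prod_(l < N) _; set B := \prod_(l < N) _; set C := \prod_(l < N) _.
  set D := \prod_(l < N) _; set E := \prod_(l < N + N) _ => IH.
  set Q := q ^+ N in IH *.
  have -> : q ^+ (N + N).+1 = q * Q ^+ 2 by rewrite /Q exprS exprD expr2.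
  have -> : q ^+ (N + N).+2 = q ^+ 2 * Q ^+ 2 by rewrite /Q -addn2 -addn2 exprD exprD; ring.
  have -> : q ^+ N.+1 = q * Q by rewrite /Q exprS.
  have -> : (-1 : R[i])^-1 = -1 by rewrite invrN1.
  have e1 : p^-1 * (q * Q) = p * Q by rewrite -pq; field.
  have e2 : (- p)^-1 * (q * Q) = - (p * Q) by rewrite -pq; field.
  rewrite e1 e2.
  have -> : A * ((1 - -1 * Q) * (1 - -1 * (q * Q))) * (B * ((1 - p * Q) * (1 - p * Q))) *
    (C * ((1 - - p * Q) * (1 - - (p * Q)))) * (1 - -1 * (q * Q)) *
    (D * (1 - q * Q)) ^+ 2 = (A * B * C * (1 - -1 * Q) * D ^+ 2) *
     ((1 + q * Q) * (1 - p * Q) ^+ 2 * (1 + p * Q) ^+ 2 * (1 + q * Q) * (1 - q * Q) ^+ 2) by ring.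
  by rewrite IH -pq; ring.
have := climit_unique h1 (climit_eventually_eq (ex_intro _ 0%N (fun n _ => esym (key n))) h2).
by rewrite mulr1 => /(mulIf (expf_neq0 2 P0)).
Qed.

(** As w is a primitive cube root of unity, (1-y)(1-wy)(1-y/w) = 1 - y^3. With y = r q^l, r^2 q^l
    and q^(l+1) this runs through 1 - q^j for the three residues of j modulo 3, and the l = 0 factor
    1 - w of [theta w q] is left over. *)
Lemma theta_3torsion (w r : R[i]) : w ^+ 2 + w + 1 = 0 -> r ^+ 3 = q -> r != 0 ->
  theta w q * theta r q * theta (w * r) q * theta (w^-1 * r) q = 1 - w.
Proof.
move=> hw rq r0; have [P P0 hP] := euler_cvg.
have w0 : w != 0.
  by apply/eqP => w0; move/eqP: hw; rewrite w0 expr0n /= !add0r oner_eq0.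
have wV : w^-1 = w ^+ 2.
  have w3 : w ^+ 3 = 1.
    have -> : w ^+ 3 = (w - 1) * (w ^+ 2 + w + 1) + 1 by ring.
    by rewrite hw mulr0 add0r.
  by apply: (mulIf w0); rewrite mulVf // -w3; ring.
have h1 : climit (fun N => thetaN w q N * thetaN r q N * thetaN (w * r) q N * thetaN (w^-1 * r) q N
    * (1 - w * q ^+ N) * euler N)
    (theta w q * theta r q * theta (w * r) q * theta (w^-1 * r) q * 1 * P).
  apply: climitM => //; apply: climitM; last exact: climit_1BM.
  by do 3?apply: climitM; exact: thetaP.
have h2 : climit (fun N => (1 - w) * euler (N + N + N)%N) ((1 - w) * P).
  by apply: climitZ; apply: (climit_comp hP) => n; rewrite -addnA leq_addr.
have key N : thetaN w q N * thetaN r q N * thetaN (w * r) q N * thetaN (w^-1 * r) q N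
    * (1 - w * q ^+ N) * euler N = (1 - w) * euler (N + N + N)%N.
  rewrite /thetaN /euler; elim: N => [|N IH]; first by rewrite !big_ord0 expr0; ring.
  have -> : (N.+1 + N.+1 + N.+1 = (N + N + N).+3)%N by lia.
  rewrite !big_ord_recr /=.
  move: IH; set A := \prod_(l < N) _; set B := \prod_(l < N) _; set C := \prod_(l < N) _.
  set C' := \prod_(l < N) _.
  set D := \prod_(l < N) _; set E := \prod_(l < N + N + N) _ => IH.
  set Q := q ^+ N in IH *.
  have -> : q ^+ (N + N + N).+1 = q * Q ^+ 3 by rewrite /Q exprS -exprM; congr (_ * _ ^+ _); lia.
  have -> : q ^+ (N + N + N).+2 = q ^+ 2 * Q ^+ 3 by rewrite /Q -exprM -exprD; congr (_ ^+ _); lia.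
  have -> : q ^+ (N + N + N).+3 = q ^+ 3 * Q ^+ 3 by rewrite /Q -exprM -exprD; congr (_ ^+ _); lia.
  have -> : q ^+ N.+1 = q * Q by rewrite /Q exprS.
  have e1 : r^-1 * (q * Q) = r ^+ 2 * Q by rewrite -rq; field.
  have e2 : (w * r)^-1 * (q * Q) = w^-1 * (r ^+ 2 * Q) by rewrite -rq; field; rewrite r0 w0.
  have e3 : (w^-1 * r)^-1 * (q * Q) = w * (r ^+ 2 * Q) by rewrite -rq; field; rewrite r0 w0.
  rewrite e1 e2 e3.
  have cube (y : R[i]) : (1 - y) * (1 - w * y) * (1 - w^-1 * y) = 1 - y ^+ 3.
    rewrite wV; have -> : (1 - y) * (1 - w * y) * (1 - w ^+ 2 * y) =
      1 - y * (w ^+ 2 + w + 1) + w * y ^+ 2 * (w ^+ 2 + w + 1)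
        - y ^+ 3 * (1 + (w - 1) * (w ^+ 2 + w + 1)) by ring.
    by rewrite hw !mulr0; ring.
  have c1 := cube (r * Q); have c2 := cube (r ^+ 2 * Q); have c3 := cube (q * Q).
  transitivity ((A * B * C * C' * (1 - w * Q) * D) *
     (((1 - r * Q) * (1 - w * (r * Q)) * (1 - w^-1 * (r * Q))) *
      ((1 - r ^+ 2 * Q) * (1 - w * (r ^+ 2 * Q)) * (1 - w^-1 * (r ^+ 2 * Q))) *
      ((1 - q * Q) * (1 - w * (q * Q)) * (1 - w^-1 * (q * Q))))).
    by move: w^-1 => v; ring.
  by rewrite c1 c2 c3 IH -rq; ring.
have := climit_unique h1 (climit_eventually_eq (ex_intro _ 0%N (fun n _ => esym (key n))) h2).
by rewrite mulr1 => /(mulIf P0).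
Qed.

End Torsion.
Lemma nome_rat_neq1 (n : nat) : (1 < n)%N -> nome (n%:R^-1) != 1 :> R[i].
Proof.
move=> n1; apply/eqP => /nome_eq1[k hk].
have n0 : (n%:R : R[i]) != 0 by rewrite pnatr_eq0 -lt0n ltnW.
have : (1%:Z%:~R : R[i]) = (k * n%:Z)%:~R by rewrite rmorphM /= -hk -pmulrn mulVf.
move=> /intr_inj /(congr1 absz); rewrite abszM /= => /esym/eqP.
by rewrite muln_eq1 => /andP[_ /eqP e]; rewrite e in n1.
Qed.

Lemma nome_half : nome (2^-1) = -1 :> R[i].
Proof. by rewrite /nome (_ : 2 * piI * 2^-1 = piI) ?cexp_piI //; field. Qed.

(** The powers of q in front cancel: the exponents are 1/12, -1/24 and -1/24. *)
Lemma ztheta_2torsion tau : 0 < complex.Im tau ->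
  ztheta (2^-1, 0) tau * ztheta (0, - 2^-1) tau * ztheta (2^-1, - 2^-1) tau = 2.
Proof.
move=> t_gt0; rewrite /ztheta /=.
have -> : (2^-1)%:C - (0 : R)%:C * tau = 2^-1 by rewrite mul0r subr0 fmorphV rmorph_nat.
have -> : (0 : R)%:C - (- 2^-1)%:C * tau = tau / 2.
  by rewrite rmorphN /= fmorphV rmorph_nat; ring.
have -> : (2^-1)%:C - (- 2^-1)%:C * tau = 2^-1 + tau / 2.
  by rewrite rmorphN /= fmorphV rmorph_nat; ring.
rewrite nomeD nome_half mulN1r addNr.
set p := nome (tau / 2).
have hp : p ^+ 2 = nome tau by rewrite /p -nomeMn; congr nome; field.
rewrite -[RHS](theta_2torsion (cmod_nome_lt1 t_gt0) hp (nome_neq0 _)).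
set A := nome (_ * tau); set B := nome ((0 ^+ 2 / 2 - _)%:C * tau).
have : A * B * B = 1.
  rewrite /A /B -!nomeD -(nome_int R 0); congr nome; rewrite -!mulrDl -!rmorphD /=.
  have -> : (0 + 2^-1) ^+ 2 / 2 - 24^-1 + (0 ^+ 2 / 2 - 24^-1) + (0 ^+ 2 / 2 - 24^-1) = 0 :> R by field.
  by rewrite mul0r.
move: A B (theta (-1) _) (theta p _) (theta (- p) _) => A B x y z h.
by rewrite -[RHS]mul1r -h; ring.
Qed.

Lemma nome_third : nome (3^-1) ^+ 2 + nome (3^-1) + 1 = 0 :> R[i].
Proof.
have h := @nome_rat_neq1 3 isT; rewrite -subr_eq0 in h; apply: (mulfI h); rewrite mulr0.
have h3 : nome (3^-1) ^+ 3 = 1 :> R[i] by rewrite -nomeMn mulVf ?nome1 // pnatr_eq0.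
by move: (nome _) h3 => w h3; rewrite -[RHS](subrr 1) -{3}h3; ring.
Qed.

(** Again the powers of q in front cancel, with exponents 1/12 and three times -1/36. *)
Lemma ztheta_3torsion tau : 0 < complex.Im tau ->
  ztheta (3^-1, 0) tau * ztheta (0, - 3^-1) tau * ztheta (3^-1, - 3^-1) tau
    * ztheta (- 3^-1, - 3^-1) tau = 1 - nome (3^-1).
Proof.
move=> t_gt0; rewrite /ztheta /=.
have -> : (3^-1)%:C - (0 : R)%:C * tau = 3^-1 by rewrite mul0r subr0 fmorphV rmorph_nat.
have -> : (0 : R)%:C - (- 3^-1)%:C * tau = tau / 3.
  by rewrite rmorphN /= fmorphV rmorph_nat; ring.
have -> : (3^-1)%:C - (- 3^-1)%:C * tau = 3^-1 + tau / 3.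
  by rewrite rmorphN /= fmorphV rmorph_nat; ring.
have -> : (- 3^-1)%:C - (- 3^-1)%:C * tau = - 3^-1 + tau / 3.
  by rewrite rmorphN /= fmorphV rmorph_nat; ring.
rewrite !nomeD nomeN.
set r := nome (tau / 3).
have hr : r ^+ 3 = nome tau by rewrite /r -nomeMn; congr nome; field.
rewrite -[RHS](theta_3torsion (cmod_nome_lt1 t_gt0) nome_third hr (nome_neq0 _)).
set A := nome (_ * tau); set B := nome (_ * tau).
have : A * B * B * B = 1.
  rewrite /A /B -!nomeD -(nome_int R 0); congr nome; rewrite -!mulrDl -!rmorphD /=.
  set x := (X in X%:C); have -> : x = 0 by rewrite /x; field.
  by rewrite mul0r.
move: A B (theta _ _) (theta _ _) (theta _ _) (theta _ _) => A B x y z t h.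
by rewrite -[RHS]mul1r -h; ring.
Qed.

Lemma ztheta_S a b tau : 0 < complex.Im tau ->
  ztheta (b, - a) (- tau^-1) = nome ((2^-1 + b) * (2^-1 - a))%:C * ztheta (a, b) tau.
Proof.
move=> t_gt0; have t'_gt0 := upper_half_inv t_gt0.
have [c hc] := ztheta_inversion t_gt0; rewrite hc.
suff -> : c = 1 by rewrite mul1r.
(* S exchanges (1/2, 0) and (0, -1/2) and fixes (1/2, -1/2), up to adding 1 to the first entry, and
   all three phases are 1. Both products equal 2, hence c^3 = 1. *)
have c3 : c ^+ 3 = 1.
  have h2 := ztheta_2torsion t_gt0; have := ztheta_2torsion t'_gt0.
  have e1 := hc (2^-1) 0; have e2 := hc 0 (- 2^-1); have e3 := hc (2^-1) (- 2^-1).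
  have hh : - 2^-1 + 1 = 2^-1 :> R by field.
  have n00 : nome (0 : R)%:C = 1 by exact: (nome_int R 0).
  rewrite oppr0 -[LHS]ztheta_add1 hh subrr mul0r n00 mulr1 in e2.
  rewrite -[LHS]ztheta_add1 hh subrr mul0r n00 mulr1 in e3.
  rewrite subrr mulr0 n00 mulr1 in e1.
  rewrite e1 e2 e3 => h.
  have n2 : (2 : R[i]) != 0 by rewrite pnatr_eq0.
  move: h2 h; move: (ztheta _ tau) (ztheta _ tau) (ztheta _ tau) => A B C h2 h.
  have : c ^+ 3 * (C * B * A) = 1 * (C * B * A) by rewrite mul1r [RHS]h2 -[RHS]h; ring.
  by rewrite h2 => /(mulIf n2).
(* S carries (1/3, 0) to (0, -1/3) and (1/3, -1/3) to (-1/3, -1/3), and sends the images back to the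
   negatives of the initial pairs. The two sign changes cost w^-2, which the product w^2 of the four
   phases compensates. *)
have c4 : c ^+ 4 = 1.
  have h3 := ztheta_3torsion t_gt0; have := ztheta_3torsion t'_gt0.
  have e1 := hc (3^-1) 0; have e2 := hc 0 (- 3^-1); have e3 := hc (3^-1) (- 3^-1).
  have e4 := hc (- 3^-1) (- 3^-1).
  have o2 := ztheta_opp (3^-1) 0 t'_gt0; have o4 := ztheta_opp (3^-1) (- 3^-1) t'_gt0.
  rewrite o2 in e2; rewrite o4 in e4.
  have n3 := @nome_rat_neq1 3 isT; rewrite eq_sym -subr_eq0 in n3.
  set w := nome (- 3^-1)%:C in e2 e4.
  have w0 : w != 0 by exact: nome_neq0.
  set u1 := nome _ in e1; set u2 := nome _ in e2; set u3 := nome _ in e3; set u4 := nome _ in e4.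
  have hu : u1 * u2 * u3 * u4 = w ^+ 2.
    rewrite /u1 /u2 /u3 /u4 /w -nomeMn -!nomeD -!rmorphD /=.
    set x := (X in nome X%:C = _).
    have -> : x = - 3^-1 * 2 + 1 by rewrite /x; field.
    by rewrite rmorphD rmorphM /= nomeD nome1 mulr1 rmorph_nat.
  rewrite e1 e3.
  have -> : ztheta (3^-1, 0) (- tau^-1) = - w^-1 * (c * u2 * ztheta (0, - 3^-1) tau).
    by rewrite -e2; field.
  have -> : ztheta (3^-1, - 3^-1) (- tau^-1) = - w^-1 * (c * u4 * ztheta (- 3^-1, - 3^-1) tau).
    by rewrite -e4; field.
  move: h3; move: (1 - nome _) n3 => D3 n3.
  move: (ztheta _ tau) (ztheta _ tau) (ztheta _ tau) (ztheta _ tau) => A B C D h3.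
  have -> : - w^-1 * (c * u2 * C) * (c * u1 * D) * (- w^-1 * (c * u4 * A)) * (c * u3 * B) =
    w^-1 ^+ 2 * (u1 * u2 * u3 * u4) * (c ^+ 4 * (D * C * B * A)) by ring.
  rewrite hu h3 => h; apply: (mulIf n3); rewrite mul1r -[RHS]h; by field.
by rewrite -c4 exprS c3 mulr1.
Qed.

End TwistedTheta.

(** * The modular group and the multiplier *)

Section ModularGroup.

Lemma mx22P (T : Type) (A B : 'M[T]_2) : A 0 0 = B 0 0 -> A 0 1 = B 0 1 ->
  A 1 0 = B 1 0 -> A 1 1 = B 1 1 -> A = B.
Proof.
move=> h00 h01 h10 h11; apply/matrixP => i j.
have o2 (k : 'I_2) : k = 0 \/ k = 1.
  by case: k => [[|[|k]] hk] //; [left|right]; apply: val_inj.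
by case: (o2 i) => ->; case: (o2 j) => ->.
Qed.

Lemma det_mx22E (A : 'M[int]_2) : \det A = A 0 0 * A 1 1 - A 0 1 * A 1 0.
Proof.
rewrite (expand_det_row _ 0) big_ord_recl big_ord1 /cofactor !det_mx11 !mxE /=.
rewrite expr0 expr1 mul1r mulN1r mulrN; congr (_ * A _ _ - A _ _ * A _ _); exact: val_inj.
Qed.

Lemma mulmx22 (A B : 'M[int]_2) i j : (A *m B) i j = A i 0 * B 0 j + A i 1 * B 1 j.
Proof.
rewrite mxE big_ord_recl big_ord1; congr (_ + A i _ * B _ j); exact: val_inj.
Qed.

Lemma matS_row (g : 'M[int]_2) j :
  ((matS *m g) 0 j = g 1 j) * ((matS *m g) 1 j = - g 0 j).
Proof. by rewrite !mulmx22 !mxE /=; split; ring. Qed.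

Lemma matT_row (g : 'M[int]_2) j :
  ((matT *m g) 0 j = g 0 j + g 1 j) * ((matT *m g) 1 j = g 1 j).
Proof. by rewrite !mulmx22 !mxE /=; split; ring. Qed.

Lemma det_matS : \det matS = 1. Proof. by rewrite det_mx22E !mxE. Qed.
Lemma det_matT : \det matT = 1. Proof. by rewrite det_mx22E !mxE. Qed.

(** Euclid's algorithm on the first column, by induction on the absolute value of its lower entry.
    Only left multiplication by S and T is allowed, matching the form of the cocycle rule; when the
    lower entry is 0 the matrix is T^k or -T^k, and S^2 = -1. *)
Lemma SL2_ind (P : 'M[int]_2 -> Prop) : P 1%:M ->
  (forall g, \det g = 1 -> P g -> P (matS *m g)) ->
  (forall g, \det g = 1 -> P g -> P (matT *m g)) ->
  forall g, \det g = 1 -> P g.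
Proof.
move=> P1 PS PT.
have dS g : \det g = 1 -> \det (matS *m g) = 1 by move=> h; rewrite det_mulmx det_matS h.
have dT g : \det g = 1 -> \det (matT *m g) = 1 by move=> h; rewrite det_mulmx det_matT h.
pose tr (k : int) (g : 'M[int]_2) : 'M[int]_2 :=
  \matrix_(i, j) (if i == 0 then g 0 j + k * g 1 j else g 1 j).
have trE k g j : (tr k g 0 j = g 0 j + k * g 1 j) * (tr k g 1 j = g 1 j) by rewrite !mxE.
have dtr k g : \det (tr k g) = \det g by rewrite !det_mx22E !trE; ring.
(* (S T)^3 = 1, so T^-1 lies in the monoid generated by S and T. *)
have PT' g : \det g = 1 -> P g -> P (tr (-1) g).
  move=> dg Pg.
  have -> : tr (-1) g = matS *m (matT *m (matS *m (matT *m (matS *m g)))).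
    by apply: mx22P; rewrite !trE !(matS_row, matT_row); ring.
  have d1 := dS _ dg; have d2 := dT _ d1; have d3 := dS _ d2; have d4 := dT _ d3.
  exact: PS d4 (PT _ d3 (PS _ d2 (PT _ d1 (PS _ dg Pg)))).
have Ptr k g : \det g = 1 -> P g -> P (tr k g).
  case: k => n; elim: n g => [|n IH] g dg Pg.
  - by rewrite (_ : tr 0 g = g) //; apply: mx22P; rewrite !trE; ring.
  - rewrite (_ : tr n.+1%:Z g = matT *m tr n%:Z g); last first.
      by apply: mx22P; rewrite !(trE, matT_row) // -[n.+1]addn1 PoszD; ring.
    by apply: PT; rewrite ?dtr //; exact: IH.
  - exact: PT'.
  - rewrite (_ : tr (Negz n.+1) g = tr (-1) (tr (Negz n) g)); last first.
      by apply: mx22P; rewrite !trE // !NegzE -[n.+2]addn1 PoszD; ring.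
    by apply: PT'; rewrite ?dtr //; exact: IH.
move=> g; have [n] := ubnP (absz (g 1 0)); elim: n g => // n IH g; rewrite ltnS => hn dg.
have [c0|c0] := eqVneq (g 1 0) 0.
  have := dg; rewrite det_mx22E c0 mulr0 subr0 => had.
  have [[a1 d1]|[a1 d1]] : (g 0 0 = 1 /\ g 1 1 = 1) \/ (g 0 0 = -1 /\ g 1 1 = -1).
    have := congr1 absz had; rewrite abszM => /eqP; rewrite muln_eq1 => /andP[/eqP h1 _].
    have [a1|a1] : g 0 0 = 1 \/ g 0 0 = -1.
      by case: (g 0 0) h1 => [[|[|?]]|[|?]] //=; [left|right].
      by left; move: had; rewrite a1 mul1r.
    by right; split=> //; move: had; rewrite a1 mulN1r => <-; rewrite opprK.
  - rewrite (_ : g = tr (g 0 1) 1%:M); first by apply: Ptr; rewrite ?det1.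
    by apply: mx22P; rewrite !trE !mxE /= ?a1 ?d1 ?c0; ring.
  - rewrite (_ : g = tr (- g 0 1) (matS *m (matS *m 1%:M))).
      have D1 : \det (1%:M : 'M[int]_2) = 1 by exact: det1.
      exact: (Ptr _ _ (dS _ (dS _ D1)) (PS _ (dS _ D1) (PS _ D1 P1))).
    by apply: mx22P; rewrite !trE !matS_row !mxE /= ?a1 ?d1 ?c0; ring.
(* [g3] is S^-1 T^-q g; its lower left entry is the remainder r, of absolute value smaller than that
   of the divisor [g 1 0]. *)
pose q := divz (g 0 0) (g 1 0); pose r := modz (g 0 0) (g 1 0).
have hr : g 0 0 = q * g 1 0 + r by exact: divz_eq.
pose g2 := tr (- q) g.
pose g3 : 'M[int]_2 := \matrix_(i, j) (if i == 0 then - g2 1 j else g2 0 j).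
have g3E j : (g3 0 j = - g2 1 j) * (g3 1 j = g2 0 j) by rewrite !mxE.
have -> : g = tr q (matS *m g3).
  by apply: mx22P; rewrite !trE !matS_row !g3E !trE; ring.
have dg3 : \det g3 = 1 by rewrite -dg !det_mx22E !g3E !trE; ring.
apply: Ptr; first exact: dS.
apply: PS => //; apply: IH => //; apply: leq_trans hn.
rewrite g3E trE (_ : _ + _ = r); last by rewrite {1}hr; ring.
by rewrite -ltz_nat abszE ger0_norm ?modz_ge0 // abszE ltz_mod.
Qed.

Lemma det_mulmx_eq1 (g1 g2 : 'M[int]_2) : \det g1 = 1 -> \det g2 = 1 -> \det (g1 *m g2) = 1.
Proof. by move=> h1 h2; rewrite det_mulmx h1 h2. Qed.

(** * The action on tau and on (alpha, beta), and the multiplier *)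

Section Action.
Variable R : realType.
Implicit Types (g : 'M[int]_2) (x : R * R) (tau : R[i]).

Lemma twist_actM g1 g2 x : twist_act (g1 *m g2) x = twist_act g1 (twist_act g2 x).
Proof.
by rewrite /twist_act !mulmx22 !rmorphD !rmorphM /=; congr pair; ring.
Qed.

Lemma twist_act1 x : twist_act 1%:M x = x.
Proof. by case: x => a b; rewrite /twist_act !mxE /=; congr pair; ring. Qed.

Lemma twist_actS (a b : R) : twist_act matS (a, b) = (b, - a).
Proof. by rewrite /twist_act !mxE /=; congr pair; ring. Qed.

Lemma twist_actT (a b : R) : twist_act matT (a, b) = (a + b, b).
Proof. by rewrite /twist_act !mxE /=; congr pair; ring. Qed.

Let den g tau : R[i] := (g 1 0)%:~R * tau + (g 1 1)%:~R.

Lemma Re_int (k : int) : complex.Re (k%:~R : R[i]) = k%:~R.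
Proof. by rewrite -(rmorph_int (real_complex R)). Qed.

Lemma Im_int (k : int) : complex.Im (k%:~R : R[i]) = 0.
Proof. by rewrite -(rmorph_int (real_complex R)). Qed.

Lemma Im_div (u v : R[i]) : complex.Im (u / v) =
  (complex.Im u * complex.Re v - complex.Re u * complex.Im v) / cmod v ^+ 2.
Proof.
rewrite cmod_sqr ImM; case: u v => a b [c d] /=; ring.
Qed.

Lemma Re_affine (k l : int) tau :
  complex.Re (k%:~R * tau + l%:~R) = k%:~R * complex.Re tau + l%:~R.
Proof. by rewrite ReD ReM !Re_int Im_int mul0r subr0. Qed.

Lemma Im_affine (k l : int) tau :
  complex.Im (k%:~R * tau + l%:~R) = k%:~R * complex.Im tau.
Proof. by rewrite ImD ImM Re_int !Im_int mul0r !addr0. Qed.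

Lemma moebius_den_neq0 g tau : \det g = 1 -> 0 < complex.Im tau -> den g tau != 0.
Proof.
move=> dg t0; apply/eqP => h.
have /eqP := congr1 (@complex.Im R) h; rewrite Im_affine /= mulf_eq0 (gt_eqF t0) orbF intr_eq0.
move=> /eqP c0; have /eqP := congr1 (@complex.Re R) h.
rewrite Re_affine c0 mul0r add0r intr_eq0 => /eqP d0.
by move: dg; rewrite det_mx22E c0 d0 !mulr0 subrr.
Qed.

Lemma Im_moebius g tau : \det g = 1 -> 0 < complex.Im tau -> 0 < complex.Im (moebius g tau).
Proof.
move=> dg t0; have := moebius_den_neq0 dg t0; rewrite -cmod_gt0 => h.
have dR : (g 0 0)%:~R * (g 1 1)%:~R - (g 0 1)%:~R * (g 1 0)%:~R = 1 :> R.
  by rewrite -!intrM -intrB -det_mx22E dg.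
rewrite Im_div divr_gt0 ?exprn_gt0 // !Re_affine !Im_affine.
set x := (X in 0 < X); have -> : x = complex.Im tau *
   ((g 0 0)%:~R * (g 1 1)%:~R - (g 0 1)%:~R * (g 1 0)%:~R) by rewrite /x; ring.
by rewrite dR mulr1.
Qed.

Lemma moebiusM g1 g2 tau : \det g1 = 1 -> \det g2 = 1 -> 0 < complex.Im tau ->
  moebius (g1 *m g2) tau = moebius g1 (moebius g2 tau).
Proof.
move=> d1 d2 t0; have h2 := moebius_den_neq0 d2 t0.
have h12 := moebius_den_neq0 (det_mulmx_eq1 d1 d2) t0.
move: h2 h12; rewrite /moebius /den !mulmx22 !rmorphD !rmorphM /=.
move: (g1 0 0)%:~R (g1 0 1)%:~R (g1 1 0)%:~R (g1 1 1)%:~R => a b c d.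
move: (g2 0 0)%:~R (g2 0 1)%:~R (g2 1 0)%:~R (g2 1 1)%:~R => a' b' c' d' h2 h12.
have h12' : c * (a' * tau + b') + d * (c' * tau + d') != 0.
  have -> : c * (a' * tau + b') + d * (c' * tau + d') =
    (c * a' + d * c') * tau + (c * b' + d * d') by ring.
  exact: h12.
by field; rewrite h12' h2 ?h12.
Qed.

Lemma moebius1 tau : moebius 1%:M tau = tau.
Proof. by rewrite /moebius !mxE /= mulr1z mulr0z mul0r mul1r add0r addr0 divr1. Qed.

Lemma moebiusS tau : moebius matS tau = - tau^-1.
Proof. by rewrite /moebius !mxE /= mulr1z !mulr0z mul0r add0r addr0 rmorphN /= mulN1r invrN mul1r. Qed.

Lemma moebiusT tau : moebius matT tau = tau + 1.
Proof. by rewrite /moebius !mxE /= mulr1z mulr0z mul0r add0r divr1 mul1r. Qed.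

(* [multiplier_phase] is a coboundary, so that the multiplier of [ztheta] is this
   coboundary times a character of SL(2,Z). *)
Definition twist_phase x : R := - x.1 * (x.2 + 1).

Definition multiplier_phase g x : R[i] :=
  cexp ((pi * (twist_phase x - twist_phase (twist_act g x)))%:C * 'i%C).

Lemma multiplier_phaseM g1 g2 x :
  multiplier_phase (g1 *m g2) x = multiplier_phase g1 (twist_act g2 x) * multiplier_phase g2 x.
Proof.
rewrite /multiplier_phase twist_actM -cexpD; congr cexp; rewrite -mulrDl -rmorphD /=.
by congr (_%:C * _); ring.
Qed.

Definition is_multiplier_const g (chi : R[i]) := cmod chi = 1 /\
  forall x tau, 0 < complex.Im tau ->
    ztheta (twist_act g x) (moebius g tau) = chi * multiplier_phase g x * ztheta x tau.

Lemma multiplier_const1 : is_multiplier_const 1%:M 1.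
Proof.
split=> [|x tau t0]; first exact: cmod1.
by rewrite /multiplier_phase twist_act1 moebius1 subrr mulr0 mul0r cexp0 !mul1r.
Qed.

Lemma multiplier_constM g1 g2 c1 c2 : \det g1 = 1 -> \det g2 = 1 ->
  is_multiplier_const g1 c1 -> is_multiplier_const g2 c2 ->
  is_multiplier_const (g1 *m g2) (c1 * c2).
Proof.
move=> d1 d2 [n1 h1] [n2 h2]; split=> [|x tau t0]; first by rewrite cmodM n1 n2 mulr1.
rewrite twist_actM (moebiusM d1 d2 t0) (h1 _ _ (Im_moebius d2 t0)) (h2 _ _ t0) multiplier_phaseM.
by move: (ztheta x tau) (multiplier_phase _ _) (multiplier_phase _ _) => u v w; ring.
Qed.

Lemma cexp_pi_real (t : R) : cexp ((pi * t)%:C * 'i%C) = nome (t / 2)%:C.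
Proof.
by rewrite /nome /piI; congr cexp; rewrite !rmorphM /= fmorphV /= rmorph_nat; field.
Qed.

Lemma cexp_pi_realD (s t : R) :
  cexp ((pi * s)%:C * 'i%C) * cexp ((pi * t)%:C * 'i%C) = cexp ((pi * (s + t))%:C * 'i%C).
Proof. by rewrite -cexpD -mulrDl -rmorphD -mulrDr. Qed.

(** The coboundary contributes b - a - 2ab, and 2 (1/2 + b)(1/2 - a) exceeds it by 1/2: only the
    number i remains. *)
Lemma multiplier_constS : is_multiplier_const matS (cexp ((pi * 2^-1)%:C * 'i%C)).
Proof.
split=> [|[a b] tau t0]; first exact: cmod_cexp_real_i.
rewrite twist_actS moebiusS ztheta_S //; congr (_ * _).
rewrite /multiplier_phase twist_actS cexp_pi_realD cexp_pi_real; congr (nome _%:C).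
by rewrite /twist_phase /=; field.
Qed.

(** The coboundary contributes b(b+1), and twice (b + 1/2)^2/2 - 1/24 is b(b+1) + 1/6. *)
Lemma multiplier_constT : is_multiplier_const matT (cexp ((pi * 6^-1)%:C * 'i%C)).
Proof.
split=> [|[a b] tau t0]; first exact: cmod_cexp_real_i.
rewrite twist_actT moebiusT ztheta_translation //; congr (_ * _).
rewrite /multiplier_phase twist_actT cexp_pi_realD cexp_pi_real; congr (nome _%:C).
by rewrite /twist_phase /=; field.
Qed.

Lemma multiplier_const_exists g : \det g = 1 -> exists chi, is_multiplier_const g chi.
Proof.
move: g; apply: SL2_ind; first by exists 1; exact: multiplier_const1.
  move=> g dg [chi h]; eexists.
  exact: (multiplier_constM det_matS dg multiplier_constS h).
move=> g dg [chi h]; eexists.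
exact: (multiplier_constM det_matT dg multiplier_constT h).
Qed.

(** One nonzero value suffices; at tau = i and (1/2, 0) it is nonzero because the product over the
    2-torsion points is 2. *)
Lemma multiplier_const_unique g c c' :
  is_multiplier_const g c -> is_multiplier_const g c' -> c = c'.
Proof.
move=> [_ h] [_ h'].
have t0 : 0 < complex.Im ('i%C : R[i]) by [].
have := ztheta_2torsion t0.
have [->|z0] := eqVneq (ztheta (2^-1, 0) ('i%C : R[i])) 0.
  by rewrite !mul0r => /eqP; rewrite eq_sym pnatr_eq0.
move=> _; have := h (2^-1, 0) _ t0; rewrite (h' (2^-1, 0) _ t0).
by move=> /(mulIf z0) /(mulIf (cexp_neq0 _)).
Qed.

Definition multiplier_const g : R[i] := xget 0 [set c | is_multiplier_const g c].

Lemma multiplier_constP g : \det g = 1 -> is_multiplier_const g (multiplier_const g).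
Proof.
by move=> /multiplier_const_exists[c hc]; rewrite /multiplier_const; case: xgetP => [c' ->|/(_ c)].
Qed.

Lemma multiplier_const_eq g c : \det g = 1 -> is_multiplier_const g c -> multiplier_const g = c.
Proof. by move=> dg; apply: multiplier_const_unique; exact: multiplier_constP. Qed.

Definition multiplier g x : R[i] := multiplier_const g * multiplier_phase g x.

(** The product of the constants of two matrices is a constant for their product, and constants are
    unique; the phase is multiplicative as a coboundary. Hence the cocycle rule needs no check of
    relations. *)
Lemma multiplier_is_system : multiplier_system multiplier.
Proof.
split=> [g1 g2 x d1 d2|a b|a b].
- rewrite /multiplier multiplier_phaseM.
  rewrite (multiplier_const_eq (det_mulmx_eq1 d1 d2)
    (multiplier_constM d1 d2 (multiplier_constP d1) (multiplier_constP d2))).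
  by rewrite mulrACA.
- rewrite /multiplier (multiplier_const_eq det_matS multiplier_constS).
  rewrite /multiplier_phase twist_actS cexp_pi_realD; apply: (congr1 (fun t => cexp (t%:C * 'i%C))).
  by rewrite /twist_phase /=; field.
- rewrite /multiplier (multiplier_const_eq det_matT multiplier_constT).
  rewrite /multiplier_phase twist_actT cexp_pi_realD; apply: (congr1 (fun t => cexp (t%:C * 'i%C))).
  by rewrite /twist_phase /=; field.
Qed.

(** Induction over words in S and T. The value at the identity is not prescribed but forced:
    applying the rule to S times 1 and cancelling the nonzero value at S gives 1. *)
Lemma multiplier_system_unique (e e' : 'M[int]_2 -> R * R -> R[i]) :
  multiplier_system e -> multiplier_system e' ->
  forall g x, \det g = 1 -> e g x = e' g x.
Proof.
have e1 f x : multiplier_system f -> f 1%:M x = 1.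
  move=> [fM fS _]; have := fM matS 1%:M x det_matS (det1 _ _).
  rewrite mulmx1 twist_act1; case: x => a b; rewrite fS.
  by rewrite -[X in X = _]mulr1 => /(mulfI (cexp_neq0 _)).
move=> he he' g x dg; move: g dg x; apply: SL2_ind => [x|g dg IH x|g dg IH x].
- by rewrite !e1.
- case: (he) (he') => eM eS _ [eM' eS' _]; rewrite eM ?eM' ?det_matS // IH.
  by case: (twist_act g x) => a b; rewrite eS eS'.
- case: (he) (he') => eM _ eT [eM' _ eT']; rewrite eM ?eM' ?det_matT // IH.
  by case: (twist_act g x) => a b; rewrite eT eT'.
Qed.

Lemma multiplier_unitary g x : \det g = 1 -> `|multiplier g x| = 1.
Proof.
move=> /multiplier_constP[h _]; rewrite normc_cmod cmodM h cmod_cexp_real_i mulr1 //.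
Qed.

Lemma ztheta_modular g x tau : \det g = 1 -> 0 < complex.Im tau ->
  ztheta (twist_act g x) (moebius g tau) = multiplier g x * ztheta x tau.
Proof. by move=> /multiplier_constP[_ h] t0; exact: h. Qed.

End Action.
End ModularGroup.

(** * Operators diagonal in a basis *)

Section LinearFunctions.
Variables (F : fieldType) (V : lmodType F).
Implicit Types (X : V -> V).

Lemma linear_fun0 X : linear X -> X 0 = 0.
Proof. by move=> h; have := h (-1) 0 0; rewrite scaler0 addr0 scaleN1r addNr. Qed.

Lemma linear_funD X u v : linear X -> X (u + v) = X u + X v.
Proof. by move=> h; have := h 1 u v; rewrite !scale1r. Qed.

Lemma linear_funZ X c u : linear X -> X (c *: u) = c *: X u.
Proof. by move=> h; have := h c u 0; rewrite !addr0 (linear_fun0 h) addr0. Qed.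

Lemma linear_fun_sum X (I : Type) (r : seq I) (P : pred I) (c : I -> F) (f : I -> V) :
  linear X -> X (\sum_(i <- r | P i) c i *: f i) = \sum_(i <- r | P i) c i *: X (f i).
Proof.
move=> h; elim/big_rec2: _ => [|i u v _ <-]; first exact: linear_fun0.
by rewrite h.
Qed.

(** The two bases may a priori differ in length, so the transition matrices P and Q are rectangular.
    Uniqueness of coordinates gives PQ = 1, QP = 1 and MP = PM', and the trace is cyclic. *)
Lemma is_trace_on_unique (U : set V) X t t' : linear X -> (forall v, U v -> U (X v)) ->
  is_trace_on U X t -> is_trace_on U X t' -> t = t'.
Proof.
move=> hX UX [n [e [M [[eU eB] eM ->]]]] [n' [e' [M' [[eU' eB'] eM' ->]]]].
have hP i : exists c : 'I_n' -> F, e i = \sum_j c j *: e' j.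
  by have [c [hc _]] := eB' _ (eU i); exists c.
have hQ i : exists c : 'I_n -> F, e' i = \sum_j c j *: e j.
  by have [c [hc _]] := eB _ (eU' i); exists c.
pose P : 'M[F]_(n, n') := \matrix_(i, j) projT1 (cid (hP i)) j.
pose Q : 'M[F]_(n', n) := \matrix_(i, j) projT1 (cid (hQ i)) j.
have PE i : e i = \sum_j P i j *: e' j.
  by rewrite {1}(projT2 (cid (hP i))); apply: eq_bigr => j _; rewrite mxE.
have QE i : e' i = \sum_j Q i j *: e j.
  by rewrite {1}(projT2 (cid (hQ i))); apply: eq_bigr => j _; rewrite mxE.
have inj m (f : 'I_m -> V) : is_finite_basis U f -> (forall c d : 'I_m -> F,
    U (\sum_j c j *: f j) -> \sum_j c j *: f j = \sum_j d j *: f j -> c = d).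
  by move=> [_ hf] c d /hf[x [_ hx]] hcd; rewrite -(hx c erefl) -(hx d hcd).
have mulE m k l (A : 'M[F]_(m, k)) (B : 'M[F]_(k, l)) (f : 'I_l -> V) i :
    \sum_j A i j *: (\sum_h B j h *: f h) = \sum_h (A *m B) i h *: f h.
  under eq_bigr do rewrite scaler_sumr; rewrite exchange_big; apply: eq_bigr => h _ /=.
  rewrite mxE scaler_suml; apply: eq_bigr => j _; by rewrite scalerA.
have PQ : P *m Q = 1%:M.
  apply/row_matrixP => i; apply/rowP => j; rewrite !mxE.
  have e1 : \sum_j (P *m Q) i j *: e j = e i.
    by rewrite -mulE [RHS]PE; apply: eq_bigr => k _; rewrite -QE.
  have e2 : e i = \sum_j (1%:M : 'M[F]_n) i j *: e j.
    rewrite (bigD1 i) //= mxE eqxx scale1r big1 ?addr0 // => k ki.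
    by rewrite mxE eq_sym (negPf ki) scale0r.
  have := inj _ e (conj eU eB) (fun j => (P *m Q) i j) (fun j => (1%:M : 'M[F]_n) i j).
  by rewrite e1 -e2 => /(_ (eU i) erefl) /(congr1 (@^~ j)); rewrite !mxE.
have QP : Q *m P = 1%:M.
  apply/row_matrixP => i; apply/rowP => j; rewrite !mxE.
  have e1 : \sum_j (Q *m P) i j *: e' j = e' i.
    by rewrite -mulE [RHS]QE; apply: eq_bigr => k _; rewrite -PE.
  have e2 : e' i = \sum_j (1%:M : 'M[F]_n') i j *: e' j.
    rewrite (bigD1 i) //= mxE eqxx scale1r big1 ?addr0 // => k ki.
    by rewrite mxE eq_sym (negPf ki) scale0r.
  have := inj _ e' (conj eU' eB') (fun j => (Q *m P) i j) (fun j => (1%:M : 'M[F]_n') i j).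
  by rewrite e1 -e2 => /(_ (eU' i) erefl) /(congr1 (@^~ j)); rewrite !mxE.
have MP : M *m P = P *m M'.
  apply/row_matrixP => i; apply/rowP => j.
  have := inj _ e' (conj eU' eB') (fun j => (M *m P) i j) (fun j => (P *m M') i j).
  rewrite -!mulE.
  have -> : \sum_j M i j *: (\sum_h P j h *: e' h) = X (e i).
    by rewrite eM; apply: eq_bigr => k _; rewrite -PE.
  have -> : \sum_j P i j *: (\sum_h M' j h *: e' h) = X (e i).
    by rewrite [in RHS]PE linear_fun_sum //; apply: eq_bigr => k _; rewrite eM'.
  by move=> /(_ (UX _ (eU i)) erefl) /(congr1 (@^~ j)); rewrite !mxE.
by rewrite -[M]mulmx1 -PQ mulmxA MP -mulmxA mxtrace_mulC -mulmxA QP mulmx1.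
Qed.

Lemma trace_on_eq (U : set V) X t : linear X -> (forall v, U v -> U (X v)) ->
  is_trace_on U X t -> trace_on U X = t.
Proof.
move=> hX UX ht; rewrite /trace_on; case: xgetP => [t' -> ht'|/(_ t)//].
exact: (is_trace_on_unique hX UX ht' ht).
Qed.

End LinearFunctions.

Section Basis.
Variables (F : fieldType) (V : lmodType F) (I : choiceType) (D : set I) (b : I -> V).
Hypothesis bB : is_basis D b.

Definition coef (v : V) : I -> F := projT1 (cid (bB v)).

Lemma coefP v : [/\ finite_set [set i | coef v i != 0],
        [set i | coef v i != 0] `<=` D & v = \sum_(i \in D) coef v i *: b i].
Proof. by rewrite /coef; case: (cid _) => c []. Qed.

Lemma coef_unique v (c : I -> F) : finite_set [set i | c i != 0] ->
  [set i | c i != 0] `<=` D -> v = \sum_(i \in D) c i *: b i -> coef v = c.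
Proof. by move=> h1 h2 h3; rewrite /coef; case: (cid _) => d [_] /=; apply. Qed.

Lemma basis_sum_seq (s : seq I) (c : I -> F) : uniq s -> {in s, forall i, D i} ->
  (forall i, c i != 0 -> i \in s) ->
  \sum_(i \in D) c i *: b i = \sum_(i <- s) c i *: b i.
Proof.
move=> us sD hc; rewrite (fsbig_seq _ _ us); apply/esym/fsbig_widen => //.
move=> i [_ /= /negP]; have [-> _|/hc -> //] := eqVneq (c i) 0.
by rewrite scale0r.
Qed.

Lemma coef_sum_seq (s : seq I) (c : I -> F) i : uniq s -> {in s, forall i, D i} ->
  coef (\sum_(i <- s) c i *: b i) i = if i \in s then c i else 0.
Proof.
move=> us sD; pose c' i := if i \in s then c i else 0.
rewrite (_ : \sum_(i <- s) c i *: b i = \sum_(i <- s) c' i *: b i); last first.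
  by apply: eq_big_seq => j js; rewrite /c' js.
have hc' j : c' j != 0 -> j \in s by rewrite /c'; case: ifP; rewrite ?eqxx.
rewrite (@coef_unique _ c') // ?(basis_sum_seq us sD hc') //.
  by apply: sub_finite_set (finite_seq s) => j /= /hc'.
by move=> j /= /hc'/sD.
Qed.

Lemma coef_support v : exists s : seq I, [/\ uniq s, {in s, forall i, D i},
  (forall i, (i \in s) = (coef v i != 0)) & v = \sum_(i <- s) coef v i *: b i].
Proof.
have [/finite_seqP[s hs] sD hv] := coefP v.
have hs' i : (i \in undup s) = (coef v i != 0).
  by rewrite mem_undup; apply/idP/idP => h; have := congr1 (@^~ i) hs => /= e; rewrite ?e // -e.
exists (undup s); split => //; first exact: undup_uniq.
  by move=> i; rewrite hs' => /sD.
rewrite {1}hv (@basis_sum_seq (undup s)) ?undup_uniq //.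
  by move=> i; rewrite hs' => /sD.
by move=> i; rewrite hs'.
Qed.

Lemma coef_inj u v : coef u = coef v -> u = v.
Proof. by move=> h; have [_ _ ->] := coefP u; have [_ _ ->] := coefP v; rewrite h. Qed.

Lemma coefE (s : seq I) v : uniq s -> {in s, forall i, D i} ->
  (forall i, coef v i != 0 -> i \in s) -> v = \sum_(i <- s) coef v i *: b i.
Proof. by move=> us sD hs; have [_ _ {1}->] := coefP v; rewrite (basis_sum_seq us sD). Qed.

Lemma coef_notin v i : ~ D i -> coef v i = 0.
Proof.
by move=> iD; apply/eqP/negP => /negP h; apply: iD; have [_ hD _] := coefP v; exact: hD.
Qed.

Lemma coef_linear x u v i : coef (x *: u + v) i = x * coef u i + coef v i.
Proof.
have [s [us sD hs _]] := coef_support u; have [t [ut tD ht _]] := coef_support v.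
pose r := undup (s ++ t).
have ur : uniq r by exact: undup_uniq.
have rD : {in r, forall i, D i} by move=> j; rewrite mem_undup mem_cat => /orP[/sD|/tD].
have ru j : coef u j != 0 -> j \in r by rewrite mem_undup mem_cat -hs => ->.
have rv j : coef v j != 0 -> j \in r by rewrite mem_undup mem_cat -ht orbC => ->.
rewrite {1}(coefE ur rD ru) {1}(coefE ur rD rv) scaler_sumr -big_split /=.
rewrite (eq_bigr (fun i => (x * coef u i + coef v i) *: b i)); last first.
  by move=> j _; rewrite scalerA scalerDl.
rewrite coef_sum_seq //; case: ifP => // /negP h.
have [->|/ru //] := eqVneq (coef u i) 0; have [->|/rv //] := eqVneq (coef v i) 0.
by rewrite mulr0 addr0.
Qed.

Lemma coefZ x u i : coef (x *: u) i = x * coef u i.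
Proof.
have h0 : coef 0 i = 0 by have := coef_linear (-1) 0 0 i; rewrite scaleN1r oppr0 addr0 mulN1r addNr.
by have := coef_linear x u 0 i; rewrite h0 !addr0.
Qed.

Lemma coef_basis i j : D i -> coef (b i) j = (j == i)%:R.
Proof.
move=> iD; have := @coef_sum_seq [:: i] (fun=> 1) j isT.
rewrite big_seq1 scale1r inE => -> //; first by case: eqP.
by move=> k; rewrite inE => /eqP ->.
Qed.

Section Diagonal.
Variables (A : V -> V) (lam : I -> F).
Hypothesis A_lin : linear A.
Hypothesis A_diag : forall i, D i -> A (b i) = lam i *: b i.

Lemma coef_diag v i : coef (A v) i = lam i * coef v i.
Proof.
have [s [us sD hs hv]] := coef_support v.
rewrite {1}hv linear_fun_sum // (eq_big_seq (fun i => (coef v i * lam i) *: b i)); last first.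
  by move=> j js; rewrite A_diag ?scalerA //; exact: sD.
rewrite coef_sum_seq // hs; case: eqP => [->|_] /=; first by rewrite mulr0.
by rewrite mulrC.
Qed.

(** Eigenvectors are the vectors supported on the basis indices with that eigenvalue. This
    translates both the definition of [opexp] and the weight spaces into coordinates. *)
Lemma diag_eigen v x : A v = x *: v <-> forall i, coef v i != 0 -> lam i = x.
Proof.
split=> [h i vi|h].
  by apply: (mulIf vi); rewrite -coef_diag h coefZ.
apply: coef_inj; apply/funext => i; rewrite coef_diag coefZ.
by have [->|/h ->] := eqVneq (coef v i) 0; rewrite ?mulr0.
Qed.

End Diagonal.

Lemma trace_on_diag (U : set V) (X : V -> V) (mu : I -> F) (s : seq I) :
  linear X -> uniq s -> {in s, forall i, D i} ->
  (forall v, U v <-> forall i, coef v i != 0 -> i \in s) ->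
  {in s, forall i, X (b i) = mu i *: b i} ->
  trace_on U X = \sum_(i <- s) mu i.
Proof.
move=> hX us sD hU hmu; apply: trace_on_eq => //.
  move=> v /hU hv; rewrite (coefE us sD hv) linear_fun_sum //.
  rewrite (eq_big_seq (fun i => (coef v i * mu i) *: b i)); last first.
    by move=> i si; rewrite hmu // scalerA.
  by apply/hU => i; rewrite coef_sum_seq //; case: ifP; rewrite ?eqxx.
exists (size s), (fun j => b (tnth (in_tuple s) j)),
  (diag_mx (\row_j mu (tnth (in_tuple s) j))); split.
- have sumE (c : 'I_(size s) -> F) : exists2 c' : I -> F,
      (forall j, c' (tnth (in_tuple s) j) = c j) &
      \sum_j c j *: b (tnth (in_tuple s) j) = \sum_(i <- s) c' i *: b i.
    have hc' : exists c' : I -> F, forall j, c' (tnth (in_tuple s) j) = c j.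
      (* Coordinates indexed by positions in [s] become a function on [I]; [s] has no repetition, so
         each element recovers its position. *)
      exists (fun i => if insub (index i s) is Some j then c j else 0) => j.
      rewrite (tnth_nth (tnth (in_tuple s) j)) index_uniq //= valK //.
    case: hc' => c' hc'; exists c' => //.
    by rewrite (big_tnth _ _ s); apply: eq_bigr => j _; rewrite hc'.
  split=> [j|v Uv].
    apply/hU => i; rewrite coef_basis; last by apply: sD; rewrite mem_tnth.
    by have [->|_] := eqVneq i; rewrite ?eqxx ?mem_tnth.
  exists (fun j => coef v (tnth (in_tuple s) j)); split.
    by rewrite {1}(coefE us sD (iffLR (hU v) Uv)) (big_tnth _ _ s).
  move=> c hc; apply/funext => j; have [c' hc' e] := sumE c.
  by rewrite hc e coef_sum_seq // mem_tnth hc'.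
- move=> j; rewrite hmu ?mem_tnth // (bigD1 j) //= !mxE eqxx mulr1n big1 ?addr0 // => k kj.
  by rewrite !mxE eq_sym (negPf kj) mulr0n scale0r.
- rewrite /mxtrace (big_tnth _ _ s); apply: eq_bigr => j _.
  by rewrite !mxE eqxx mulr1n.
Qed.

End Basis.

Section OperatorExponential.
Variables (R : realType) (V : lmodType R[i]) (I : choiceType) (D : set I) (b : I -> V).
Hypothesis bB : is_basis D b.
Variables (A : V -> V) (lam : I -> R[i]).
Hypothesis A_lin : linear A.
Hypothesis A_diag : forall i, D i -> A (b i) = lam i *: b i.

(** The choice in [opexp] does not fall back on its default: multiplying the i-th coordinate by
    [cexp (lam i)] is linear and acts correctly on eigenvectors by [diag_eigen]. *)
Lemma is_opexp_opexp : is_opexp A (opexp A).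
Proof.
rewrite /opexp; case: xgetP => [E -> //|h]; exfalso.
have hE v : exists w, forall i, coef bB w i = cexp (lam i) * coef bB v i.
  have [s [us sD hs hv]] := coef_support bB v.
  exists (\sum_(i <- s) (cexp (lam i) * coef bB v i) *: b i) => i.
  by rewrite coef_sum_seq // hs; case: eqP => [->|]; rewrite ?mulr0.
apply: (h (fun v => projT1 (cid (hE v)))).
have hc v i : coef bB (projT1 (cid (hE v))) i = cexp (lam i) * coef bB v i by exact: projT2 (cid (hE v)) i.
split=> [x u v|x v /(diag_eigen bB A_lin A_diag) hx].
  apply: (@coef_inj _ _ _ _ _ bB); apply/funext => i; rewrite coef_linear !hc coef_linear; ring.
apply: (@coef_inj _ _ _ _ _ bB); apply/funext => i; rewrite coefZ hc.
by have [->|/hx ->] := eqVneq (coef bB v i) 0; rewrite ?mulr0.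
Qed.

Lemma opexp_linear : linear (opexp A). Proof. by case: is_opexp_opexp. Qed.

Lemma opexp_diag i : D i -> opexp A (b i) = cexp (lam i) *: b i.
Proof. by move=> iD; case: is_opexp_opexp => _; apply; exact: A_diag. Qed.

End OperatorExponential.

(** * The fermion Fock space *)

Section Commutators.
Variables (R : realType) (V : lmodType R[i]) (W : vosa V).
Implicit Types (u v w psi phi : V) (m n : int).

Lemma fsbig_nat_ord (f : nat -> V) (N : nat) : (forall j, (N <= j)%N -> f j = 0) ->
  \sum_(j \in [set: nat]) f j = \sum_(j < N) f j.
Proof.
move=> h; rewrite -(big_mkord xpredT) /index_iota subn0 (fsbig_seq _ _ (iota_uniq 0 N)).
apply/esym/fsbig_widen => // j [_ /= /negP]; rewrite mem_iota /= add0n -leqNgt; exact: h.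
Qed.

Lemma binz0l j : binz R[i] 0 j = (j == 0%N)%:R.
Proof.
rewrite /binz; case: j => [|j]; first by rewrite big_ord0 divr1.
by rewrite big_ord_recl /= mulr0z subr0 !mul0r.
Qed.

Lemma binz0r m : binz R[i] m 0 = 1.
Proof. by rewrite /binz big_ord0 divr1. Qed.

Lemma binz1r m : binz R[i] m 1 = m%:~R.
Proof. by rewrite /binz big_ord1 subr0 divr1. Qed.

Lemma vmode_lin_r u n : linear (vmode W u n).
Proof. by move=> x v w; exact: vmode_linearr. Qed.

Lemma vmode_lin_l n w : linear (fun u => vmode W u n w).
Proof. by move=> x u v; exact: vmode_linearl. Qed.

(** The Borcherds identity at k = 0, where the binomial coefficients on the right vanish for j >
    0. *)
Lemma commutator_formula p p' u v w m n : vparity W p u -> vparity W p' v ->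
  \sum_(j \in [set: nat]) binz R[i] m j *: vmode W (vmode W u j%:Z v) (m + n - j%:Z) w
  = vmode W u m (vmode W v n w) - (-1) ^+ (p && p') *: vmode W v n (vmode W u m w).
Proof.
move=> hu hv; have := vmode_borcherds w 0 m n hu hv.
under eq_fsbigr do rewrite add0r.
move=> ->; rewrite (@fsbig_nat_ord _ 1) ?big_ord1.
  by rewrite /= binz0l expr0 mulr1 scale1r !addr0 ?subr0 expr0z mulr1.
by case=> // j _; rewrite binz0l mulr0 scale0r.
Qed.

(** * Commutators of a fermion mode with omega and a, for the pair psi^+, psi^- in either order *)

Section FermionPair.
Variables (psi phi : V).
Hypothesis psi_odd : vparity W true psi.
Hypothesis psi_phi : forall m n v, vmode W psi m (vmode W phi n v) + vmode W phi n (vmode W psi m v)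
  = if m == - n - 1 then v else 0.
Hypothesis psi_psi : forall m n v,
  vmode W psi m (vmode W psi n v) + vmode W psi n (vmode W psi m v) = 0.
Local Notation vac := (vvac W).

Let psi_phiE m n v : vmode W psi m (vmode W phi n v) =
  (if m == - n - 1 then v else 0) - vmode W phi n (vmode W psi m v).
Proof. by rewrite -psi_phi addrK. Qed.

Let psi_psiE m n v : vmode W psi m (vmode W psi n v) = - vmode W psi n (vmode W psi m v).
Proof. by apply/eqP; rewrite -addr_eq0 psi_psi. Qed.

Let vmode0 u n : vmode W u n 0 = 0. Proof. exact: linear_fun0 (vmode_lin_r u n). Qed.

Let psi_ann (j : nat) : vmode W psi j vac = 0. Proof. exact: vmode_annihilation. Qed.

Lemma psi_mode_ppvac (j : nat) n :
  vmode W psi j%:Z (vmode W psi n (vmode W phi (-1) vac)) =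
  - (if j == 0%N then vmode W psi n vac else 0).
Proof.
rewrite psi_psiE psi_phiE psi_ann vmode0 subr0.
have -> : (j%:Z == - (-1) - 1) = (j == 0%N) by lia.
by case: ifP => _ //; rewrite vmode0.
Qed.

Lemma psi_mode_fpvac (j : nat) n :
  vmode W psi j%:Z (vmode W phi n (vmode W psi (-1) vac)) =
  if j%:Z == - n - 1 then psi else 0.
Proof.
rewrite psi_phiE psi_psiE psi_ann vmode0 oppr0 vmode0 subr0.
by case: ifP => _ //; rewrite vmode_creation.
Qed.

Section Conformal.
Hypothesis omegaE : vconf W = 2^-1 *: (vmode W psi (- 2%:Z) (vmode W phi (-1) vac)
                         + vmode W phi (- 2%:Z) (vmode W psi (-1) vac)).
Local Notation omega := (vconf W).

Lemma psi_mode_omega (j : nat) : vmode W psi j%:Z omega =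
  2^-1 *: (- (if j == 0%N then vmode W psi (- 2%:Z) vac else 0) + (if j == 1%N then psi else 0)).
Proof.
rewrite omegaE (linear_funZ _ _ (vmode_lin_r _ _)) (linear_funD _ _ (vmode_lin_r _ _)).
by rewrite psi_mode_ppvac psi_mode_fpvac.
Qed.

(** Only psi(0) omega and psi(1) omega are nonzero among the nonnegative modes, so the commutator
    formula has two terms. *)
Lemma psi_omega_commutator m n w :
  vmode W psi m (vmode W omega n w) - vmode W omega n (vmode W psi m w) =
  2^-1 *: (m%:~R *: vmode W psi (m + n - 1) w - vmode W (vmode W psi (- 2%:Z) vac) (m + n) w).
Proof.
have := commutator_formula w m n psi_odd (vconf_even W).
rewrite /= scale1r => <-; rewrite (@fsbig_nat_ord _ 2); last first.
  case=> [|[|j]] // _; rewrite psi_mode_omega /= oppr0 addr0 scaler0.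
  by rewrite (linear_fun0 (vmode_lin_l _ _)) scaler0.
rewrite 2!big_ord_recr big_ord0 /= add0r binz0r binz1r !psi_mode_omega /= !oppr0 add0r !addr0.
rewrite scale1r scalerN (linear_funZ _ _ (vmode_lin_l _ _)).
rewrite -scalerN (linear_funZ _ _ (vmode_lin_l _ _)) addrC scalerA mulrC -scalerA -scalerDr.
have := linear_funZ (-1) (vmode W psi (- 2%:Z) vac) (vmode_lin_l (m + n) w).
by rewrite !scaleN1r => ->.
Qed.

(** Identifies psi(-2)1 with L(-1) psi, so that the derivative property supplies its modes. The
    commutator at m = -1, n = 0 is applied to the vacuum, which omega(0) kills. *)
Lemma omega0_psi : vmode W omega 0 psi = vmode W psi (- 2%:Z) vac.
Proof.
have := psi_omega_commutator (-1) 0 vac.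
rewrite vmode_annihilation // vmode0 sub0r !vmode_creation addr0.
have -> : (-1 - 1 = - 2%:Z :> int) by [].
rewrite mulrN1z scaleN1r -opprD scalerN => /oppr_inj ->.
set x := vmode _ _ _ _; have -> : x + x = (2 : R[i]) *: x by rewrite scaler_nat mulr2n.
by rewrite scalerA mulVf ?scale1r // pnatr_eq0.
Qed.

Lemma Lzero_psi m w : Lzero W (vmode W psi m w) =
  vmode W psi m (Lzero W w) - (m%:~R + 2^-1) *: vmode W psi m w.
Proof.
(* The modes of L(-1) psi contribute m + 1, and half of m + (m + 1) is m + 1/2. *)
have := psi_omega_commutator m 1 w; rewrite -omega0_psi vconf_derivative !addrK.
rewrite scaleNr opprK -scalerDl scalerA => h.
rewrite /Lzero -[vmode W omega 1 _](subKr (vmode W psi m (vmode W omega 1 w))) h.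
by congr (_ - _ *: _); rewrite rmorphD /=; field.
Qed.

End Conformal.

Section Charge.
Variable (c : R[i]) (a : V).
Hypothesis a_even : vparity W false a.
Hypothesis psi_a : forall j : nat, vmode W psi j%:Z a = if j == 0%N then - c *: psi else 0.

Lemma charge_psi m w : vmode W a 0 (vmode W psi m w) =
  vmode W psi m (vmode W a 0 w) + c *: vmode W psi m w.
Proof.
have := commutator_formula w m 0 psi_odd a_even.
rewrite /= scale1r (@fsbig_nat_ord _ 1); last first.
  by case=> // j _; rewrite psi_a /= (linear_fun0 (vmode_lin_l _ _)) scaler0.
rewrite big_ord1 binz0r scale1r psi_a /= (linear_funZ _ _ (vmode_lin_l _ _)) subr0 addr0 => h.
by rewrite -[LHS](subKr (vmode W psi m (vmode W a 0 w))) -h scaleNr opprK.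
Qed.

End Charge.
End FermionPair.

(** * Weight, charge and parity of the Fock basis vectors *)

Section Fock.
Variables (psip psim : V).
Hypothesis hV : rank_two_fermion W psip psim.
Implicit Types (kl : seq nat * seq nat).

Definition fock_weight kl : R :=
  \sum_(k <- kl.1) (k%:R - 2^-1) + \sum_(l <- kl.2) (l%:R - 2^-1).

Definition fock_charge kl : R := (size kl.1)%:R - (size kl.2)%:R.

Lemma fock_consl k ks ls :
  fock W psip psim (k :: ks, ls) = vmode W psip (- k%:Z) (fock W psip psim (ks, ls)).
Proof. by []. Qed.

Lemma fock_consr l ls :
  fock W psip psim ([::], l :: ls) = vmode W psim (- l%:Z) (fock W psip psim ([::], ls)).
Proof. by []. Qed.

Lemma fock_ind (P : seq nat * seq nat -> Prop) : P ([::], [::]) ->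
  (forall l ls, P ([::], ls) -> P ([::], l :: ls)) ->
  (forall k ks ls, P (ks, ls) -> P (k :: ks, ls)) -> forall kl, P kl.
Proof.
move=> P0 Pr Pl [ks ls]; elim: ks => [|k ks IH]; last exact: Pl.
by elim: ls => // l ls IH; exact: Pr.
Qed.

Let ppodd : vparity W true psip. Proof. by case: hV => -[]. Qed.
Let pmodd : vparity W true psim. Proof. by case: hV => -[]. Qed.
Let omegaE : vconf W = 2^-1 *: (vmode W psip (- 2%:Z) (vmode W psim (-1) (vvac W))
                         + vmode W psim (- 2%:Z) (vmode W psip (-1) (vvac W))).
Proof. by case: hV. Qed.
Let pm m n v : vmode W psip m (vmode W psim n v) + vmode W psim n (vmode W psip m v)
  = if m == - n - 1 then v else 0.
Proof. by case: hV => _ /(_ m n v)[]. Qed.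
Let mp m n v : vmode W psim m (vmode W psip n v) + vmode W psip n (vmode W psim m v)
  = if m == - n - 1 then v else 0.
Proof. by rewrite addrC pm; congr (if _ then _ else _); lia. Qed.
Let pp m n v : vmode W psip m (vmode W psip n v) + vmode W psip n (vmode W psip m v) = 0.
Proof. by case: hV => _ /(_ m n v)[]. Qed.
Let mm m n v : vmode W psim m (vmode W psim n v) + vmode W psim n (vmode W psim m v) = 0.
Proof. by case: hV => _ /(_ m n v)[]. Qed.

Lemma Lzero_fock kl : Lzero W (fock W psip psim kl) = (fock_weight kl)%:C *: fock W psip psim kl.
Proof.
have omegaE' := omegaE; rewrite addrC in omegaE'.
have r2 (k : nat) : (k%:R - 2^-1 : R)%:C = k%:R - 2^-1 :> R[i].
  by rewrite rmorphB rmorph_nat fmorphV rmorph_nat.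
elim/fock_ind: kl => [|l ls IH|k ks ls IH].
- by rewrite /fock_weight !big_nil addr0 scale0r; exact: vmode_annihilation.
- rewrite fock_consr (Lzero_psi pmodd mp mm omegaE') IH (linear_funZ _ _ (vmode_lin_r _ _)).
  rewrite -scalerBl; congr (_ *: _); rewrite /fock_weight /= !big_nil !add0r big_cons.
  by rewrite rmorphD /= r2 rmorphN /=; ring.
- rewrite fock_consl (Lzero_psi ppodd pm pp omegaE) IH (linear_funZ _ _ (vmode_lin_r _ _)).
  rewrite -scalerBl; congr (_ *: _); rewrite /fock_weight /= big_cons.
  rewrite -addrA [in RHS]rmorphD /= r2 rmorphN /= -pmulrn.
  by move: (_ + _)%:C => A; ring.
Qed.

Local Notation a := (heisenberg W psip psim).

Lemma heisenberg_even : vparity W false a.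
Proof.
exact: (vmode_parity (p := true) (p' := true) _ ppodd
  (vmode_parity (p := true) (p' := false) _ pmodd (vvac_even W))).
Qed.

Lemma charge_fock kl : vmode W a 0 (fock W psip psim kl) =
  (fock_charge kl)%:C *: fock W psip psim kl.
Proof.
have hp (j : nat) : vmode W psip j%:Z a = if j == 0%N then - 1 *: psip else 0.
  rewrite /heisenberg (psi_mode_ppvac pm pp) vmode_creation scaleN1r.
  by case: ifP; rewrite ?oppr0.
have hm (j : nat) : vmode W psim j%:Z a = if j == 0%N then - (-1) *: psim else 0.
  rewrite /heisenberg (psi_mode_fpvac mp mm).
  have -> : (j%:Z == - (-1) - 1) = (j == 0%N) by lia.
  by rewrite opprK scale1r.
elim/fock_ind: kl => [|l ls IH|k ks ls IH].
- by rewrite /fock_charge subrr scale0r; exact: vmode_annihilation.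
- rewrite fock_consr (charge_psi pmodd heisenberg_even hm) IH (linear_funZ _ _ (vmode_lin_r _ _)).
  rewrite -scalerDl; congr (_ *: _); rewrite /fock_charge /= -natr1.
  by rewrite !rmorphB !rmorphD /= rmorph1; ring.
- rewrite fock_consl (charge_psi ppodd heisenberg_even hp) IH (linear_funZ _ _ (vmode_lin_r _ _)).
  rewrite -scalerDl; congr (_ *: _); rewrite /fock_charge /= -natr1.
  by rewrite !rmorphB !rmorphD /= rmorph1; ring.
Qed.

Lemma parity_fock kl : vparity W (odd (size kl.1 + size kl.2)) (fock W psip psim kl).
Proof.
elim/fock_ind: kl => [|l ls IH|k ks ls IH].
- exact: vvac_even.
- exact: (vmode_parity (- l%:Z) pmodd IH).
- exact: (vmode_parity (- k%:Z) ppodd IH).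
Qed.

End Fock.
End Commutators.

(** * The supertrace *)

Section FockSums.

(** Strictly increasing lists are listed as subsets of [m, m+n) by deciding first whether m occurs;
    this recursion is the expansion of prod (1 + f). *)
Fixpoint subs (m n : nat) : seq (seq nat) :=
  if n is n'.+1 then subs m.+1 n' ++ [seq m :: s | s <- subs m.+1 n'] else [:: [::]].

Lemma mem_subs m n s :
  (s \in subs m n) = sorted ltn s && all (fun k => m <= k < m + n)%N s.
Proof.
elim: n m s => [|n IH] m s /=.
  rewrite inE; case: s => //= k s; rewrite addn0.
  rewrite (_ : (m <= k < m)%N = false) ?andbF //; lia.
have inS t : (t \in subs m.+1 n) = sorted ltn t && all (fun k => m < k < m + n.+1)%N t.
  by rewrite IH; congr (_ && _); apply: eq_all => k; lia.
rewrite mem_cat inS; apply/orP/andP => [[/andP[h1 h2]|/mapP[t]]|[h1 h2]].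
- by split => //; apply: sub_all h2 => k; lia.
- rewrite inS => /andP[h1 h2] ->; split => /=.
    rewrite (path_sortedE ltn_trans) h1 andbT.
    by apply: sub_all h2 => k; lia.
  by rewrite (_ : (m <= m < m + n.+1)%N) //=; [apply: sub_all h2 => k; lia | lia].
- case: s h1 h2 => [|k s] //=; first by left.
  rewrite (path_sortedE ltn_trans) => /andP[ks ss] /andP[km hs].
  have [e|mk] := eqVneq k m; last first.
    left; rewrite ks ss /=; apply/andP; split; first by lia.
    by apply/allP => l ls; have := allP ks _ ls; have := allP hs _ ls; lia.
  right; rewrite e; apply/mapP; exists s => //; rewrite inS ss /=.
  by apply/allP => l ls; have := allP ks _ ls; have := allP hs _ ls; rewrite e; lia.
Qed.

Lemma uniq_subs m n : uniq (subs m n).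
Proof.
elim: n m => [|n IH] m //=; rewrite cat_uniq IH map_inj_uniq ?IH ?andbT; last by move=> s t [].
apply/hasPn => _ /mapP[s _ ->]; rewrite mem_subs /=; apply/negP.
by move=> /andP[_ /andP[]]; lia.
Qed.

Lemma sum_subs (T : comPzRingType) (f : nat -> T) m n :
  \sum_(s <- subs m n) \prod_(k <- s) f k = \prod_(i < n) (1 + f (m + i)%N).
Proof.
elim: n m => [|n IH] m /=; first by rewrite big_seq1 big_nil big_ord0.
rewrite big_cat big_map /=.
under [X in _ + X]eq_bigr do rewrite big_cons.
rewrite -mulr_sumr IH big_ord_recl addn0.
under [in RHS]eq_bigr do rewrite addnS -addSn.
by rewrite mulrDl mul1r.
Qed.

(** The cut-off is on the modes and not on the weight: a sum over this box factors exactly into the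
    K-th partial product. *)
Definition fock_states K : seq (seq nat * seq nat) :=
  [seq (s, t) | s <- subs 1 K, t <- subs 1 K].

Lemma uniq_fock_states K : uniq (fock_states K).
Proof. by rewrite allpairs_uniq ?uniq_subs // => -[? ?] [? ?] _ _ [-> ->]. Qed.

Lemma mem_fock_states K kl : (kl \in fock_states K) =
  (kl.1 \in subs 1 K) && (kl.2 \in subs 1 K).
Proof.
apply/allpairsP/andP => [[[s t] /= [h1 h2 ->]] //|[h1 h2]].
by exists kl; split => //; case: kl {h1 h2}.
Qed.

Lemma path0_sorted s : path ltn 0%N s = sorted ltn s && all (ltn 0%N) s.
Proof. by rewrite (path_sortedE ltn_trans) andbC. Qed.

Lemma fock_states_index K kl : kl \in fock_states K -> fock_index kl.
Proof.
rewrite mem_fock_states !mem_subs => /andP[/andP[h1 h2] /andP[h3 h4]].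
split; rewrite path0_sorted ?h1 ?h3 /=; first by apply: sub_all h2 => k /andP[].
by apply: sub_all h4 => k /andP[].
Qed.

Lemma fock_index_states K kl : fock_index kl -> all (leq^~ K) kl.1 -> all (leq^~ K) kl.2 ->
  kl \in fock_states K.
Proof.
move=> [/=]; rewrite !path0_sorted => /andP[h1 h2] /andP[h3 h4] a1 a2.
rewrite mem_fock_states !mem_subs h1 h3 /=; apply/andP; split; apply/allP => k kk.
  by have := allP h2 _ kk; have := allP a1 _ kk; rewrite /=; lia.
by have := allP h4 _ kk; have := allP a2 _ kk; rewrite /=; lia.
Qed.

Lemma fock_states_le K K' kl : (K <= K')%N -> kl \in fock_states K -> kl \in fock_states K'.
Proof.
move=> KK; rewrite !mem_fock_states !mem_subs => /andP[/andP[-> h2] /andP[-> h4]] /=.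
by apply/andP; split; [apply: sub_all h2|apply: sub_all h4] => k; lia.
Qed.

Lemma sum_fock_states (T : comPzRingType) (f g : nat -> T) K :
  \sum_(kl <- fock_states K) (\prod_(k <- kl.1) f k) * (\prod_(l <- kl.2) g l) =
  \prod_(l < K) ((1 + f l.+1) * (1 + g l.+1)).
Proof.
rewrite big_allpairs_dep /=.
under eq_bigr do rewrite -mulr_sumr; rewrite -mulr_suml !sum_subs -big_split /=.
by apply: eq_bigr => l _; rewrite !add1n.
Qed.

Lemma fock_states_filter K K' (T : nmodType) (f : seq nat * seq nat -> T) : (K <= K')%N ->
  \sum_(kl <- fock_states K' | kl \in fock_states K) f kl = \sum_(kl <- fock_states K) f kl.
Proof.
move=> KK; rewrite -big_filter; apply: perm_big; apply: uniq_perm.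
- by rewrite filter_uniq // uniq_fock_states.
- exact: uniq_fock_states.
by move=> kl; rewrite mem_filter andb_idr // => /(fock_states_le KK).
Qed.

Variable R : realType.

Lemma fock_weight_bound (r : R) : exists K0 : nat, forall kl K, (K0 <= K)%N ->
  fock_index kl -> fock_weight R kl = r -> kl \in fock_states K.
Proof.
(* All terms k - 1/2 are positive, since k >= 1, so none exceeds the total weight r; hence k <= r +
   1/2. *)
exists (Num.truncn (r + 1)) => kl K K0K hkl hw.
have r1 (x : nat) : (x%:R : R) <= r + 2^-1 -> (x <= K)%N.
  move=> h; apply: leq_trans K0K; rewrite truncn_ge_nat; first by lra.
  by have := ler0n R x; lra.
have pos (s : seq nat) : all (ltn 0%N) s -> forall k, k \in s -> 0 <= (k%:R - 2^-1 : R).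
  by move=> /allP h k /h /=; rewrite -(ler_nat R) => k1; lra.
have sum_ge (s : seq nat) : all (ltn 0%N) s -> 0 <= \sum_(k <- s) (k%:R - 2^-1 : R).
  by move=> h; rewrite big_seq sumr_ge0 // => k; exact: pos.
have single (s : seq nat) k : all (ltn 0%N) s -> k \in s ->
    (k%:R - 2^-1 : R) <= \sum_(k <- s) (k%:R - 2^-1).
  move=> h ks; rewrite (big_rem k ks) /= lerDl big_seq sumr_ge0 // => l /mem_rem; exact: pos.
have [/=] := hkl; rewrite !path0_sorted => /andP[_ a1] /andP[_ a2].
have s1 := sum_ge _ a1; have s2 := sum_ge _ a2.
apply: fock_index_states => //; apply/allP => k kk; apply: r1; rewrite -hw /fock_weight.
  by have := single _ _ a1 kk; lra.
by have := single _ _ a2 kk; lra.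
Qed.

End FockSums.

Lemma sum_eq_limit (R : realType) (f : R -> R[i]) (L : R[i]) :
  (forall e : R, 0 < e -> exists A0 : {fset R}, forall A : {fset R}, (A0 `<=` A)%fset ->
    cmod (\sum_(r <- A) f r - L) <= e) ->
  sum (f : R -> R[i]^o) = L.
Proof.
move=> h; rewrite /sum.
apply: (@cvg_lim R[i]^o (@norm_hausdorff R[i] R[i]^o) _ totally totally_filter (partial_sum f) L).
apply/(@cvgrPdist_le R[i] R[i]^o _ totally totally_filter) => eps eps0.
have [e e0 ->] : exists2 e : R, 0 < e & eps = e%:C.
  by case: eps eps0 => x y; rewrite ltcE /= => /andP[/eqP -> x0]; exists x.
have [A0 hA0] := h e e0; exists A0 => // A /= /hA0.
rewrite cmodBC /partial_sum -(big_seq_fsetE _ _ xpredT f) /=.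
by rewrite -lecR -normc_cmod.
Qed.

(** * The supertrace as a sum over Fock states, and the product formula *)

Section PartitionFunction.
Variables (R : realType) (V : lmodType R[i]) (W : vosa V) (psip psim : V).
Hypothesis hV : rank_two_fermion W psip psim.
Local Notation b := (fock W psip psim).
Implicit Types (kl : seq nat * seq nat).

Let bB : is_basis fock_index b. Proof. by case: hV. Qed.

Definition fock_parity kl : bool := odd (size kl.1 + size kl.2).

Lemma subspace_sum (U : set V) (I : eqType) (s : seq I) (P : pred I) (c : I -> R[i]) (f : I -> V) :
  subspace U -> (forall i, i \in s -> P i -> U (f i)) -> U (\sum_(i <- s | P i) c i *: f i).
Proof.
move=> [U0 UD] h; rewrite big_seq_cond; elim/big_rec: _ => // i v /andP[si Pi] Uv.
by apply: UD => //; exact: h.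
Qed.

(** In a vector of parity p, the Fock terms of the other parity add up to a vector lying in both
    parity subspaces, hence 0; uniqueness of Fock coefficients makes each of them vanish. *)
Lemma vparity_coef p v : vparity W p v <-> forall i, coef bB v i != 0 -> fock_parity i = p.
Proof.
have [s [us sD hs hv]] := coef_support bB v.
split=> [vp i vi|h]; last first.
  rewrite hv big_seq; apply: subspace_sum; first exact: vparity_subspace.
  move=> i _; rewrite hs => /h <-; exact: parity_fock.
apply/eqP/negP => /negP ip.
pose ve := \sum_(j <- s | fock_parity j == p) coef bB v j *: b j.
pose vo := \sum_(j <- s | fock_parity j != p) coef bB v j *: b j.
have hve : vparity W p ve.
  by apply: subspace_sum; [exact: vparity_subspace|move=> j _ /eqP <-; exact: parity_fock].
have hvo : vparity W (~~ p) vo.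
  apply: subspace_sum; first exact: vparity_subspace.
  move=> j _ jp; rewrite (_ : ~~ p = fock_parity j); first exact: parity_fock.
  by case: (fock_parity j) (p) jp => [] [].
have e : v = ve + vo by rewrite {1}hv (bigID (fun j => fock_parity j == p)).
have hvo' : vparity W p vo.
  have [_ UD] := vparity_subspace W p.
  by have := UD (-1) ve v hve vp; rewrite scaleN1r e addrA addNr add0r.
have vo0 : vo = 0.
  by case: (p) hvo hvo' => h1 h2; [exact: vparity_cap h1 h2|exact: vparity_cap h2 h1].
have := @coef_sum_seq _ _ _ _ _ bB s
  (fun j => if fock_parity j != p then coef bB v j else 0) i us sD.
rewrite hs vi ip => h; case/negP: vi; rewrite -h.
rewrite (_ : \sum_(j <- s) _ = vo); last first.
  rewrite /vo [RHS]big_mkcond; apply: eq_bigr => j _.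
  by case: ifP => _; rewrite ?scale0r.
by rewrite vo0 -(scale0r 0) coefZ mul0r.
Qed.

Lemma weight_space_coef r v :
  weight_space W r v <-> forall i, coef bB v i != 0 -> fock_weight R i = r.
Proof.
have hL : linear (Lzero W) by exact: vmode_lin_r.
have hD i : fock_index i -> Lzero W (b i) = (fock_weight R i)%:C *: b i.
  by move=> _; exact: Lzero_fock.
have := diag_eigen bB hL hD v r%:C.
by split=> [/H h i /h /complexI //|h]; apply/H => i /h ->.
Qed.

Lemma supertrace_weight_sum (X : V -> V) (mu : seq nat * seq nat -> R[i]) (r : R) (K : nat) :
  linear X -> (forall i, fock_index i -> X (b i) = mu i *: b i) ->
  (forall kl, fock_index kl -> fock_weight R kl = r -> kl \in fock_states K) ->
  supertrace_weight W X r =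
  \sum_(i <- fock_states K | fock_weight R i == r) (-1) ^+ (fock_parity i) * mu i.
Proof.
move=> hX hmu hK.
have tr p : trace_on (weight_space W r `&` vparity W p) X =
    \sum_(i <- fock_states K | (fock_weight R i == r) && (fock_parity i == p)) mu i.
  rewrite -big_filter; apply: (@trace_on_diag _ _ _ _ _ bB _ X mu) => //.
  - by rewrite filter_uniq // uniq_fock_states.
  - by move=> i; rewrite mem_filter => /andP[_ /fock_states_index].
  - move=> v; split=> [[/weight_space_coef h1 /vparity_coef h2] i vi|h].
      rewrite mem_filter h1 // h2 // !eqxx /=; apply: hK; last exact: h1.
      by apply: contrapT => iD; move: vi; rewrite (coef_notin bB v iD) eqxx.
    split; [apply/weight_space_coef|apply/vparity_coef] => i /h;
      by rewrite mem_filter => /andP[/andP[/eqP ? /eqP ?]].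
  - by move=> i; rewrite mem_filter => /andP[_ /fock_states_index]; exact: hmu.
rewrite /supertrace_weight !tr (bigID (fun i => fock_parity i) (fun i => fock_weight R i == r)) /=.
rewrite addrC -sumrN; congr (_ + _).
  apply: eq_big => i; first by case: (fock_parity i); rewrite ?andbT ?andbF.
  by move=> /andP[_ /eqP ->]; rewrite expr0 mul1r.
by apply: eq_big => i; [rewrite eqb_id|move=> /andP[_ /eqP ->]; rewrite expr1 mulN1r].
Qed.

(** [supertrace] is an unconditional sum over real weights, whereas L is a limit over boxes of
    modes. Absolute summability reconciles the two orders: each weight has finitely many Fock
    states, and the states outside a large box contribute little in any grouping. *)
Lemma supertrace_sum (X : V -> V) (mu : seq nat * seq nat -> R[i]) (B : R) (L : R[i]) :
  linear X -> (forall i, fock_index i -> X (b i) = mu i *: b i) ->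
  (forall K, \sum_(i <- fock_states K) cmod (mu i) <= B) ->
  climit (fun K => \sum_(i <- fock_states K) (-1) ^+ (fock_parity i) * mu i) L ->
  supertrace W X = L.
Proof.
move=> hX hmu hB hL.
pose t i := (-1) ^+ (fock_parity i) * mu i.
have tE i : cmod (t i) = cmod (mu i).
  by rewrite cmodM cmodX cmodN cmod1 expr1n mul1r.
apply: sum_eq_limit => e e0; have e2 : 0 < e / 2 by rewrite divr_gt0.
pose q K := \sum_(i <- fock_states K) cmod (mu i).
have qd K K' : (K <= K')%N ->
    q K' - q K = \sum_(i <- fock_states K' | i \notin fock_states K) cmod (mu i).
  move=> KK; rewrite /q (bigID (fun i => i \in fock_states K)) /=.
  by rewrite fock_states_filter // addrAC subrr add0r.
have nd : {homo q : m n / (m <= n)%N >-> m <= n}.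
  by move=> m n mn; rewrite -subr_ge0 qd // sumr_ge0 // => i _; exact: cmod_ge0.
have [K1 hK1] := nondecreasing_tail_small nd hB e2.
have [K2 hK2] := (climitP _ _).1 hL _ e2.
(* A finite set A of weights that contains all weights of the box K1 can omit only states outside
   K1. A larger box K then contains every state whose weight is in A. *)
exists [fset fock_weight R i | i in fock_states K1]%fset => A hA.
have [KA hKA] : exists KA : nat, forall r, r \in A -> forall kl K, (KA <= K)%N ->
    fock_index kl -> fock_weight R kl = r -> kl \in fock_states K.
  pose bound r := projT1 (cid (@fock_weight_bound R r)).
  exists (\max_(r <- A) bound r)%N => r rA kl K hK.
  apply: (projT2 (cid (@fock_weight_bound R r))); apply: leq_trans hK.
  by rewrite (big_rem r rA) /= leq_maxl.
pose K := maxn (maxn K1 K2) KA.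
have K1K : (K1 <= K)%N by rewrite /K; lia.
have K2K : (K2 <= K)%N by rewrite /K; lia.
have -> : \sum_(r <- A) supertrace_weight W X r =
    \sum_(i <- fock_states K | fock_weight R i \in A) t i.
  rewrite (eq_big_seq (fun r => \sum_(i <- fock_states K | fock_weight R i == r) t i)); last first.
    move=> r rA; apply: supertrace_weight_sum => // kl; apply: hKA => //.
    exact: leq_maxr.
  rewrite big_seq (exchange_big_dep (fun i => fock_weight R i \in A)) /=; last first.
    by move=> r i rA /eqP ->.
  apply: eq_bigr => i iA; rewrite big_mkcond.
  rewrite (bigD1_seq (fock_weight R i)) ?fset_uniq //= iA eqxx big1 ?addr0 // => r.
  by rewrite eq_sym => /negPf ->; rewrite andbF.
have hPK := hK2 K K2K.
set S := \sum_(i <- _ | _) _.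
have hS : cmod (\sum_(i <- fock_states K) t i - S) <= e / 2.
  have -> : \sum_(i <- fock_states K) t i - S =
      \sum_(i <- fock_states K | fock_weight R i \notin A) t i.
    by rewrite (bigID (fun i => fock_weight R i \in A)) /= addrAC subrr add0r.
  apply: le_trans (cmod_sum _ _ _) _; apply: le_trans (ltW (hK1 K)); rewrite qd //.
  rewrite [leLHS]big_mkcond [leRHS]big_mkcond big_seq [leRHS]big_seq.
  apply: ler_sum => i iK; rewrite tE; case: ifP => [iA|_]; last by case: ifP => _; rewrite ?cmod_ge0.
  rewrite ifT //; apply: contra iA => iK1; apply: (fsubsetP hA).
  by apply/imfsetP; exists i.
have -> : S - L = (\sum_(i <- fock_states K) t i - L) - (\sum_(i <- fock_states K) t i - S) by ring.
apply: le_trans (cmodD _ _) _; rewrite cmodN.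
by move: hPK hS; rewrite -/t; lra.
Qed.

Lemma sum_half_integers (s : seq nat) (x y t : R[i]) :
  \sum_(k <- s) (x + (k%:R - 2^-1 + y) * t) =
  (size s)%:R * (x + y * t) + (\sum_(k <- s) (k%:R - 2^-1 : R))%:C * t.
Proof.
rewrite big_split -mulr_suml big_split !big_const_seq !count_predT !iter_addr_0 /=.
set S := \sum_(k <- s) _.
have -> : (\sum_(k <- s) (k%:R - 2^-1 : R))%:C = S.
  rewrite rmorph_sum; apply: eq_bigr => k _.
  by rewrite rmorphB fmorphV !rmorph_nat.
by rewrite -(mulr_natl x) -(mulr_natl y) mulrDl mulrDr mulrA [S * t + _]addrC addrA.
Qed.

Section FockEigenvalues.
Variables (a be : R) (tau : R[i]).
Hypothesis t0 : 0 < complex.Im tau.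
Let kappa := be + 2^-1.
Let w := nome (a%:C - be%:C * tau).
Let q := nome tau.
Let pref := nome ((kappa ^+ 2 / 2 - 24^-1)%:C * tau).

Let lamf kl : R[i] := (2 * pi * a)%:C * 'i%C * (fock_charge R kl)%:C.
Let lamq kl : R[i] := (2 * pi)%:C * 'i%C * tau *
  ((fock_weight R kl)%:C - kappa%:C * (fock_charge R kl)%:C + (kappa ^+ 2 / 2 - 24^-1)%:C).

Let fock_eigenvalue kl : R[i] := cexp (lamq kl) * cexp (lamf kl).

Lemma nome_sum (I : Type) (r : seq I) (P : pred I) (F : I -> R[i]) :
  nome (\sum_(i <- r | P i) F i) = \prod_(i <- r | P i) nome (F i).
Proof. by rewrite /nome mulr_sumr cexp_sum. Qed.

(** As kappa = beta + 1/2, the mode psi^+(-k) contributes the exponent alpha + (k - 1/2 - kappa)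
    tau, that is w q^(k-1), and psi^-(-l) contributes w^-1 q^l. *)
Lemma fock_eigenvalue_prod kl : fock_index kl -> fock_eigenvalue kl =
  pref * ((\prod_(k <- kl.1) (w * q ^+ k.-1)) * (\prod_(l <- kl.2) (w^-1 * q ^+ l))).
Proof.
have hw k : (0 < k)%N -> w * q ^+ k.-1 =
    nome (a%:C + ((k%:R - 2^-1) - kappa%:C) * tau).
  case: k => // k _; rewrite /w /q -nomeMn -nomeD; congr nome.
  by rewrite /kappa rmorphD /= fmorphV rmorph_nat -natr1; field.
have hv l : w^-1 * q ^+ l = nome (- a%:C + ((l%:R - 2^-1) + kappa%:C) * tau).
  rewrite /w /q -nomeMn -nomeN -nomeD; congr nome.
  by rewrite /kappa rmorphD /= fmorphV rmorph_nat; field.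
move=> [/=]; rewrite path0_sorted => /andP[_ h1] _.
rewrite [X in _ * (X * _)](_ : _ = nome (\sum_(k <- kl.1) (a%:C + ((k%:R - 2^-1) - kappa%:C) * tau))); last first.
  rewrite nome_sum; apply: eq_big_seq => k /(allP h1) k0; exact: hw.
rewrite [X in _ * (_ * X)](_ : _ = nome (\sum_(l <- kl.2) (- a%:C + ((l%:R - 2^-1) + kappa%:C) * tau))); last first.
  by rewrite nome_sum; apply: eq_bigr => l _; exact: hv.
rewrite !sum_half_integers.
have h A B C : nome A * (nome B * nome C) = nome (A + (B + C)) :> R[i] by rewrite !nomeD.
rewrite [RHS]h /fock_eigenvalue -[LHS]cexpD [RHS]/nome; apply: (congr1 (@cexp R)).
rewrite /lamq /lamf /piI /fock_weight /fock_charge.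
move: (\sum_(k <- _) _) (\sum_(k <- _) _) ((kappa ^+ 2 / 2 - 24^-1)%:C) => A B c.
have -> : (B + A)%:C = A%:C + B%:C by rewrite addrC rmorphD.
have -> : ((size kl.1)%:R - (size kl.2)%:R)%:C = (size kl.1)%:R - (size kl.2)%:R :> R[i].
  by rewrite rmorphB !rmorph_nat.
have -> : (2 * pi * a)%:C = 2 * pi%:C * a%:C :> R[i] by rewrite !rmorphM rmorph_nat.
have -> : (2 * pi)%:C = 2 * pi%:C :> R[i] by rewrite rmorphM rmorph_nat.
move: A%:C B%:C pi%:C a%:C kappa%:C => a1 b1 p a' k.
ring.
Qed.

Lemma scaled_charge_linear (c : R[i]) : linear (fun v => c *: vmode W (heisenberg W psip psim) 0 v).
Proof. by move=> x u v; rewrite vmode_lin_r scalerDr !scalerA [c * x]mulrC. Qed.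

Lemma twisted_exponent_linear (c x y : R[i]) : linear (fun v => c *: (Lzero W v -
  x *: vmode W (heisenberg W psip psim) 0 v + y *: v)).
Proof.
move=> z u v; rewrite [z *: (c *: _)]scalerA [z * c]mulrC -scalerA -scalerDr; congr (c *: _).
rewrite /Lzero !vmode_lin_r !scalerDr scalerN opprD.
rewrite [x *: (z *: _)]scalerA [y *: (z *: _)]scalerA [x * z]mulrC [y * z]mulrC -!scalerA.
by rewrite [_ + (- _ - _)]addrACA [LHS]addrACA.
Qed.

Lemma fermion_aut_linear : linear (fermion_aut W psip psim a).
Proof.
apply: (@opexp_linear _ _ _ _ _ bB _ lamf) => [|kl _]; first exact: scaled_charge_linear.
by rewrite charge_fock // scalerA.
Qed.

Lemma fermion_aut_fock kl : fock_index kl -> fermion_aut W psip psim a (b kl) = cexp (lamf kl) *: b kl.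
Proof.
apply: (@opexp_diag _ _ _ _ _ bB _ lamf) => [|i _]; first exact: scaled_charge_linear.
by rewrite charge_fock // scalerA.
Qed.

Lemma twisted_exponent_fock i : fock_index i -> (2 * pi)%:C * 'i%C * tau *:
    (Lzero W (b i) - kappa%:C *: vmode W (heisenberg W psip psim) 0 (b i)
     + (kappa ^+ 2 / 2 - 24^-1)%:C *: b i) = lamq i *: b i.
Proof.
move=> _; rewrite charge_fock // Lzero_fock // scalerA -scalerBl -scalerDl scalerA //.
Qed.

Lemma twisted_qL0_linear : linear (twisted_qL0 W psip psim be tau).
Proof. by apply: (@opexp_linear _ _ _ _ _ bB _ lamq); [exact: twisted_exponent_linear|exact: twisted_exponent_fock]. Qed.

Lemma twisted_qL0_fock kl : fock_index kl ->
  twisted_qL0 W psip psim be tau (b kl) = cexp (lamq kl) *: b kl.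
Proof. by apply: (@opexp_diag _ _ _ _ _ bB _ lamq); [exact: twisted_exponent_linear|exact: twisted_exponent_fock]. Qed.

Lemma signed_fock_eigenvalue_sum K :
  \sum_(i <- fock_states K) (-1) ^+ (fock_parity i) * fock_eigenvalue i = pref * thetaN w q K.
Proof.
have sgn (s : seq nat) (f : nat -> R[i]) : \prod_(k <- s) (- f k) = (-1) ^+ size s * \prod_(k <- s) f k.
  elim: s => [|k s IH]; first by rewrite !big_nil mulr1.
  by rewrite !big_cons IH exprS; ring.
rewrite (eq_big_seq (fun i : seq nat * seq nat => pref * ((\prod_(k <- i.1) (- (w * q ^+ k.-1))) *
  (\prod_(l <- i.2) (- (w^-1 * q ^+ l)))))); last first.
  move=> i /fock_states_index /fock_eigenvalue_prod ->; rewrite !sgn /fock_parity signr_odd exprD.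
  by ring.
rewrite -mulr_sumr (sum_fock_states (fun k => - (w * q ^+ k.-1)) (fun l => - (w^-1 * q ^+ l))) //.
Qed.

(** The product expansion is repeated with absolute values; the resulting products of 1 + |w| |q|^l
    are bounded by exponentials of geometric sums. *)
Lemma fock_eigenvalue_sum_bounded : exists B, forall K,
  \sum_(i <- fock_states K) cmod (fock_eigenvalue i) <= B.
Proof.
have q1 : cmod q < 1 by exact: cmod_nome_lt1.
have hE := fock_eigenvalue_prod; clearbody w q pref.
exists (cmod pref * (expR (cmod w * (1 - cmod q)^-1) * expR (cmod w^-1 * (1 - cmod q)^-1))) => K.
rewrite (eq_big_seq (fun i : seq nat * seq nat => cmod pref * ((\prod_(k <- i.1) (cmod w * cmod q ^+ k.-1)) *
  (\prod_(l <- i.2) (cmod w^-1 * cmod q ^+ l))))); last first.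
  move=> i /fock_states_index /hE ->; rewrite !cmodM !cmod_prod.
  congr (_ * (_ * _)); apply: eq_bigr => k _; by rewrite cmodM cmodX.
rewrite -mulr_sumr (sum_fock_states (fun k => cmod w * cmod q ^+ k.-1) (fun l => cmod w^-1 * cmod q ^+ l)).
rewrite ler_wpM2l ?cmod_ge0 // big_split /=.
have q0 := cmod_ge0 q.
have gs := @geometric_sum_le R (cmod q) K; rewrite q0 q1 in gs; have {}gs := gs isT.
have bd (c : R) (f : nat -> R) : 0 <= c -> (forall l, 0 <= f l <= cmod q ^+ l) ->
    0 <= \prod_(l < K) (1 + c * f l) <= expR (c * (1 - cmod q)^-1).
  move=> c0 hf; rewrite prodr_ge0 => [|l _]; last first.
    by rewrite addr_ge0 // mulr_ge0 //; case/andP: (hf l).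
  apply: le_trans (prod1D_le_expR _ _ _) _ => [l|].
    by rewrite mulr_ge0 //; case/andP: (hf l).
  rewrite ler_expR -mulr_sumr ler_wpM2l //; apply: le_trans gs.
  by apply: ler_sum => l _; case/andP: (hf l).
have /andP[A0 A1] := bd (cmod w) (fun l => cmod q ^+ l) (cmod_ge0 w)
  (fun l => introT andP (conj (exprn_ge0 l q0) (lexx _))).
have h2 l : 0 <= cmod q ^+ l.+1 <= cmod q ^+ l.
  by rewrite exprn_ge0 // exprS ler_piMl ?exprn_ge0 // ltW.
have /andP[B0 B1] := bd (cmod w^-1) (fun l => cmod q ^+ l.+1) (cmod_ge0 _) h2.
exact: ler_pM.
Qed.

Lemma partition_function_pair :
  partition_function W psip psim (a, be) tau = ztheta (a, be) tau.
Proof.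
have [B hB] := fock_eigenvalue_sum_bounded.
apply: (supertrace_sum (mu := fock_eigenvalue) _ _ hB) => [x u v|i iD|].
- by rewrite /= twisted_qL0_linear fermion_aut_linear.
- rewrite /= twisted_qL0_fock // (linear_funZ _ _ fermion_aut_linear) fermion_aut_fock //.
  by rewrite scalerA.
- rewrite (_ : (fun K => _) = fun K => pref * thetaN w q K); last first.
    by apply/funext => K; exact: signed_fock_eigenvalue_sum.
  by apply: climitZ; apply: thetaP; exact: cmod_nome_lt1.
Qed.

End FockEigenvalues.

Lemma partition_function_ztheta x tau : 0 < complex.Im tau ->
  partition_function W psip psim x tau = ztheta x tau.
Proof. by case: x => a be; exact: partition_function_pair. Qed.

End PartitionFunction.

Theorem proposition6p12 (R : realType) (V : lmodType R[i]) (W : vosa V)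
    (psip psim : V) (hV : rank_two_fermion W psip psim) :
  exists eps : 'M[int]_2 -> R * R -> R[i],
    [/\ multiplier_system eps,
        forall eps' : 'M[int]_2 -> R * R -> R[i], multiplier_system eps' ->
          forall (g : 'M[int]_2) (fg : R * R), \det g = 1 -> eps' g fg = eps g fg,
        forall (g : 'M[int]_2) (fg : R * R), \det g = 1 -> `|eps g fg| = 1 &
        forall (g : 'M[int]_2) (fg : R * R) (tau : R[i]),
          \det g = 1 -> upper_half_plane tau ->
          partition_function W psip psim (twist_act g fg) (moebius g tau)
          = eps g fg * partition_function W psip psim fg tau].
Proof.
exists (@multiplier R); split => [|e he g x dg|g x dg|g x tau dg t0].
- exact: multiplier_is_system.
- exact: (multiplier_system_unique he (multiplier_is_system R) x dg).
- exact: multiplier_unitary.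
- rewrite (partition_function_ztheta hV _ t0) (partition_function_ztheta hV _ (Im_moebius dg t0)).
  exact: ztheta_modular.
Qed.
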